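(* Let $\beta>0$ and $a,b\ge0$ be fixed. For each $n\ge 1$ let $(x_1,\dots,x_n)$ have the Jacobi distribution $$\mathrm{cst}\,|\Delta(x_1,\dots,x_n)|^\beta\prod_{j=1}^n(2-x_j)^a(2+x_j)^b\,dx_1\cdots dx_n$$ on $(-2,2)^n$, and let $\det^{(+)}=\prod_{k=1}^n(2-x_k)$ and $\det^{(-)}=\prod_{k=1}^n(2+x_k)$. Then, as $n\to\infty$, $$\left(\frac{\log\det^{(+)}+\left(\frac12-\frac{2a+1}{\beta}\right)\log n}{\sqrt{\frac{2}{\beta}\log n}},\ \frac{\log\det^{(-)}+\left(\frac12-\frac{2b+1}{\beta}\right)\log n}{\sqrt{\frac{2}{\beta}\log n}}\right)\ \xrightarrow{\text{law}}\ (\mathcal N_1,\mathcal N_2),$$ with $\mathcal N_1$ and $\mathcal N_2$ independent standard (real) normal variables.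
   Context: $\Delta(x_1,\dots,x_n)=\prod_{1\le k<l\le n}(x_l-x_k)$ is the Vandermonde determinant and $\mathrm{cst}$ is the normalization constant making the expression a probability measure. *)

(* Defs.v *)
From HB Require Import structures.
From mathcomp Require Import all_boot all_order all_algebra.
From mathcomp Require Import all_classical all_reals all_analysis.

Set Implicit Arguments.
Unset Strict Implicit.
Unset Printing Implicit Defensive.

Import Order.TTheory GRing.Theory Num.Theory.
Import numFieldNormedType.Exports.

Local Open Scope classical_set_scope.
Local Open Scope ring_scope.

Section lebesgue_tuple.
Context {R : realType}.

Definition tuple_cons n (p : measurableTypeR R * n.-tuple R) : n.+1.-tuple R :=
  [tuple of p.1 :: p.2].

Definition tuple_uncons n (t : n.+1.-tuple R) : measurableTypeR R * n.-tuple R :=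
  (thead t, [tuple of behead t]).

Lemma tuple_consK n : cancel (@tuple_cons n) (@tuple_uncons n).
Proof. by move=> [x t]; congr pair; exact: val_inj. Qed.

Lemma tuple_unconsK n : cancel (@tuple_uncons n) (@tuple_cons n).
Proof. by move=> t; rewrite /tuple_cons /= -tuple_eta. Qed.

Lemma measurable_tuple_cons n :
  measurable_fun [set: measurableTypeR R * n.-tuple R] (@tuple_cons n).
Proof. exact: measurable_cons. Qed.

Lemma measurable_tuple_uncons n :
  measurable_fun [set: n.+1.-tuple R] (@tuple_uncons n).
Proof.
apply: measurable_fun_pair; last exact: measurable_behead.
exact: measurable_tnth.
Qed.

Section lebesgue_cons.
Variables (n : nat) (mu : {sigma_finite_measure set (n.-tuple R) -> \bar R}).

Definition lebesgue_cons : set (n.+1.-tuple R) -> \bar R :=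
  pushforward (@lebesgue_measure R \x mu)%E (@tuple_cons n).

Let lebesgue_cons0 : lebesgue_cons set0 = 0%E.
Proof. by rewrite /lebesgue_cons /pushforward preimage_set0 measure0. Qed.

Let lebesgue_cons_ge0 A : (0 <= lebesgue_cons A)%E.
Proof. exact: (measure_ge0 (@lebesgue_measure R \x mu)%E). Qed.

Let lebesgue_cons_sigma_additive : semi_sigma_additive lebesgue_cons.
Proof.
apply: measure_semi_sigma_additive; exact: measurable_tuple_cons.
Qed.

HB.instance Definition _ := isMeasure.Build _ _ _ lebesgue_cons
  lebesgue_cons0 lebesgue_cons_ge0 lebesgue_cons_sigma_additive.

Let sigma_finite_lebesgue_cons : sigma_finite setT lebesgue_cons.
Proof.
have /sigma_finiteP[F [TF ndF Foo]] := sigma_finiteT (@lebesgue_measure R).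
have /sigma_finiteP[G [TG ndG Goo]] := sigma_finiteT mu.
exists (fun k => @tuple_uncons n @^-1` (F k `*` G k)).
  rewrite -preimage_bigcup (_ : \bigcup_k _ = setT) ?preimage_setT//.
  rewrite -setXTT TF TG predeqE => -[x y]; split.
    by move=> [k _ [/= ? ?]]; split; exists k.
  move=> [/= [k _ Fkx] [l _ Gly]]; exists (maxn k l) => //; split.
  - by move: x Fkx; exact/subsetPset/ndF/leq_maxl.
  - by move: y Gly; exact/subsetPset/ndG/leq_maxr.
move=> k; have [mF Fk] := Foo k; have [mG Gk] := Goo k; split.
  rewrite -[X in measurable X]setTI.
  by apply: measurable_tuple_uncons => //; exact: measurableX.
rewrite /lebesgue_cons /pushforward -comp_preimage.
rewrite (_ : _ \o _ = id) ?preimage_id; last first.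
  by apply/funext => p; exact: tuple_consK.
by rewrite product_measure1E// lte_mul_pinfty// ge0_fin_numE.
Qed.

HB.instance Definition _ :=
  Measure_isSigmaFinite.Build _ _ _ lebesgue_cons sigma_finite_lebesgue_cons.

End lebesgue_cons.

(* Lebesgue measure on R^n, as the n-fold product of the one on R; on the
   one-point space R^0 it is the Dirac mass. *)
Fixpoint lebesgue_tuple n : {sigma_finite_measure set (n.-tuple R) -> \bar R} :=
  match n with
  | 0 => \d_([tuple] : 0.-tuple R)
  | m.+1 => lebesgue_cons (lebesgue_tuple m)
  end.

End lebesgue_tuple.

Section jacobi.
Context {R : realType}.
Implicit Types (beta a b : R) (n : nat).

Definition vandermonde n (x : n.-tuple R) : R :=
  \prod_(k < n) \prod_(l < n | (k < l)%N) (tnth x l - tnth x k).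

Definition jacobi_weight beta a b n (x : n.-tuple R) : R :=
  `|vandermonde x| `^ beta *
  \prod_(j < n) ((2 - tnth x j) `^ a * (2 + tnth x j) `^ b).

Definition jacobi_support n : set (n.-tuple R) :=
  [set x | forall j, -2 < tnth x j < 2].

Definition jacobi_cst beta a b n : R :=
  (fine (\int[lebesgue_tuple n]_(x in @jacobi_support n)
           (jacobi_weight beta a b x)%:E)%E)^-1.

Definition jacobi_law beta a b n (A : set (n.-tuple R)) : \bar R :=
  ((jacobi_cst beta a b n)%:E *
   \int[lebesgue_tuple n]_(x in A `&` @jacobi_support n)
     (jacobi_weight beta a b x)%:E)%E.

Definition det_plus n (x : n.-tuple R) : R := \prod_(k < n) (2 - tnth x k).

Definition det_minus n (x : n.-tuple R) : R := \prod_(k < n) (2 + tnth x k).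

(* The two coordinates are the same function of (det_plus, a) and
   (det_minus, b). *)
Definition normalized_log beta (c : R) n (D : R) : R :=
  (ln D + (1 / 2 - (2 * c + 1) / beta) * ln n%:R) /
  Num.sqrt (2 / beta * ln n%:R).

End jacobi.

Section convergence_in_law.
Context {R : realType}.

Definition has_law d d' (T : measurableType d) (T' : measurableType d')
    (P : probability T R) (X : {RV P >-> T'}) (mu : set T' -> \bar R) : Prop :=
  forall A, measurable A -> distribution P X A = mu A.

Definition independent_RV2 d (T : measurableType d) (P : probability T R)
    (X Y : {RV P >-> R}) : Prop :=
  forall A B : set R, measurable A -> measurable B ->
    P (X @^-1` A `&` Y @^-1` B) = (P (X @^-1` A) * P (Y @^-1` B))%E.

(* The random elements may live on different probability spaces. *)
Definition cvg_in_law (V : topologicalType)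
    (d : nat -> measure_display) (T : forall n, measurableType (d n))
    (P : forall n, probability (T n) R) (Y : forall n, T n -> V)
    d' (O : measurableType d') (Q : probability O R) (Z : O -> V) : Prop :=
  forall f : V -> R, continuous f -> bounded_fun f ->
    ('E_(P n)[f \o Y n] @[n --> \oo] --> 'E_Q[f \o Z])%E.

End convergence_in_law.

(* Main.v *)
(* Multiplying the Jacobi weight by (det^(+))^s (det^(-))^r only replaces (a, b)
   by (a + s, b + r), so the joint moment generating function of the two
   logarithms is a ratio Z(a + s, b + r) / Z(a, b) of Selberg integrals.
   Aomoto's integration by parts, applied to the elementary symmetric functions
   of t_i = 2 - x_i or t_i = 2 + x_i, gives this ratio exactly when one parameter
   grows by 1.  For other shifts no Gamma function is needed: 4^(-na) Z(a, b) is
   nonincreasing in a, which bounds the effect of a shift s at a + m, and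
   telescoping the exact ratio from a to a + m as m tends to infinity gives
   ln Z(a + s, b) - ln Z(a, b) up to an error O(|s|) that is uniform in n.  With
   s, r of order (ln n)^(-1/2) the generating function of the normalised pair
   tends to exp((l^2 + m^2) / 2) for all real l, m.

   Such convergence implies convergence in law without characteristic functions:
   up to arbitrarily small multiples of cosh(c x) cosh(c y), sums of exponentials
   approximate monomials, hence sin(x / L), hence polynomials in sin(x / L) and
   sin(y / L), hence, by Bernstein's theorem, all bounded continuous functions. *)

Require Import Defs.
From mathcomp Require Import all_boot all_order all_algebra.
From mathcomp Require Import all_classical all_reals all_analysis.
From mathcomp Require Import measurable_realfun ring lra.

Set Implicit Arguments.
Unset Strict Implicit.
Unset Printing Implicit Defensive.

Import Order.TTheory GRing.Theory Num.Theory.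
Import numFieldNormedType.Exports.

Local Open Scope classical_set_scope.
Local Open Scope ring_scope.

(** * Integration over tuples *)

Section tuple_integral.
Context {R : realType}.
Local Notation mu := (@lebesgue_measure R).
Local Open Scope ereal_scope.

(** The integrands are singular: the shifted exponents can be slightly negative, and for small beta
    the Vandermonde factor is not differentiable where two points meet. Integration by parts is
    therefore carried out for a regularised weight, and the regularisation is removed by dominated
    convergence; for the same reason the integrals are studied for all exponents > -1. In the
    expansion of ln Z the error must carry a factor |s| with a constant free of n: s^2 ln n stays
    bounded, whereas the linear terms s ln n diverge and have to match the centring exactly. The
    passage from unit steps to arbitrary s follows the uniqueness argument of Bohr and Mollerup,
    with monotonicity in the place of log-convexity. Asymptotic independence has a simple source: at
    order ln n, the effect of shifting one parameter does not depend on the other. Convergence is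
    first known on real exponentials only, which are unbounded, so every approximation is measured
    against an exponential weight whose own expectations converge. *)

Lemma ge0_integral_lebesgue_tupleS n (f : n.+1.-tuple R -> \bar R) :
  measurable_fun [set: n.+1.-tuple R] f -> (forall x, 0 <= f x) ->
  \int[lebesgue_tuple n.+1]_x f x =
  \int[mu \x lebesgue_tuple n]_p f (tuple_cons p).
Proof.
move=> mf f0; have mc := @measurable_tuple_cons R n.
rewrite [LHS](_ : _ = \int[pushforward (mu \x lebesgue_tuple n) (@tuple_cons R n)]_x f x).
  by rewrite ge0_integral_pushforward.
by [].
Qed.

Lemma integral_lebesgue_tupleS n (f : n.+1.-tuple R -> \bar R) :
  (lebesgue_tuple n.+1).-integrable setT f ->
  \int[lebesgue_tuple n.+1]_x f x =
  \int[mu \x lebesgue_tuple n]_p f (tuple_cons p).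
Proof.
move=> /integrableP[mf intf]; have mc := @measurable_tuple_cons R n.
rewrite [LHS](_ : _ = \int[pushforward (mu \x lebesgue_tuple n) (@tuple_cons R n)]_x f x)//.
rewrite integral_pushforward//.
apply/integrableP; split; first exact: measurableT_comp.
move: intf; rewrite ge0_integral_lebesgue_tupleS//.
exact: measurableT_comp.
Qed.

Lemma integrable_lebesgue_tupleS n (f : n.+1.-tuple R -> \bar R) :
  (lebesgue_tuple n.+1).-integrable setT f ->
  (mu \x lebesgue_tuple n).-integrable setT (f \o @tuple_cons R n).
Proof.
move=> /integrableP[mf intf]; have mc := @measurable_tuple_cons R n.
apply/integrableP; split; first exact: measurableT_comp.
move: intf; rewrite ge0_integral_lebesgue_tupleS//.
exact: measurableT_comp.
Qed.

Lemma measurable_prod_tnth n (f : R -> R) : measurable_fun setT f ->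
  measurable_fun [set: n.-tuple R] (fun x : n.-tuple R => \prod_(i < n) f (tnth x i))%R.
Proof.
move=> mf; apply: measurable_prod => i _.
apply: measurableT_comp => //; exact: measurable_tnth.
Qed.

Lemma integral_prod_tnth n (f : R -> R) : measurable_fun setT f ->
  (forall x, 0 <= f x)%R ->
  \int[lebesgue_tuple n]_x (\prod_(i < n) f (tnth x i))%:E =
  (\int[mu]_u (f u)%:E) ^+ n.
Proof.
move=> mf f0; elim: n => [|n IH].
  rewrite expe0 /= integral_dirac//; last first.
    by apply/measurable_EFinP; exact: measurable_prod_tnth.
  by rewrite big_ord0 mule1 diracE mem_set.
have mp m : measurable_fun [set: m.-tuple R]
    (fun x => (\prod_(i < m) f (tnth x i))%:E).
  by apply/measurable_EFinP; exact: measurable_prod_tnth.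
have p0 m (x : m.-tuple R) : 0 <= (\prod_(i < m) f (tnth x i))%:E.
  by rewrite lee_fin prodr_ge0.
rewrite ge0_integral_lebesgue_tupleS//.
rewrite fubini_tonelli1//; last first.
  exact: (measurableT_comp (mp n.+1) (@measurable_tuple_cons R n)).
rewrite expeS -IH -ge0_integralZr//; last 3 first.
- exact/measurable_EFinP.
- by move=> x _; rewrite lee_fin.
- exact: integral_ge0.
apply: eq_integral => u _; rewrite /fubini_F /= -ge0_integralZl_EFin//.
apply: eq_integral => x _; rewrite -EFinM big_ord_recl; congr (_ * _)%:E.
by apply: eq_bigr => i _; rewrite tnthS.
- by move=> x _; exact: p0.
- exact: mp.
Qed.

Definition tuple_upd n (x : n.-tuple R) (i : 'I_n) (u : R) : n.-tuple R :=
  [tuple if j == i then u else tnth x j | j < n].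

Lemma tnth_upd n (x : n.-tuple R) i u j :
  tnth (tuple_upd x i u) j = if j == i then u else tnth x j.
Proof. by rewrite tnth_mktuple. Qed.

Lemma tuple_upd_cons0 n (x : n.-tuple R) u v :
  tuple_upd (tuple_cons (v, x)) ord0 u = tuple_cons (u, x).
Proof.
apply: eq_from_tnth => j; rewrite tnth_upd.
by case: (unliftP ord0 j) => [k ->|->] //=; rewrite !tnthS.
Qed.

Lemma tuple_upd_consS n (x : n.-tuple R) i u v :
  tuple_upd (tuple_cons (v, x)) (lift ord0 i) u = tuple_cons (v, tuple_upd x i u).
Proof.
apply: eq_from_tnth => j; rewrite tnth_upd.
case: (unliftP ord0 j) => [k ->|->] //=; rewrite !tnthS (inj_eq lift_inj).
by rewrite tnth_upd.
Qed.

(** Fubini with the i-th integral innermost. The induction peels off head coordinates until [i] is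
    the head; the bound by a product survives because freezing the head at [v] only replaces [C] by
    [C * h v]. *)
Lemma integral_tuple_eq0 n (i : 'I_n) (g : n.-tuple R -> R) (h : R -> R) :
  measurable_fun [set: n.-tuple R] g -> measurable_fun setT h ->
  mu.-integrable setT (EFin \o h) ->
  (forall u, 0 <= h u)%R ->
  (exists C : R, forall x, `|g x| <= C * \prod_(j < n) h (tnth x j))%R ->
  (forall x, \int[mu]_u (g (tuple_upd x i u))%:E = 0) ->
  \int[lebesgue_tuple n]_x (g x)%:E = 0.
Proof.
move=> mg mh ih h0; elim: n i g mg => [[]//|n IH] i g mg [C gC] gi.
have ig : (lebesgue_tuple n.+1).-integrable setT (EFin \o g).
  apply: (@le_integrable _ _ _ (lebesgue_tuple n.+1) setT measurableT _
    (fun x => C%:E * (\prod_(j < n.+1) h (tnth x j))%:E)) => //.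
  - exact/measurable_EFinP.
  - by move=> x _; rewrite -EFinM /= lee_fin (le_trans (gC x))// ler_norm.
  apply: integrableZl; first exact: measurableT.
  apply/integrableP; split.
    by apply/measurable_EFinP; exact: measurable_prod_tnth.
  under eq_integral do rewrite /= ger0_norm ?prodr_ge0//.
  by rewrite integral_prod_tnth// ltey_eq fin_numX// integrable_fin_num.
rewrite integral_lebesgue_tupleS//.
have igc := integrable_lebesgue_tupleS ig.
have [k i0|i0] := unliftP ord0 i; last first.
  rewrite -(integral21_prod_meas1 igc) /fubini_G/=.
  rewrite integral0_eq// => x _.
  (* The head entry 0 is a filler, overwritten by [tuple_upd] at [ord0]. *)
  by rewrite -(gi (tuple_cons (0%R, x))) i0; under [RHS]eq_integral do rewrite tuple_upd_cons0.
rewrite -(integral12_prod_meas1 igc) /fubini_F/=.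
rewrite integral0_eq// => v _.
apply: (IH k (fun x => g (tuple_cons (v, x)))) => //.
- have mc : measurable_fun [set: n.-tuple R] (fun x => tuple_cons (v, x)).
    by apply: (measurableT_comp (@measurable_tuple_cons R n)); exact: measurable_pair1.
  exact: (measurableT_comp mg mc).
- exists (C * h v)%R => x; rewrite (le_trans (gC _))// big_ord_recl -mulrA.
  rewrite le_eqVlt; apply/orP; left; apply/eqP; congr (_ * (_ * _))%R.
  by apply: eq_bigr => j _; rewrite tnthS.
- by move=> x; rewrite -(gi (tuple_cons (v, x))) i0; under [RHS]eq_integral do rewrite tuple_upd_consS.
Qed.

End tuple_integral.

(** * Aomoto's recursion for the Selberg integral *)

Section root_poly.
Context {R : realType} {n : nat}.
Implicit Types (t : 'I_n -> R) (i j : 'I_n) (m : nat).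

(** Generating polynomial of the elementary symmetric functions: the coefficient of X^m is the one
    of degree #|A| - m. Over all indices, coefficient n is 1 and coefficient 0 is the product of the
    [t j]. *)
Definition rpoly t (A : pred 'I_n) : {poly R} :=
  \prod_(j < n | A j) ('X + (t j)%:P).

Lemma rpolyD1 t (A : pred 'I_n) i : A i ->
  rpoly t A = ('X + (t i)%:P) * rpoly t (fun j => A j && (j != i)).
Proof. by move=> Ai; rewrite /rpoly (bigD1 i). Qed.

Lemma deriv_rpoly t (A : pred 'I_n) :
  (rpoly t A)^`() = \sum_(i < n | A i) rpoly t (fun j => A j && (j != i)).
Proof.
have [k] := ubnP #|A|; elim: k A => // k IH A cA.
have [i Ai|A0] := pickP A; last first.
  by rewrite /rpoly !big_pred0// derivC.
rewrite (rpolyD1 t Ai) derivM derivD derivX derivC addr0 mul1r (bigD1 i)//=.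
congr (_ + _); rewrite IH; last first.
  move: cA; rewrite (cardD1 i) unfold_in Ai add1n !ltnS.
  apply: leq_trans; rewrite ltnS; apply/subset_leq_card/fintype.subsetP => j.
  by rewrite !inE unfold_in andbC.
rewrite mulr_sumr; apply: eq_bigr => j /andP[Aj ji].
rewrite (@rpolyD1 t (fun l => A l && (l != j)) i) ?Ai 1?eq_sym//.
by congr (_ * _); apply: eq_bigl => l; rewrite andbAC.
Qed.

Local Notation P t := (rpoly t xpredT).
Local Notation P1 t i := (rpoly t (fun j => j != i)).
Local Notation P2 t i j := (rpoly t (fun l => (l != i) && (l != j))).

Lemma rpoly1E t i : P t = ('X + (t i)%:P) * P1 t i.
Proof. exact: (@rpolyD1 t xpredT i). Qed.

Lemma rpoly2E t i j : i != j -> P1 t i = ('X + (t j)%:P) * P2 t i j.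
Proof. by move=> ij; rewrite (@rpolyD1 t (fun l => l != i) j)// eq_sym. Qed.

(* rV is the vector field of Aomoto's integration by parts; it is chosen so that
   rV_i - rV_j is divisible by t_i - t_j and that it vanishes at t_i = 0 and 4. *)
Definition rV t m i := t i * (4 - t i) * (P1 t i)`_m.

(** Dividing V_i - V_j by t_i - t_j leaves P2 times 4X - X (t_i + t_j) - t_i t_j, which equals 4X +
    X^2 - (X + t_i) (X + t_j). In this form P2 meets only monomials, so that sums over i and j
    become derivatives of P. *)
Definition rQ t m i j := (4%:P * 'X * P2 t i j + 'X^2 * P2 t i j - P t)`_m.

Lemma rV_sub t m i j : i != j -> rV t m i - rV t m j = (t i - t j) * rQ t m i j.
Proof.
move=> ij; rewrite /rV /rQ -!coefCM -coefB; congr ((_ : {poly R})`_m).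
have e1 : P t = ('X + (t i)%:P) * (('X + (t j)%:P) * P2 t i j).
  by rewrite (rpoly1E t i) (rpoly2E t ij).
have e2 : P1 t j = ('X + (t i)%:P) * P2 t i j.
  rewrite (rpoly2E t (_ : j != i)) 1?eq_sym//; congr (_ * _).
  by apply: eq_bigl => l; rewrite andbC.
rewrite e1 e2 (rpoly2E t ij) !polyCM !polyCB; move: 'X => x; ring.
Qed.

Lemma sum_rP t m : \sum_(i < n) (P1 t i)`_m = m.+1%:R * (P t)`_m.+1.
Proof.
by rewrite mulr_natl -coef_deriv deriv_rpoly coef_sum; apply: eq_bigr.
Qed.

Lemma sum_rtP t m : \sum_(i < n) t i * (P1 t i)`_m = (n%:R - m%:R) * (P t)`_m.
Proof.
have e i : t i * (P1 t i)`_m = (P t)`_m - ('X * P1 t i)`_m.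
  by rewrite (rpoly1E t i) mulrDl coefD coefCM [RHS]addrC addKr.
under eq_bigr do rewrite e.
rewrite sumrB sumr_const card_ord mulrBl !mulr_natl; congr (_ - _).
under eq_bigr do rewrite coefXM.
case: m e => [|m] _ /=; first by rewrite big1 ?mulr0n.
by rewrite sum_rP mulr_natl.
Qed.

(** The double sum of the P2 is P'', so the total is the coefficient of 4X P'' + X^2 P'' - n (n - 1)
    P; the last factor comes from n (n - 1) - m (m - 1) = (n - m) (n + m - 1). *)
Lemma sum_rQ t m : \sum_(i < n) \sum_(j < n | j != i) rQ t m i j =
  4 * (m%:R * m.+1%:R) * (P t)`_m.+1
  - (n%:R - m%:R) * (n%:R + m%:R - 1) * (P t)`_m.
Proof.
have en : (n * n.-1)%:R = n%:R * (n%:R - 1) :> R.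
  by case: n => [|k]; rewrite ?mul0r// natrM; congr (_ * _); rewrite -natr1 addrK.
have d2 : \sum_(i < n) \sum_(j < n | j != i) P2 t i j = (P t)^`()^`().
  rewrite deriv_rpoly raddf_sum/=; apply: eq_bigr => i _.
  by rewrite deriv_rpoly; apply: eq_bigr.
transitivity ((4%:P * 'X * (P t)^`()^`() + 'X^2 * (P t)^`()^`()
    - (n * n.-1)%:R *: P t)`_m).
  rewrite -d2 (_ : (n * n.-1)%:R *: P t = \sum_(i < n) \sum_(j < n | j != i) P t).
    rewrite !mulr_sumr -big_split -sumrB /= coef_sum; apply: eq_bigr => i _.
    by rewrite !mulr_sumr -big_split -sumrB /= coef_sum.
  rewrite (eq_bigr (fun=> P t *+ n.-1)); last first.
    move=> i _; rewrite sumr_const; congr (_ *+ _).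
    by rewrite (_ : #|_| = #|predC1 i|) ?cardC1 ?card_ord//; exact: eq_card.
  by rewrite sumr_const card_ord -mulrnA scaler_nat mulnC.
rewrite coefB coefD -mulrA coefCM coefXM -[X in 'X^2 * X]mulr1 mulrA.
rewrite mulr1 expr2 -mulrA !coefXM coefZ !coef_deriv.
case: m => [|[|m]] /=; rewrite ?coef_deriv.
- rewrite en; move: (n%:R : R) (_`_0) (_`_1) => x y z; ring.
- rewrite en; move: (n%:R : R) (_`_1) (_`_2) => x y z; ring.
- rewrite en; move: (n%:R : R) (_`_m.+2) (_`_m.+3) => x z w; ring.
Qed.

End root_poly.

(** * One-variable calculus and limits of finite sums and products *)

Section calculus.
Context {R : realType}.
Local Notation mu := (@lebesgue_measure R).

(** On positive values the inverse is the exponential of minus the logarithm, a composition of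
    measurable maps. *)
Lemma measurable_funV_gt0 d (T : measurableType d) (D : set T) (f : T -> R) :
  measurable D -> measurable_fun D f -> (forall x, D x -> 0 < f x) ->
  measurable_fun D (fun x => (f x)^-1).
Proof.
move=> mD mf f0; apply: (eq_measurable_fun (fun x => expR (- ln (f x)))).
  by move=> x; rewrite inE => Dx; rewrite expRN lnK// posrE f0.
apply: measurableT_comp => //; apply: measurableT_comp => //.
exact: (measurableT_comp (@measurable_ln R)).
Qed.

(** The fundamental theorem of calculus for a primitive vanishing at both ends. The sign [s] covers
    u = 2 - v and u = 2 + v at once, so that one proof serves both determinants. *)
Lemma integral_itv_derive0 (s : R) (F f : R -> R) : s = 1 \/ s = -1 ->
  (forall u : R, 0 <= u <= 4 -> is_derive u 1 F (f u)) ->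
  (forall u : R, 0 <= u <= 4 -> {for u, continuous f}) -> F 0 = 0 -> F 4 = 0 ->
  (\int[mu]_(v in `](-2)%R, 2%R[) (f (2 - s * v))%:E = 0)%E.
Proof.
move=> s1 dF cf F0 F4.
have st (v : R) : -2 <= v <= 2 -> 0 <= 2 - s * v <= 4 by case: s1 => ->; lra.
have cl (v : R) : {for v, continuous (fun w : R => 2 - s * w)}.
  move=> /=; apply: cvgB; first exact: cvg_cst.
  by apply: cvgM; [exact: cvg_cst|exact: cvg_id].
pose G v : R := - s * F (2 - s * v).
have dG (v : R) : -2 <= v <= 2 -> is_derive v 1 G (f (2 - s * v)).
  move=> v2; have dl : is_derive v 1 (fun w : R => 2 - s * w) (- s).
    apply: is_derive_eq; rewrite /GRing.scale/= ?mulr0 ?mulr1; ring.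
  have /= dFl := @is_derive1_comp R F (fun w => 2 - s * w) v _ _ (dF _ (st _ v2)) dl.
  have := is_deriveZ (- s) dFl => dGs.
  apply: (@is_derive_eq _ _ _ _ _ _ _ _ dGs).
  by rewrite /GRing.scale/=; case: s1 => ->; ring.
have cG (v : R) : -2 <= v <= 2 -> {for v, continuous G}.
  move=> v2; apply: differentiable_continuous; apply/derivable1_diffP.
  exact: (@ex_derive _ _ _ _ _ _ _ (dG _ v2)).
have cf2 : {within `[-2, 2], continuous (fun v : R => f (2 - s * v))}.
  apply: continuous_in_subspaceT => v; rewrite inE/= in_itv/= => v2.
  apply: (@continuous_comp _ _ _ (fun w : R => 2 - s * w) f) => //.
  exact/cf/st.
have mf2 := subspace_continuous_measurable_fun (measurable_itv `[(-2)%R, 2%R]) cf2.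
rewrite -(@integral_itv_bndoo _ _ _ _ true false); last first.
  apply/measurable_EFinP; apply: (measurable_funS _ _ mf2) => //.
  by apply: subset_itv; rewrite bnd_simp.
rewrite (@continuous_FTC2 _ _ G)//; first last.
- move=> v; rewrite in_itv/= => /andP[v1 v2].
  by rewrite derive1E (@derive_val _ _ _ _ _ _ _ (dG v _))// !ltW.
- split.
  + move=> v; rewrite in_itv/= => /andP[v1 v2].
    by apply: (@ex_derive _ _ _ _ _ _ _ (dG v _)); rewrite !ltW.
  + by apply: cvg_at_right_filter; apply: cG; lra.
  + by apply: cvg_at_left_filter; apply: cG; lra.
- by lra.
rewrite /G -EFinB; congr (_%:E).
have : (2 - s * 2 = 0 /\ 2 - s * -2 = 4) \/ (2 - s * 2 = 4 /\ 2 - s * -2 = 0).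
  by case: s1 => ->; [left|right]; split; ring.
by case=> -[-> ->]; rewrite F0 F4 !mulr0 subr0.
Qed.

Lemma cvg_sumR T (F : set_system T) (FF : Filter F) I (r : seq I) (P : pred I)
    (f : I -> T -> R) (l : I -> R) :
  (forall i, P i -> f i x @[x --> F] --> l i) ->
  \sum_(i <- r | P i) f i x @[x --> F] --> \sum_(i <- r | P i) l i.
Proof. by move=> fl; apply: cvg_big => //; exact: add_continuous. Qed.

Lemma cvg_prodR T (F : set_system T) (FF : Filter F) I (r : seq I) (P : pred I)
    (f : I -> T -> R) (l : I -> R) :
  (forall i, P i -> f i x @[x --> F] --> l i) ->
  \prod_(i <- r | P i) f i x @[x --> F] --> \prod_(i <- r | P i) l i.
Proof. by move=> fl; apply: cvg_big => //; exact: mul_continuous. Qed.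

End calculus.

(** * Integration by parts for the regularised weight *)

Section regularised_weight.
Context {R : realType} {n : nat}.
Variables (beta a b : R).
Implicit Types (y : 'I_n -> R) (i j : 'I_n) (m : nat) (e u : R).

Definition fupd y i u : 'I_n -> R := fun j => if j == i then u else y j.

(* regW is the weight in which every base of a power is increased by e > 0, so
   that integration by parts is legitimate even for a, b < 0 or beta < 1. *)
Definition regS e u := a * ln (u + e) + b * ln (4 - u + e).

(** The factor is beta / 4 because each unordered pair occurs twice in the double sum and the square
    doubles its logarithm. *)
Definition regH e y :=
  \sum_i regS e (y i)
  + beta / 4 * \sum_i \sum_(j | j != i) ln ((y i - y j) ^+ 2 + e).

Definition regW e y := expR (regH e y).

(** This is the derivative of V_i W in the i-th variable: the polynomial coefficient in V_i does not
    involve y_i, and the term j = i of the unrestricted sum vanishes. *)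
Definition regD e m y i :=
  (rpoly y (fun j => j != i))`_m * regW e y *
  (4 - 2 * y i + y i * (4 - y i) *
     (a * (y i + e)^-1 - b * (4 - y i + e)^-1
      + beta * \sum_j (y i - y j) * ((y i - y j) ^+ 2 + e)^-1)).

Lemma sq_eps_gt0 e u : 0 < e -> 0 < u ^+ 2 + e.
Proof. by move=> e0; rewrite ltr_wpDl// sqr_ge0. Qed.

Lemma rpoly_upd y i u :
  rpoly (fupd y i u) (fun j => j != i) = rpoly y (fun j => j != i).
Proof. by apply: eq_bigr => j ji; rewrite /fupd (negbTE ji). Qed.

(** Separates what depends on [u] from a constant; the pairs (i, j) and (j, i) merge, which turns
    beta / 4 into beta / 2. *)
Lemma regH_upd e y i u : regH e (fupd y i u) =
  regS e u + beta / 2 * \sum_(j | j != i) ln ((u - y j) ^+ 2 + e)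
  + (\sum_(k | k != i) regS e (y k) + beta / 4 *
     \sum_(k | k != i) \sum_(j | (j != k) && (j != i)) ln ((y k - y j) ^+ 2 + e)).
Proof.
rewrite /regH (bigD1 i)//= [\sum_k \sum_(j | _) _](bigD1 i)//=.
have -> : regS e (fupd y i u i) = regS e u by rewrite /fupd eqxx.
have -> : \sum_(k | k != i) regS e (fupd y i u k) = \sum_(k | k != i) regS e (y k).
  by apply: eq_bigr => k ki; rewrite /fupd (negbTE ki).
set L := fun v => ln (v ^+ 2 + e).
have -> : \sum_(j | j != i) ln ((fupd y i u i - fupd y i u j) ^+ 2 + e) =
    \sum_(j | j != i) L (u - y j).
  by apply: eq_bigr => k ki; rewrite /fupd eqxx (negbTE ki).
have -> : \sum_(k | k != i) \sum_(j | j != k) ln ((fupd y i u k - fupd y i u j) ^+ 2 + e)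
  = \sum_(k | k != i) (L (u - y k) + \sum_(j | (j != k) && (j != i)) L (y k - y j)).
  apply: eq_bigr => k ki; rewrite (bigD1 i) 1?eq_sym//=; congr (_ + _).
    by rewrite /fupd eqxx (negbTE ki) /L -sqrrN opprB.
  by apply: eq_bigr => j /andP[jk ji]; rewrite /fupd (negbTE ki) (negbTE ji).
rewrite [\sum_(k | k != i) (L _ + _)]big_split/=.
move: (\sum_(k | k != i) regS e (y k)) (regS e u) => x z.
rewrite -[\sum_(k | k != i) ln _]/(\sum_(k | k != i) L (u - y k)).
rewrite -[\sum_(k | k != i) \sum_(j | _) ln _]/(\sum_(k | k != i) \sum_(j | (j != k) && (j != i)) L (y k - y j)).
move: (\sum_(k | k != i) L _) (\sum_(k | k != i) \sum_(j | _) L _) => w v.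
by field.
Qed.

Lemma is_derive_lnsq e c u : 0 < e ->
  is_derive u 1 (fun v : R => ln ((v - c) ^+ 2 + e))
    (2 * ((u - c) * ((u - c) ^+ 2 + e)^-1)).
Proof.
move=> e0.
have d1 : is_derive u 1 (fun v : R => (v - c) ^+ 2 + e) (2 * (u - c)).
  apply: is_derive_eq; rewrite /GRing.scale/= subr0 addr0.
  by ring.
have := @is_derive1_comp R (@ln R) _ u _ _ (is_derive1_ln (sq_eps_gt0 (u - c) e0)) d1.
by move=> /= d2; apply: (is_derive_eq d2); ring.
Qed.

Lemma is_derive_ln_affine e c u : 0 < c * u + e ->
  is_derive u 1 (fun v : R => ln (c * v + e)) (c * (c * u + e)^-1).
Proof.
move=> e0.
have d1 : is_derive u 1 (fun v : R => c * v + e) c.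
  by apply: is_derive_eq; rewrite /GRing.scale/= ?mulr0 ?mulr1 ?addr0 ?add0r.
have := @is_derive1_comp R (@ln R) _ u _ _ (is_derive1_ln e0) d1.
by move=> /= d2; apply: (is_derive_eq d2); ring.
Qed.

Lemma is_derive_regW e y i u : 0 < e -> 0 <= u <= 4 ->
  is_derive u 1 (fun v => regW e (fupd y i v))
    (regW e (fupd y i u) * (a * (u + e)^-1 - b * (4 - u + e)^-1
      + beta * \sum_j (u - fupd y i u j) * ((u - fupd y i u j) ^+ 2 + e)^-1)).
Proof.
move=> e0 u4.
rewrite (_ : (fun v => _) = expR \o (fun v => regH e (fupd y i v)))//.
have d1 : is_derive u 1 (fun v => ln (v + e)) (u + e)^-1.
  have := @is_derive_ln_affine e 1 u; rewrite !mul1r => d.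
  have -> : (fun v : R => ln (v + e)) = (fun v => ln (1 * v + e)).
    by apply/funext => v; rewrite mul1r.
  by apply: d; lra.
have d2 : is_derive u 1 (fun v => ln (4 - v + e)) (- (4 - u + e)^-1).
  have := @is_derive_ln_affine (4 + e) (-1) u => d.
  have -> : (fun v : R => ln (4 - v + e)) = (fun v => ln (-1 * v + (4 + e))).
    by apply/funext => v; congr ln; ring.
  apply: (is_derive_eq (d _)); first lra.
  by rewrite mulN1r; congr (- _^-1); ring.
have d3 : is_derive u 1 (fun v => \sum_(j | j != i) ln ((v - y j) ^+ 2 + e))
    (\sum_(j | j != i) 2 * ((u - y j) * ((u - y j) ^+ 2 + e)^-1)).
  rewrite (_ : (fun v => _) = \sum_(j < n) (fun v : R => if j != i then ln ((v - y j) ^+ 2 + e) else 0)); last first.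
    by apply/funext => v; rewrite fct_sumE big_mkcond.
  rewrite [X in is_derive _ _ _ X]big_mkcond; apply: is_derive_sum => j.
  by case: ifP => _; [exact: is_derive_lnsq|exact: is_derive_cst].
have dH : is_derive u 1 (fun v => regH e (fupd y i v))
   (a * (u + e)^-1 - b * (4 - u + e)^-1
      + beta * \sum_j (u - fupd y i u j) * ((u - fupd y i u j) ^+ 2 + e)^-1).
  under eq_fun do rewrite regH_upd.
  apply: is_derive_eq; rewrite /GRing.scale/= addr0 ?mul0r ?mulr0 ?addr0.
  rewrite [in RHS](bigD1 i)//= {1 2}/fupd eqxx subrr mul0r add0r -mulr_sumr.
  rewrite mulrA divfK ?pnatr_eq0// mulrN; congr (_ + _ * _).
  by apply: eq_bigr => j ji; rewrite /fupd (negbTE ji).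
exact: (@is_derive1_comp R (@expR R) _ u _ _ (is_derive_expR _) dH).
Qed.

Lemma is_derive_rVW e m y i u : 0 < e -> 0 <= u <= 4 ->
  is_derive u 1 (fun v => rV (fupd y i v) m i * regW e (fupd y i v))
    (regD e m (fupd y i u) i).
Proof.
move=> e0 u4; have dW := is_derive_regW y i e0 u4.
set c := (rpoly y (fun j => j != i))`_m.
have dV : is_derive u 1 (fun v => rV (fupd y i v) m i) (c * (4 - 2 * u)).
  rewrite (_ : (fun v => _) = (fun v => v * (4 - v) * c)); last first.
    by apply/funext => v; rewrite /rV rpoly_upd /fupd eqxx.
  apply: is_derive_eq; rewrite /GRing.scale/=; ring.
have d := is_deriveM dV dW; apply: (is_derive_eq d).
rewrite /regD /GRing.scale/= /rV rpoly_upd -/c.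
have -> : fupd y i u i = u by rewrite /fupd eqxx.
move: (regW _ _) (\sum_j _) ((u + e)^-1) ((4 - u + e)^-1) => W S p q; ring.
Qed.

Lemma continuous_regD e m y i u : 0 < e -> 0 <= u <= 4 ->
  {for u, continuous (fun v : R => regD e m (fupd y i v) i)}.
Proof.
move=> e0 u4; have dW := is_derive_regW y i e0 u4.
set c := (rpoly y (fun j => j != i))`_m.
rewrite (_ : (fun v => _) = (fun v => c * regW e (fupd y i v) *
  (4 - 2 * v + v * (4 - v) * (a * (v + e)^-1 - b * (4 - v + e)^-1
   + beta * \sum_(j < n | j != i) (v - y j) * ((v - y j) ^+ 2 + e)^-1)))); last first.
  apply/funext => v; rewrite /regD rpoly_upd -/c.
  have -> : fupd y i v i = v by rewrite /fupd eqxx.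
  rewrite (bigD1 i)//= {1 2}/fupd eqxx subrr mul0r add0r.
  congr (_ * (_ + _ * (_ + _ * _))).
  by apply: eq_bigr => j ji; rewrite /fupd (negbTE ji).
have cI : (fun v : R => v) @ u --> u by exact: cvg_id.
have cW : {for u, continuous (fun v : R => regW e (fupd y i v))}.
  apply: differentiable_continuous; apply/derivable1_diffP.
  exact: (@ex_derive _ _ _ _ _ _ _ dW).
have cL k : (fun v : R => k - v) @ u --> k - u by apply: cvgB => //; exact: cvg_cst.
have cR k : (fun v : R => v - k) @ u --> u - k by apply: cvgB => //; exact: cvg_cst.
apply: cvgM; first by apply: cvgM => //; exact: cvg_cst.
apply: cvgD.
  apply: cvgB; first exact: cvg_cst.
  by apply: cvgM => //; exact: cvg_cst.
apply: cvgM; first by apply: cvgM.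
apply: cvgD.
  apply: cvgB; (apply: cvgM; first exact: cvg_cst).
    apply: cvgV; first by rewrite gt_eqF//; lra.
    by apply: cvgD => //; exact: cvg_cst.
  apply: cvgV; first by rewrite gt_eqF//; lra.
  by apply: cvgD; [exact: cL|exact: cvg_cst].
apply: cvgM; first exact: cvg_cst.
apply: cvg_sumR => j _; apply: cvgM => //.
apply: cvgV; first by rewrite gt_eqF// sq_eps_gt0.
by apply: cvgD; [apply: cvgM|exact: cvg_cst].
Qed.

Lemma integral_regD0 (s : R) e m y i : s = 1 \/ s = -1 -> 0 < e ->
  (\int[@lebesgue_measure R]_(v in `](-2)%R, 2%R[)
     (regD e m (fupd y i (2 - s * v)) i)%:E = 0)%E.
Proof.
move=> s1 e0; apply: (@integral_itv_derive0 _ _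
  (fun v => rV (fupd y i v) m i * regW e (fupd y i v))
  (fun v => regD e m (fupd y i v) i)) => //.
- by move=> u u4; exact: is_derive_rVW.
- by move=> u u4; exact: continuous_regD.
- by rewrite /rV /fupd eqxx !mul0r.
- by rewrite /rV /fupd eqxx subrr !(mulr0, mul0r).
Qed.

End regularised_weight.

(** * Integrability at the end points for exponents > -1 *)

Section endpoint_integrability.
Context {R : realType}.
Local Notation mu := (@lebesgue_measure R).

(** An improper integral: [f] may blow up at both ends, so the fundamental theorem is applied on
    closed segments exhausting the interval, where it gives at most 2M, and monotone convergence
    carries this bound to the limit. *)
Lemma integrable_bounded_primitive (f F : R -> R) (M : R) :
  (forall v : R, -2 < v < 2 -> 0 <= f v) ->
  (forall v : R, -2 < v < 2 -> is_derive v 1 F (f v)) ->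
  (forall v : R, -2 < v < 2 -> {for v, continuous f}) ->
  (forall v : R, -2 < v < 2 -> `|F v| <= M) ->
  mu.-integrable `](-2)%R, 2%R[ (EFin \o f).
Proof.
move=> f0 dF cf FM.
have mf : measurable_fun (`](-2)%R, 2%R[%classic : set (measurableTypeR R)) f.
  apply: open_continuous_measurable_fun; first exact: interval_open.
  by move=> v; rewrite inE/= in_itv/= => /cf.
apply/integrableP; split; first exact/measurable_EFinP.
pose d k : R := k.+1%:R^-1.
have d0 k : 0 < d k by rewrite invr_gt0.
have d1 k : d k <= 1 by rewrite invf_le1// ler1n.
pose E k := `[-2 + d k, 2 - d k]%classic.
have EU : `](-2)%R, 2%R[%classic = \bigcup_k E k.
  apply/seteqP; split => v /=; rewrite in_itv/=.
    move=> /andP[v1 v2].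
    have v0 : 0 < Num.min (v + 2) (2 - v) by rewrite lt_min; lra.
    have [k _ /(_ _ (leqnn k))/=] := near_infty_natSinv_lt (PosNum v0).
    rewrite lt_min -/(d k) => /andP[k1 k2].
    by exists k => //; rewrite /E/= in_itv/=; lra.
  by move=> [k _]; rewrite /E/= in_itv/=; have := d0 k; lra.
have sE k v : E k v -> -2 < v < 2.
  by rewrite /E/= in_itv/=; have := d0 k; lra.
have ndE : nondecreasing_seq E.
  move=> k l kl; rewrite subsetEset; apply: subset_itv; rewrite bnd_simp.
    by rewrite lerD2l lef_pV2 ?posrE// ler_nat.
  by rewrite lerD2l lerN2 lef_pV2 ?posrE// ler_nat.
have mE k : measurable (E k) by exact: measurable_itv.
have cvgE : (\int[mu]_(x in E k) (f x)%:E @[k --> \oo] -->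
    \int[mu]_(x in `](-2)%R, 2%R[) (f x)%:E)%E.
  rewrite EU; apply: ge0_nondecreasing_set_cvg_integral => //.
  - move=> k; apply/measurable_EFinP; apply: (measurable_funS _ _ mf) => //.
    by move=> v /sE /=; rewrite in_itv.
  - by move=> k v /sE v2; rewrite lee_fin f0.
have bE k : (\int[mu]_(x in E k) (f x)%:E <= (M *+ 2)%:E)%E.
  have := d0 k; have := d1 k => dk1 dk0.
  rewrite (@continuous_FTC2 _ _ F)//; first last.
  - move=> v; rewrite in_itv/= => v2.
    by rewrite derive1E (@derive_val _ _ _ _ _ _ _ (dF v _))//; lra.
  - have cF (v : R) : -2 < v < 2 -> {for v, continuous F}.
      move=> v2; apply: differentiable_continuous; apply/derivable1_diffP.
      exact: (@ex_derive _ _ _ _ _ _ _ (dF _ v2)).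
    split.
    + move=> v; rewrite in_itv/= => v2.
      by apply: (@ex_derive _ _ _ _ _ _ _ (dF v _)); lra.
    + by apply: cvg_at_right_filter; apply: cF; lra.
    + by apply: cvg_at_left_filter; apply: cF; lra.
  - apply: continuous_in_subspaceT => v; rewrite inE/= in_itv/= => v2.
    by apply: cf; lra.
  - by lra.
  rewrite -EFinB lee_fin mulr2n lerD//.
    by apply: le_trans (FM _ _); [exact: ler_norm|lra].
  by rewrite lerNl; apply: le_trans (_ : - `|F (-2 + d k)| <= _);
    [rewrite lerN2 FM//; lra|rewrite lerNl -normrN ler_norm].
apply: (@le_lt_trans _ _ (M *+ 2)%:E); last by rewrite ltry.
rewrite (_ : (\int[mu]_(x in _) _ = \int[mu]_(x in `](-2)%R, 2%R[) (f x)%:E)%E); last first.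
  by apply: eq_integral => v; rewrite inE/= in_itv/= => v2; rewrite ger0_norm// f0.
rewrite -(cvg_lim _ cvgE)//; apply: lime_le; last exact: nearW.
by apply/cvg_ex; eexists; exact: cvgE.
Qed.

Lemma affine_itv (s v : R) : s = 1 \/ s = -1 -> -2 < v < 2 -> 0 < 2 - s * v < 4.
Proof. by case=> ->; lra. Qed.

(** The primitive u^(a + 1) / (a + 1) stays bounded near u = 0 because a + 1 > 0, even if u^a does
    not. *)
Lemma integrable_powR_affine (s a : R) : s = 1 \/ s = -1 -> -1 < a ->
  mu.-integrable `](-2)%R, 2%R[ (fun v => ((2 - s * v) `^ a)%:E).
Proof.
move=> s1 a1; have a10 : 0 < a + 1 by lra.
have dl (v : R) : is_derive v 1 (fun w : R => 2 - s * w) (- s).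
  apply: is_derive_eq; rewrite /GRing.scale/= ?mulr0 ?mulr1; ring.
have ss : s * s = 1 by case: s1 => ->; ring.
have H := @integrable_bounded_primitive (fun v => (2 - s * v) `^ a)
  (fun v => - s / (a + 1) * (2 - s * v) `^ (a + 1)) (4 `^ (a + 1) / (a + 1)).
apply: H => v v2.
- exact: powR_ge0.
- have /andP[u0 u4] := affine_itv s1 v2.
  have d1 := @is_derive1_comp R (fun u => u `^ (a + 1)) (fun w => 2 - s * w) v _ _
    (is_derive1_powR (a + 1) u0) (dl v).
  have := is_deriveZ (- s / (a + 1)) d1 => d2.
  apply: (@is_derive_eq _ _ _ _ _ _ _ _ d2).
  rewrite addrK /GRing.scale/=; move: (_ `^ a) => w.
  transitivity ((s * s) * ((a + 1) / (a + 1)) * w); first by ring.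
  by rewrite ss divff ?gt_eqF// !mul1r.
- have /andP[u0 u4] := affine_itv s1 v2.
  apply: (@continuous_comp _ _ _ (fun w : R => 2 - s * w) (fun u => u `^ a)).
    apply: cvgB; first exact: cvg_cst.
    by apply: cvgM; [exact: cvg_cst|exact: cvg_id].
  apply: differentiable_continuous; apply/derivable1_diffP.
  exact: (@ex_derive _ _ _ _ _ _ _ (is_derive1_powR a u0)).
- have /andP[u0 u4] := affine_itv s1 v2.
  rewrite !normrM normrN normfV (gtr0_norm a10) (ger0_norm (powR_ge0 _ _)).
  rewrite (_ : `|s| = 1); last by case: s1 => ->; rewrite ?normrN normr1.
  rewrite mul1r mulrC ler_pM2r ?invr_gt0// ge0_ler_powR// ?nnegrE; lra.
Qed.

(** A power is monotone, increasing or decreasing according to the sign of the exponent; the sum of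
    both end values avoids this distinction later. *)
Lemma powR_le_endpoints (u p q a : R) : 0 < p -> p <= u <= q ->
  u `^ a <= p `^ a + q `^ a.
Proof.
move=> p0 /andP[pu uq]; have u0 : 0 < u by lra.
have [a0|a0] := leP 0 a.
  by rewrite ler_wpDl ?powR_ge0// ge0_ler_powR// ?nnegrE; lra.
rewrite ler_wpDr ?powR_ge0// -[a]opprK !powRN lef_pV2 ?posrE ?powR_gt0//.
by rewrite -!powRN ge0_ler_powR// ?nnegrE; lra.
all: by rewrite invr_gt0 powR_gt0.
Qed.

(* Dominates (u + e)^a (4 - u + e)^b for 0 < u < 4 and 0 < e <= 1. *)
Definition dom_weight (a b u : R) := (u `^ a + 5 `^ a) * ((4 - u) `^ b + 5 `^ b).

Lemma dom_weight_ge0 a b u : 0 <= dom_weight a b u.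
Proof. by rewrite mulr_ge0// addr_ge0// powR_ge0. Qed.

Lemma measurable_dom_weight (a b s : R) :
  measurable_fun setT (fun v : R => dom_weight a b (2 - s * v)).
Proof.
have ml : measurable_fun setT (fun v : R => 2 - s * v).
  by apply: measurable_funB => //; exact: measurable_funM.
apply: measurable_funM; apply: measurable_funD => //.
  exact: (measurableT_comp (measurable_powR a) ml).
apply: (measurableT_comp (measurable_powR b)); exact: measurable_funB.
Qed.

Lemma integrable_dom_weight (a b s : R) : s = 1 \/ s = -1 -> -1 < a -> -1 < b ->
  mu.-integrable `](-2)%R, 2%R[ (fun v => (dom_weight a b (2 - s * v))%:E).
Proof.
move=> s1 a1 b1.
pose A := 2 `^ a + 4 `^ a + 5 `^ a; pose B := 2 `^ b + 4 `^ b + 5 `^ b.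
have A0 : 0 <= A by rewrite !addr_ge0// powR_ge0.
have B0 : 0 <= B by rewrite !addr_ge0// powR_ge0.
have hle (v : R) : -2 < v < 2 -> dom_weight a b (2 - s * v) <=
    B * (2 - s * v) `^ a + A * (2 - (- s) * v) `^ b + A * B.
  move=> v2; have /andP[u0 u4] := affine_itv s1 v2.
  rewrite (_ : 2 - - s * v = 4 - (2 - s * v)); last by ring.
  move: (2 - s * v) u0 u4 => u u0 u4; rewrite /dom_weight.
  have ua := powR_ge0 u a; have ub := powR_ge0 (4 - u) b.
  (* On each half of the interval only one factor can be singular; the argument of the other lies in
     [2, 4], so it is bounded by [B] or by [A]. *)
  have [u2|u2] := leP u 2.
    have h : (4 - u) `^ b + 5 `^ b <= B.
      by rewrite /B lerD2r powR_le_endpoints//; lra.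
    apply: (@le_trans _ _ ((u `^ a + 5 `^ a) * B)).
      by rewrite ler_wpM2l// addr_ge0// powR_ge0.
    have A5 : 5 `^ a * B <= A * B.
      by rewrite ler_wpM2r// /A ler_wpDl// addr_ge0// powR_ge0.
    by rewrite mulrDl lerD// -[leLHS]addr0 lerD ?mulr_ge0// mulrC.
  have h : u `^ a + 5 `^ a <= A by rewrite /A lerD2r powR_le_endpoints//; lra.
  apply: (@le_trans _ _ (A * ((4 - u) `^ b + 5 `^ b))).
    by rewrite ler_wpM2r// addr_ge0// powR_ge0.
  have A5 : A * 5 `^ b <= A * B.
    by rewrite ler_wpM2l// /B ler_wpDl// addr_ge0// powR_ge0.
  by rewrite mulrDr lerD// -[leLHS]add0r lerD ?mulr_ge0.
have s1' : - s = 1 \/ - s = -1 by case: s1 => ->; [right|left]; rewrite ?opprK.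
have ia := integrable_powR_affine s1 a1; have ib := integrable_powR_affine s1' b1.
have mI : measurable (`](-2)%R, 2%R[%classic : set (measurableTypeR R)).
  exact: measurable_itv.
have ic : mu.-integrable `](-2)%R, 2%R[ (EFin \o (cst (A * B) : R -> R)).
  apply: measurable_bounded_integrable => //.
  - by rewrite [ltLHS]lebesgue_measure_itv/= lte_fin; case: ifP => _; rewrite ltry.
  - exists (A * B); split; first exact: num_real.
    by move=> M ABM v _ /=; rewrite ger0_norm ?mulr_ge0// ltW.
have := integrableD mI (integrableD mI (integrableZl mI B ia) (integrableZl mI A ib)) ic.
apply: le_integrable => //.
  by apply/measurable_EFinP; apply: measurable_funTS; exact: measurable_dom_weight.
move=> v; rewrite /= in_itv/= => v2.
rewrite lee_fin ger0_norm ?dom_weight_ge0//.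
by rewrite (le_trans (hle _ v2))// ler_norm.
Qed.

End endpoint_integrability.

(** * Measurability and domination in the coordinates 2 - x and 2 + x *)

Section jacobi_coordinates.
Context {R : realType} {n : nat}.
Implicit Types (x : n.-tuple R) (y : 'I_n -> R) (i j : 'I_n) (m : nat).

Definition tvec (s : R) x : 'I_n -> R := fun i => 2 - s * tnth x i.

Lemma tvec_itv (s : R) x i : s = 1 \/ s = -1 -> jacobi_support x ->
  0 < tvec s x i < 4.
Proof. by move=> s1 /(_ i) xi; exact: affine_itv. Qed.

Lemma tvec_upd (s : R) x i v :
  tvec s (tuple_upd x i v) = fupd (tvec s x) i (2 - s * v).
Proof. by apply/funext => j; rewrite /tvec tnth_upd /fupd; case: ifP. Qed.

Lemma measurable_jacobi_support : measurable (@jacobi_support R n).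
Proof.
rewrite (_ : @jacobi_support R n = \bigcap_(i in [set: 'I_n])
    ((fun x : n.-tuple R => tnth x i) @^-1` `](-2)%R, 2%R[)); last first.
  apply/seteqP; split => x.
    by move=> xs i _ /=; rewrite in_itv/= xs.
  by move=> xs i; have := xs i I; rewrite /= in_itv.
apply: fin_bigcap_measurable => // i _.
rewrite -[X in measurable X]setTI.
by apply: (@measurable_tnth _ _ n i).
Qed.

Lemma measurable_tvec (s : R) i :
  measurable_fun [set: n.-tuple R] (fun x => tvec s x i).
Proof.
apply: measurable_funB => //; apply: measurable_funM => //.
exact: measurable_tnth.
Qed.

Lemma measurable_coef_rpoly (s : R) (A : pred 'I_n) m :
  measurable_fun [set: n.-tuple R] (fun x => (rpoly (tvec s x) A)`_m).
Proof.
rewrite /rpoly; elim: (index_enum _) m => [|j r IH] m.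
  under eq_fun do rewrite big_nil; exact: measurable_cst.
under eq_fun do rewrite big_cons.
case: (A j); last exact: IH.
under eq_fun do rewrite mulrDl coefD coefXM coefCM.
apply: measurable_funD; last first.
  by apply: measurable_funM; [exact: measurable_tvec|exact: IH].
by case: m => [|m]; [exact: measurable_cst|exact: IH].
Qed.

(** Multiplying by X + y_j with 0 < y_j < 4 enlarges the largest coefficient by a factor at most 1 +
    4. *)
Lemma coef_rpoly_bound y (A : pred 'I_n) m : (forall i, 0 < y i < 4) ->
  `|(rpoly y A)`_m| <= 5 ^+ n.
Proof.
move=> y4; rewrite -[n in 5 ^+ n]size_enum_ord enumT /rpoly.
rewrite -[Finite.enum _]/(index_enum 'I_n).
elim: (index_enum _) m => [|j r IH] m.
  by rewrite big_nil expr0 coef1; case: eqP => _; rewrite ?normr1 ?normr0.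
rewrite big_cons exprS; case: (A j); last first.
  by rewrite (le_trans (IH m))// ler_peMl ?exprn_ge0// ler1n.
set p := \prod_(k <- r | _) _ in IH *.
rewrite mulrDl coefD coefXM coefCM (le_trans (ler_normD _ _))//.
have h1 : `|if m == 0%N then 0 else p`_m.-1| <= 5 ^+ size r.
  by case: eqP => _; rewrite ?normr0 ?exprn_ge0.
have h2 : `|y j * p`_m| <= 4 * 5 ^+ size r.
  have /andP[yj0 yj4] := y4 j.
  by rewrite normrM ler_pM// gtr0_norm// ltW.
by rewrite (_ : 5 * _ = 5 ^+ size r + 4 * 5 ^+ size r); [exact: lerD|ring].
Qed.

Lemma measurable_regW beta a b e (s : R) :
  measurable_fun [set: n.-tuple R] (fun x => regW beta a b e (tvec s x)).
Proof.
have mln (f : n.-tuple R -> R) : measurable_fun [set: n.-tuple R] f ->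
    measurable_fun [set: n.-tuple R] (fun x => ln (f x)).
  by move=> mf; exact: (measurableT_comp (@measurable_ln R) mf).
have mt := measurable_tvec s.
apply: measurableT_comp => //; rewrite /regH.
apply: measurable_funD.
  apply: measurable_sum => i; rewrite /regS.
  apply: measurable_funD; apply: measurable_funM => //; apply: mln.
    exact: measurable_funD.
  by apply: measurable_funD => //; exact: measurable_funB.
apply: measurable_funM => //; apply: measurable_sum => i.
under eq_fun do rewrite big_mkcond.
apply: measurable_sum => j; case: (j != i); last exact: measurable_cst.
apply: mln; apply: measurable_funD => //.
by apply: measurable_funX; exact: measurable_funB.
Qed.

(** [K] does not depend on [e], as dominated convergence requires. The number 17 bounds (y_i -
    y_j)^2 + e, and each end point factor (u + e)^c is bounded by its values at u and at 5. *)
Lemma regW_bound beta a b : 0 <= beta ->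
  exists2 K : R, 0 <= K & forall e y, 0 < e <= 1 -> (forall i, 0 < y i < 4) ->
    regW beta a b e y <= K * \prod_i dom_weight a b (y i).
Proof.
move=> beta0; exists (expR (beta / 4 * \sum_(i < n) \sum_(j < n | j != i) ln 17)).
  exact: expR_ge0.
move=> e y /andP[e0 e1] y4; rewrite /regW /regH expRD mulrC expR_sum.
apply: ler_pM; rewrite ?expR_ge0//.
- by apply: prodr_ge0 => i _; exact: expR_ge0.
- rewrite ler_expR ler_wpM2l//; first by rewrite divr_ge0.
  apply: ler_sum => i _; apply: ler_sum => j _.
  rewrite ler_ln ?posrE ?sq_eps_gt0//.
  have /andP[i0 i4] := y4 i; have /andP[j0 j4] := y4 j.
  have : (y i - y j) ^+ 2 <= 16.
    have : 0 <= (4 - (y i - y j)) * (4 + (y i - y j)) by rewrite mulr_ge0//; lra.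
    by rewrite (_ : _ * _ = 16 - (y i - y j) ^+ 2) ?subr_ge0//; ring.
  by move: (_ ^+ 2) => w; lra.
- apply: ler_prod => i _; rewrite expR_ge0/=.
  have /andP[i0 i4] := y4 i.
  have h c u : 0 < u < 4 -> expR (c * ln (u + e)) <= u `^ c + 5 `^ c.
    move=> u4; have [c0|c0] := leP 0 c.
      rewrite ler_wpDl ?powR_ge0// -[leLHS]/(expR (c * ln (u + e))).
      rewrite /powR gt_eqF// ler_expR ler_wpM2l// ler_ln ?posrE//; lra.
    rewrite ler_wpDr ?powR_ge0// /powR gt_eqF; last lra.
    rewrite ler_expR ler_wnM2l//; first lra.
    by rewrite ler_ln ?posrE; lra.
  rewrite /regS expRD ler_pM ?expR_ge0//; apply: h; lra.
Qed.

(** Here [C] may depend on [e], through e^-1: the bound only ensures integrability for a fixed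
    [e]. *)
Lemma regD_bound beta a b e m i : 0 <= beta -> 0 < e <= 1 ->
  exists C : R, forall y, (forall j, 0 < y j < 4) ->
    `|regD beta a b e m y i| <= C * \prod_j dom_weight a b (y j).
Proof.
move=> beta0 /[dup] e01 /andP[e0 e1]; have [K K0 WK] := regW_bound a b beta0.
pose B := 4 + 16 * (`|a| * e^-1 + `|b| * e^-1 + beta * \sum_(j < n) 4 * e^-1).
exists (5 ^+ n * K * B) => y y4.
have ei : 0 < e^-1 by rewrite invr_gt0.
have inv u : 0 < u -> `|(u + e)^-1| <= e^-1.
  move=> u0; rewrite normfV gtr0_norm; last lra.
  by rewrite lef_pV2 ?posrE//; lra.
have /andP[yi0 yi4] := y4 i.
rewrite (_ : 5 ^+ n * K * B * _ = 5 ^+ n * (K * \prod_j dom_weight a b (y j)) * B); last by ring.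
rewrite /regD 2!normrM; apply: ler_pM; rewrite ?mulr_ge0//.
  apply: ler_pM => //; first exact: coef_rpoly_bound.
  by rewrite (ger0_norm (expR_ge0 _)) WK.
rewrite (le_trans (ler_normD _ _))// lerD//.
  by rewrite ler_norml; apply/andP; lra.
rewrite !normrM; apply: ler_pM; rewrite ?mulr_ge0//.
  rewrite -[16](_ : 4 * 4 = _); last by ring.
  by apply: ler_pM => //; rewrite ger0_norm; lra.
rewrite (le_trans (ler_normD _ _))// lerD//.
  rewrite (le_trans (ler_normB _ _))// !normrM.
  by apply: lerD; rewrite ler_wpM2l// inv//; lra.
rewrite normrM ger0_norm// ler_wpM2l// (le_trans (ler_norm_sum _ _ _))//.
apply: ler_sum => j _; have /andP[j0 j4] := y4 j.
rewrite normrM ler_pM//; first by rewrite ler_norml; apply/andP; lra.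
rewrite normfV gtr0_norm ?sq_eps_gt0// lef_pV2 ?posrE ?sq_eps_gt0//.
by rewrite lerDr sqr_ge0.
Qed.

Lemma measurable_regD beta a b e (s : R) m i : s = 1 \/ s = -1 -> 0 < e ->
  measurable_fun (@jacobi_support R n) (fun x => regD beta a b e m (tvec s x) i).
Proof.
move=> s1 e0; have mD := measurable_jacobi_support.
have mt j : measurable_fun (@jacobi_support R n) (fun x => tvec s x j).
  by apply: measurable_funTS; exact: measurable_tvec.
have md j : measurable_fun (@jacobi_support R n) (fun x => tvec s x i - tvec s x j).
  exact: measurable_funB.
apply: measurable_funM.
  apply: measurable_funM; apply: measurable_funTS.
    exact: measurable_coef_rpoly.
  exact: measurable_regW.
apply: measurable_funD.
  by apply: measurable_funB => //; exact: measurable_funM.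
apply: measurable_funM.
  by apply: measurable_funM => //; exact: measurable_funB.
apply: measurable_funD; last first.
  apply: measurable_funM => //; apply: measurable_sum => j.
  apply: measurable_funM => //; apply: measurable_funV_gt0 => //.
    by apply: measurable_funD => //; exact: measurable_funX.
  by move=> x _; exact: sq_eps_gt0.
apply: measurable_funB; apply: measurable_funM => //; apply: measurable_funV_gt0 => //.
- exact: measurable_funD.
- by move=> x xs; have := tvec_itv i s1 xs; lra.
- by apply: measurable_funD => //; exact: measurable_funB.
- by move=> x xs; have := tvec_itv i s1 xs; lra.
Qed.

Lemma integral_regD_eq0 beta a b e (s : R) m i : s = 1 \/ s = -1 ->
  0 <= beta -> -1 < a -> -1 < b -> 0 < e <= 1 ->
  (\int[lebesgue_tuple n]_(x in @jacobi_support R n)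
     (regD beta a b e m (tvec s x) i)%:E = 0)%E.
Proof.
move=> s1 beta0 a1 b1 /[dup] e01 /andP[e0 _].
have mD := measurable_jacobi_support.
pose g x := if x \in @jacobi_support R n then regD beta a b e m (tvec s x) i else 0.
pose h v := if v \in `](-2)%R, 2%R[%classic then dom_weight a b (2 - s * v) else 0.
rewrite integral_mkcond (_ : _ \_ _ = EFin \o g); last first.
  by apply/funext => x; rewrite /g patchE/=; case: ifP.
have mI : measurable (`](-2)%R, 2%R[%classic : set (measurableTypeR R)).
  exact: measurable_itv.
apply: (@integral_tuple_eq0 _ _ i g h).
- have := (measurable_restrictT (fun x => regD beta a b e m (tvec s x) i) mD).1.
  by apply; exact: measurable_regD.
- have := (measurable_restrictT (fun v => dom_weight a b (2 - s * v)) mI).1.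
  by apply; apply: measurable_funTS; exact: measurable_dom_weight.
- have := integrable_dom_weight s1 a1 b1.
  rewrite (integrable_mkcond _ mI) (_ : _ \_ _ = EFin \o h)//.
  by apply/funext => v; rewrite /h patchE/=; case: ifP.
- by move=> u; rewrite /h; case: ifP => // _; exact: dom_weight_ge0.
- have [C HC] := regD_bound a b m i beta0 e01; exists C => x; rewrite /g.
  case: ifPn => [|xs]; last first.
    have /existsNP[j xj] : ~ @jacobi_support R n x by move=> H; move/negP: xs; rewrite inE.
    rewrite (bigD1 j)//= /h ifF ?mul0r ?mulr0 ?normr0//.
    by apply/negP; rewrite inE/= in_itv.
  rewrite inE => xs.
  rewrite (_ : \prod_(j < n) _ = \prod_j dom_weight a b (tvec s x j)).
    by apply: HC => j; exact: tvec_itv.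
  by apply: eq_bigr => j _; rewrite /h ifT// inE/= in_itv/= xs.
(* A line parallel to the i-th axis meets the cube in the whole interval or not at all. *)
- move=> x; have [xi|xi] := pselect (forall j, j != i -> -2 < tnth x j < 2).
    rewrite -(integral_regD0 beta a b m (tvec s x) i s1 e0) integral_mkcond/=.
    rewrite [RHS]integral_mkcond; apply: eq_integral => v _.
    rewrite patch_setT patchE /g tvec_upd.
    have -> : (tuple_upd x i v \in @jacobi_support R n) = (v \in `](-2)%R, 2%R[%classic).
      apply/idP/idP; rewrite !inE/= in_itv/=.
        by move=> /(_ i); rewrite tnth_upd eqxx.
      by move=> v2 j; rewrite tnth_upd; case: eqP => // /eqP; exact: xi.
    by case: ifP.
  rewrite integral0_eq// => v _; rewrite /g ifF//.
  apply/negP; rewrite inE => H; apply: xi => j ji.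
  by have := H j; rewrite tnth_upd (negbTE ji).
Qed.

End jacobi_coordinates.

Lemma cvg_EFinP {R : realType} T (F : set_system T) (FF : Filter F) (u : T -> R) (l : R) :
  u x @[x --> F] --> l <-> (u x)%:E @[x --> F] --> l%:E.
Proof.
split => [ul|/fine_cvgP[]//].
by apply/fine_cvgP; split => //; exact: nearW.
Qed.

(** * Removing the regularisation: Aomoto's two-term recursion *)

Section regularisation_limit.
Context {R : realType} {n : nat}.
Variables (beta a b : R).
Implicit Types (x : n.-tuple R) (y : 'I_n -> R) (i j : 'I_n) (m : nat) (e : R).

(** Unlike [regD] this is bounded uniformly in e: in y (4 - y) / (y + e), in its mirror image and in
    d^2 / (d^2 + e), with d = y_i - y_j, every pole is compensated by a zero. *)
Definition regQ e m y :=
  \sum_i (rpoly y (fun j => j != i))`_m *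
    (4 - 2 * y i + y i * (4 - y i) * (a * (y i + e)^-1 - b * (4 - y i + e)^-1))
  + beta / 2 * \sum_i \sum_(j | j != i)
      rQ y m i j * ((y i - y j) ^+ 2 * ((y i - y j) ^+ 2 + e)^-1).

(* Antisymmetrising in (i, j) turns the singular factor 1 / (y_i - y_j) into
   the polynomial (V_i - V_j) / (y_i - y_j). *)
Lemma sum_regD e m y :
  \sum_i regD beta a b e m y i = regW beta a b e y * regQ e m y.
Proof.
pose c i := (rpoly y (fun j => j != i))`_m.
pose r i j := (y i - y j) * ((y i - y j) ^+ 2 + e)^-1.
have rC i j : r j i = - r i j by rewrite /r -(opprB (y i)) sqrrN mulNr.
have key : \sum_i \sum_j rV y m i * r i j =
    2^-1 * \sum_i \sum_(j | j != i) rQ y m i j * ((y i - y j) ^+ 2 * ((y i - y j) ^+ 2 + e)^-1).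
  set L := LHS; have LN : L = - \sum_i \sum_j rV y m j * r i j.
    rewrite /L exchange_big -sumrN/=; apply: eq_bigr => j _.
    by rewrite -sumrN; apply: eq_bigr => i _; rewrite rC mulrN.
  have L2 : L + L = \sum_i \sum_j (rV y m i - rV y m j) * r i j.
    rewrite {2}LN -sumrB; apply: eq_bigr => i _.
    by rewrite -sumrB; apply: eq_bigr => j _; rewrite mulrBl.
  rewrite (_ : L = 2^-1 * (L + L)); last by field.
  rewrite L2; congr (_ * _); apply: eq_bigr => i _.
  rewrite (bigD1 i)//= subrr mul0r add0r; apply: eq_bigr => j ji.
  by rewrite rV_sub 1?eq_sym// /r; ring.
rewrite /regQ mulrDr mulr_sumr.
have -> : beta / 2 * \sum_i \sum_(j | j != i)
      rQ y m i j * ((y i - y j) ^+ 2 * ((y i - y j) ^+ 2 + e)^-1) =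
    \sum_i rV y m i * (beta * \sum_j r i j).
  rewrite -mulrA -key mulr_sumr; apply: eq_bigr => i _.
  by rewrite mulrCA; congr (_ * _); rewrite mulr_sumr.
rewrite mulr_sumr -big_split/=; apply: eq_bigr => i _.
rewrite /regD /rV -/(c i).
by move: (\sum_j _) (regW _ _ _ _ _) ((y i + e)^-1) ((4 - y i + e)^-1) => S W p q; ring.
Qed.

Lemma regQ_bound m : 0 <= beta ->
  exists M : R, forall e y, 0 < e <= 1 -> (forall j, 0 < y j < 4) ->
    `|regQ e m y| <= M.
Proof.
move=> beta0.
(* The fours bound 4 - 2y and the two compensated quotients; 6 = 4 + 1 + 1 counts the three terms of
   [rQ], whose coefficients are at most 5^n. *)
exists (\sum_(i < n) 5 ^+ n * (4 + 4 * (`|a| + `|b|))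
  + beta / 2 * \sum_(i < n) \sum_(j < n | j != i) (6 * 5 ^+ n)).
move=> e y /andP[e0 e1] y4; rewrite /regQ.
have hc A k : `|(rpoly y A)`_k| <= 5 ^+ n by exact: coef_rpoly_bound.
rewrite (le_trans (ler_normD _ _))// lerD//.
  rewrite (le_trans (ler_norm_sum _ _ _))//; apply: ler_sum => i _.
  have /andP[i0 i4] := y4 i.
  rewrite normrM ler_pM// (le_trans (ler_normD _ _))// lerD//.
    by rewrite ler_norml; apply/andP; lra.
  rewrite (_ : _ * (_ - _) = a * (y i * (4 - y i) * (y i + e)^-1)
    - b * (y i * (4 - y i) * (4 - y i + e)^-1)); last by ring.
  have h1 : `|y i * (4 - y i) * (y i + e)^-1| <= 4.
    rewrite ger0_norm; last by rewrite !mulr_ge0 ?invr_ge0//; lra.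
    rewrite ler_pdivrMr; last lra.
    rewrite mulrC ler_pM//; lra.
  have h2 : `|y i * (4 - y i) * (4 - y i + e)^-1| <= 4.
    rewrite ger0_norm; last by rewrite !mulr_ge0 ?invr_ge0//; lra.
    rewrite ler_pdivrMr; last lra.
    rewrite ler_pM//; lra.
  rewrite (le_trans (ler_normB _ _))// [leRHS]mulrDr (normrM a) (normrM b).
  by apply: lerD; rewrite mulrC ler_wpM2r.
rewrite normrM ger0_norm ?divr_ge0// ler_wpM2l ?divr_ge0//.
rewrite (le_trans (ler_norm_sum _ _ _))//; apply: ler_sum => i _.
rewrite (le_trans (ler_norm_sum _ _ _))//; apply: ler_sum => j _.
have e0d := sq_eps_gt0 (y i - y j) e0.
rewrite normrM -[leRHS]mulr1 ler_pM//; last first.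
  rewrite ger0_norm; last by rewrite mulr_ge0 ?sqr_ge0// invr_ge0 ltW.
  by rewrite ler_pdivrMr// mul1r lerDl ltW.
rewrite /rQ coefB coefD -mulrA coefCM coefXM expr2 -mulrA !coefXM.
rewrite (le_trans (ler_normB _ _))// (le_trans (lerD (ler_normD _ _) (lexx _)))//.
have p0 : 0 <= 5 ^+ n :> R by rewrite exprn_ge0.
rewrite (_ : 6 * _ = 4 * 5 ^+ n + 5 ^+ n + 5 ^+ n); last by ring.
rewrite lerD// lerD//.
- rewrite normrM ger0_norm// ler_wpM2l//; case: eqP => _; rewrite ?normr0//; exact: hc.
- by case: eqP => _; rewrite ?normr0//; case: eqP => _; rewrite ?normr0//; exact: hc.
Qed.

Definition limW y := \prod_i (y i `^ a * (4 - y i) `^ b) *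
  \prod_i \prod_(j | j != i) ((y i - y j) ^+ 2) `^ (beta / 4).

Definition eps k : R := k.+1%:R^-1.

Lemma eps_itv k : 0 < eps k <= 1.
Proof. by rewrite invr_gt0 ltr0n/= invf_le1// ler1n. Qed.

Lemma cvg_eps : eps k @[k --> \oo] --> 0.
Proof. exact: cvg_harmonic. Qed.

Lemma cvg_powR_eps (u c : R) : 0 < u -> (u + eps k) `^ c @[k --> \oo] --> u `^ c.
Proof.
move=> u0.
have h : {for u, continuous (fun v : R => v `^ c)}.
  apply: differentiable_continuous; apply/derivable1_diffP.
  exact: (@ex_derive _ _ _ _ _ _ _ (is_derive1_powR c u0)).
apply: (continuous_cvg _ h); rewrite -[X in _ --> X]addr0.
by apply: cvgD; [exact: cvg_cst|exact: cvg_eps].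
Qed.

Lemma cvg_powR0_eps (c : R) : 0 < c -> (eps k) `^ c @[k --> \oo] --> 0.
Proof.
move=> c0; have /cvg_at_rightP := powR_cvg0 c0; apply; split => [k|].
  by have /andP[] := eps_itv k.
exact: cvg_eps.
Qed.

Lemma cvg_regW y : 0 < beta -> (forall i, 0 < y i < 4) ->
  regW beta a b (eps k) y @[k --> \oo] --> limW y.
Proof.
move=> beta0 y4.
rewrite (_ : (fun k => _) = (fun k => \prod_i ((y i + eps k) `^ a * (4 - y i + eps k) `^ b)
  * \prod_i \prod_(j | j != i) ((y i - y j) ^+ 2 + eps k) `^ (beta / 4))); last first.
  apply/funext => k; have /andP[e0 e1] := eps_itv k.
  rewrite /regW /regH expRD expR_sum mulr_sumr expR_sum; congr (_ * _).
    apply: eq_bigr => i _; have /andP[i0 i4] := y4 i.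
    by rewrite /regS expRD /powR !gt_eqF//; lra.
  apply: eq_bigr => i _; rewrite mulr_sumr expR_sum; apply: eq_bigr => j _.
  by rewrite /powR gt_eqF// sq_eps_gt0.
apply: cvgM; apply: cvg_prodR => i _.
  have /andP[i0 i4] := y4 i.
  by apply: cvgM; apply: cvg_powR_eps; lra.
(* Where two coordinates coincide the factor is e^(beta / 4), which tends to 0 since beta > 0. *)
apply: cvg_prodR => j _; have [d0|d0] := eqVneq ((y i - y j) ^+ 2) 0.
  rewrite d0 powR0; last by rewrite mulf_neq0 ?gt_eqF.
  under eq_fun do rewrite add0r.
  by apply: cvg_powR0_eps; rewrite divr_gt0.
by apply: cvg_powR_eps; rewrite lt_def d0 sqr_ge0.
Qed.

Lemma limWE (s : R) x : 0 < beta -> s = 1 \/ s = -1 -> jacobi_support x ->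
  limW (tvec s x) = `|vandermonde x| `^ beta *
    \prod_(j < n) ((2 - s * tnth x j) `^ a * (2 + s * tnth x j) `^ b).
Proof.
move=> beta0 s1 xs; rewrite /limW mulrC; congr (_ * _); last first.
  apply: eq_bigr => i _; rewrite /tvec; congr (_ * _ `^ _); ring.
pose f i j := `|tnth x j - tnth x i| `^ (beta / 2).
have fE i j : ((tvec s x i - tvec s x j) ^+ 2) `^ (beta / 4) = f i j.
  have -> : (tvec s x i - tvec s x j) ^+ 2 = `|tnth x j - tnth x i| `^ 2.
    rewrite powR_mulrn// real_normK ?num_real// /tvec.
    by case: s1 => ->; ring.
  by rewrite -powRrM /f; congr (_ `^ _); field.
under eq_bigr do under eq_bigr do rewrite fE.
have -> : \prod_i \prod_(j | j != i) f i j =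
    (\prod_(i < n) \prod_(j < n | (i < j)%N) f i j) *
    (\prod_(i < n) \prod_(j < n | (i < j)%N) f i j).
  rewrite (eq_bigr (fun i => (\prod_(j < n | (i < j)%N) f i j) *
      (\prod_(j < n | (j < i)%N) f i j))); last first.
    move=> i _; rewrite (bigID (fun j : 'I_n => (i < j)%N))/=; congr (_ * _).
      by apply: eq_bigl => j; rewrite -val_eqE/=; case: ltngtP.
    by apply: eq_bigl => j; rewrite -val_eqE/=; case: ltngtP.
  rewrite big_split/=; congr (_ * _).
  rewrite (exchange_big_dep xpredT)//=; apply: eq_bigr => j _.
  by apply: eq_bigr => i _; rewrite /f distrC.
have -> : \prod_(i < n) \prod_(j < n | (i < j)%N) f i j =
    `|vandermonde x| `^ (beta / 2).
  have pM r (P : pred 'I_n) (F : 'I_n -> R) : \prod_(j <- r | P j) (`|F j| `^ (beta / 2)) =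
      `|\prod_(j <- r | P j) F j| `^ (beta / 2).
    elim: r => [|j r IH]; first by rewrite !big_nil normr1 powR1.
    by rewrite !big_cons; case: (P j); rewrite // IH normrM powRM.
  rewrite /vandermonde -pM; apply: eq_bigr => i _.
  by rewrite -pM.
rewrite -powRD; first by congr (_ `^ _); field.
by rewrite gt_eqF// addr_gt0// divr_gt0.
Qed.

Lemma limW_bound : 0 < beta ->
  exists2 K : R, 0 <= K & forall y, (forall i, 0 < y i < 4) ->
    `|limW y| <= K * \prod_i dom_weight a b (y i).
Proof.
move=> beta0; have [K K0 WK] := @regW_bound R n beta a b (ltW beta0); exists K => // y y4.
have cW := cvg_regW beta0 y4.
rewrite ger0_norm; last first.
  by rewrite mulr_ge0//; apply: prodr_ge0 => i _; rewrite ?mulr_ge0 ?powR_ge0// prodr_ge0// => j _; exact: powR_ge0.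
rewrite -(cvg_lim _ cW)//; apply: limr_le; first exact: (cvgP _ cW).
by apply: nearW => k; apply: WK => //; exact: eps_itv.
Qed.

Lemma measurable_limW (s : R) :
  measurable_fun [set: n.-tuple R] (fun x => limW (tvec s x)).
Proof.
have mt := @measurable_tvec R n s.
have mp (f : n.-tuple R -> R) c : measurable_fun [set: n.-tuple R] f ->
    measurable_fun [set: n.-tuple R] (fun x => f x `^ c).
  by move=> mf; exact: (measurableT_comp (measurable_powR c) mf).
apply: measurable_funM; apply: measurable_prod => i _.
  apply: measurable_funM; apply: mp => //; exact: measurable_funB.
under eq_fun do rewrite big_mkcond.
apply: measurable_prod => j _; case: (j != i); last exact: measurable_cst.
by apply: mp; apply: measurable_funX; exact: measurable_funB.
Qed.

Lemma integrable_dom_prod (s : R) : s = 1 \/ s = -1 -> -1 < a -> -1 < b ->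
  (lebesgue_tuple n).-integrable (@jacobi_support R n)
    (fun x => (\prod_i dom_weight a b (tvec s x i))%:E).
Proof.
move=> s1 a1 b1; have mD := @measurable_jacobi_support R n.
have mI : measurable (`](-2)%R, 2%R[%classic : set (measurableTypeR R)).
  exact: measurable_itv.
pose h v := if v \in `](-2)%R, 2%R[%classic then dom_weight a b (2 - s * v) else 0.
have h0 v : 0 <= h v by rewrite /h; case: ifP => // _; exact: dom_weight_ge0.
have mh : measurable_fun setT h.
  have := (measurable_restrictT (fun v => dom_weight a b (2 - s * v)) mI).1.
  by apply; apply: measurable_funTS; exact: measurable_dom_weight.
have ih : (@lebesgue_measure R).-integrable setT (EFin \o h).
  have := integrable_dom_weight s1 a1 b1.
  rewrite (integrable_mkcond _ mI) (_ : _ \_ _ = EFin \o h)//.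
  by apply/funext => v; rewrite /h patchE/=; case: ifP.
have iP : (lebesgue_tuple n).-integrable setT
    (fun x => (\prod_(i < n) h (tnth x i))%:E).
  apply/integrableP; split.
    by apply/measurable_EFinP; exact: measurable_prod_tnth.
  under eq_integral do rewrite /= ger0_norm ?prodr_ge0//.
  by rewrite integral_prod_tnth// ltey_eq fin_numX// integrable_fin_num.
have := integrableS measurableT mD (@subsetT _ _) iP.
apply: eq_integrable => // x; rewrite inE => xs; congr (_%:E).
by apply: eq_bigr => i _; rewrite /h ifT// inE/= in_itv/= xs.
Qed.

Lemma integrable_coef_limW (s : R) (A : pred 'I_n) m : s = 1 \/ s = -1 ->
  0 < beta -> -1 < a -> -1 < b ->
  (lebesgue_tuple n).-integrable (@jacobi_support R n)
    (fun x => ((rpoly (tvec s x) A)`_m * limW (tvec s x))%:E).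
Proof.
move=> s1 beta0 a1 b1; have [K K0 WK] := limW_bound beta0.
have mD := @measurable_jacobi_support R n.
have := integrableZl mD (5 ^+ n * K) (integrable_dom_prod s1 a1 b1).
apply: le_integrable => //.
  apply/measurable_EFinP; apply: measurable_funTS; apply: measurable_funM.
    exact: measurable_coef_rpoly.
  exact: measurable_limW.
move=> x xs; have x4 i := tvec_itv i s1 xs.
rewrite -EFinM /= lee_fin normrM (le_trans _ (ler_norm _))// -mulrA ler_pM//.
  exact: coef_rpoly_bound.
exact: WK.
Qed.

(** The value of the divergence divided by the weight at e = 0, with all sums evaluated. Only two
    consecutive elementary symmetric functions remain, so the vanishing of its integral is a
    two-term recursion. *)
Definition limQ m y :=
  4 * m.+1%:R * (a + 1 + beta / 2 * m%:R) * (rpoly y xpredT)`_m.+1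
  - (n%:R - m%:R) * (a + b + 2 + beta / 2 * (n%:R + m%:R - 1)) * (rpoly y xpredT)`_m.

Lemma limQE m y : (forall i, 0 < y i < 4) -> limQ m y =
  \sum_i (rpoly y (fun j => j != i))`_m *
    (4 - 2 * y i + y i * (4 - y i) * (a * (y i)^-1 - b * (4 - y i)^-1))
  + beta / 2 * \sum_i \sum_(j | j != i) rQ y m i j.
Proof.
move=> y4; rewrite sum_rQ.
rewrite [X in _ = X + _](_ : _ = 4 * (a + 1) * (\sum_i (rpoly y (fun j => j != i))`_m)
    - (a + b + 2) * (\sum_i y i * (rpoly y (fun j => j != i))`_m)).
  rewrite sum_rP sum_rtP /limQ.
  by move: (_`_m.+1) (_`_m) (m.+1%:R) (m%:R) (n%:R) => p q u v w; field.
rewrite !mulr_sumr -sumrB; apply: eq_bigr => i _; have /andP[i0 i4] := y4 i.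
by field; apply/andP; split; rewrite gt_eqF//; lra.
Qed.

Lemma cvg_regW_regQ m y : 0 < beta -> (forall i, 0 < y i < 4) ->
  regW beta a b (eps k) y * regQ (eps k) m y @[k --> \oo] --> limW y * limQ m y.
Proof.
move=> beta0 y4; have cW := cvg_regW beta0 y4.
have cinv u : u != 0 -> (u + eps k)^-1 @[k --> \oo] --> u^-1.
  move=> u0; apply: cvgV => //; rewrite -[X in _ --> X]addr0.
  by apply: cvgD; [exact: cvg_cst|exact: cvg_eps].
(* If two coordinates coincide, d^2 / (d^2 + e) is 0 instead of tending to 1, but the weight tends
   to 0 and [regQ] is bounded. Convergence thus holds everywhere in the cube, without discarding the
   diagonals. *)
have [[i [j [ji dij]]]|inj] := pselect (exists i j, j != i /\ y i - y j = 0).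
  have W0 : limW y = 0.
    rewrite /limW [X in _ * X](bigD1 i)//= [X in _ * (X * _)](bigD1 j)//= dij expr0n/=.
    rewrite powR0 ?mul0r ?mulr0//.
    by rewrite gt_eqF// divr_gt0.
  rewrite W0 mul0r in cW *; have [M HM] := regQ_bound m (ltW beta0).
  apply/norm_cvg0P; apply: (@squeeze_cvgr _ _ _ _ (cst 0)
    (fun k => M * `|regW beta a b (eps k) y|)).
  - apply: nearW => k; rewrite /= normr_ge0/= normrM mulrC.
    by rewrite ler_wpM2r// HM//; exact: eps_itv.
  - exact: cvg_cst.
  - rewrite -[X in _ --> X](mulr0 M) -(normr0 R); apply: cvgM; first exact: cvg_cst.
    exact: cvg_norm.
apply: cvgM => //; rewrite limQE//; apply: cvgD.
  apply: cvg_sumR => i _; have /andP[i0 i4] := y4 i.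
  apply: cvgM; first exact: cvg_cst.
  apply: cvgD; first exact: cvg_cst.
  apply: cvgM; first exact: cvg_cst.
  apply: cvgB; (apply: cvgM; first exact: cvg_cst); apply: cinv; rewrite gt_eqF//; lra.
apply: cvgM; first exact: cvg_cst.
apply: cvg_sumR => i _; apply: cvg_sumR => j ji.
have d0 : (y i - y j) ^+ 2 != 0.
  by rewrite sqrf_eq0; apply/eqP => dij; apply: inj; exists i, j.
rewrite -[X in _ --> X]mulr1 -(divff d0).
apply: cvgM; first exact: cvg_cst.
by apply: cvgM; [exact: cvg_cst|exact: cinv].
Qed.

Local Notation E s m := (\int[lebesgue_tuple n]_(x in @jacobi_support R n)
  ((rpoly (tvec s x) xpredT)`_m * limW (tvec s x))).

(** Each regularised divergence has integral 0. Dominated convergence, with [K] for the weight and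
    [M] for [regQ], turns this into the vanishing of the integral of [limW] times [limQ]. *)
Lemma aomoto_rec (s : R) m : s = 1 \/ s = -1 -> 0 < beta -> -1 < a -> -1 < b ->
  4 * m.+1%:R * (a + 1 + beta / 2 * m%:R) * E s m.+1 =
  (n%:R - m%:R) * (a + b + 2 + beta / 2 * (n%:R + m%:R - 1)) * E s m.
Proof.
move=> s1 beta0 a1 b1; have mD := @measurable_jacobi_support R n.
set A := 4 * _ * _; set B := _ * (a + b + _ + _).
pose L x := A * ((rpoly (tvec s x) xpredT)`_m.+1 * limW (tvec s x))
  - B * ((rpoly (tvec s x) xpredT)`_m * limW (tvec s x)).
have LE x : L x = limW (tvec s x) * limQ m (tvec s x).
  by rewrite /L /limQ -/A -/B; ring.
have iD := integrable_dom_prod s1 a1 b1.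
have L0 : (\int[lebesgue_tuple n]_(x in @jacobi_support R n) (L x)%:E = 0)%E.
  pose f k x := (\sum_i regD beta a b (eps k) m (tvec s x) i)%:E.
  have mR k i : measurable_fun (@jacobi_support R n)
      (fun x => regD beta a b (eps k) m (tvec s x) i).
    by apply: measurable_regD => //; have /andP[] := eps_itv k.
  have f0 k : (\int[lebesgue_tuple n]_(x in @jacobi_support R n) f k x = 0)%E.
    rewrite /f; under eq_integral do rewrite -sumEFin.
    rewrite integral_sum//; last first.
      move=> i; have [C HC] := regD_bound a b m i (ltW beta0) (eps_itv k).
      have := integrableZl mD C iD; apply: le_integrable => //.
        by apply/measurable_EFinP; exact: mR.
      move=> x xs; rewrite -EFinM /= lee_fin (le_trans _ (ler_norm _))// HC// => j.
      exact: tvec_itv.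
    by rewrite big1// => i _; apply: integral_regD_eq0 => //; [exact: ltW|exact: eps_itv].
  have [K K0 WK] := @regW_bound R n beta a b (ltW beta0).
  have [M HM] := regQ_bound m (ltW beta0).
  have fE k x : f k x = (regW beta a b (eps k) (tvec s x) * regQ (eps k) m (tvec s x))%:E.
    by rewrite /f sum_regD.
  have mL : measurable_fun (@jacobi_support R n) (EFin \o L).
    apply/measurable_EFinP; apply: measurable_funTS; apply: measurable_funB.
      apply: measurable_funM => //; apply: measurable_funM; first exact: measurable_coef_rpoly.
      exact: measurable_limW.
    apply: measurable_funM => //; apply: measurable_funM; first exact: measurable_coef_rpoly.
    exact: measurable_limW.
  have [] := @dominated_convergence _ _ _ (lebesgue_tuple n) (@jacobi_support R n) mD
    f (EFin \o L) (fun x => (K * M)%:E * (\prod_i dom_weight a b (tvec s x i))%:E)%E.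
  - by move=> k; apply/measurable_EFinP; apply: measurable_sum => i; exact: mR.
  - exact: mL.
  - apply: aeW => x xs; rewrite /= LE.
    have := @cvg_regW_regQ m (tvec s x) beta0 (fun i => tvec_itv i s1 xs).
    by move=> c; under eq_fun do rewrite fE; exact/cvg_EFinP.
  - exact: integrableZl.
  - apply: aeW => x k xs; rewrite fE /= -EFinM lee_fin normrM mulrAC.
    have x4 i := tvec_itv i s1 xs.
    rewrite ler_pM// ?HM ?eps_itv//.
    rewrite ger0_norm; last exact: expR_ge0.
    by apply: WK => //; exact: eps_itv.
  move=> _ _; rewrite (_ : [sequence _]_k = (fun=> 0%E)); last by apply/funext => k /=.
  by move=> /cvg_lim; rewrite lim_cst// => <-.
have i1 := integrable_coef_limW xpredT m.+1 s1 beta0 a1 b1.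
have i0 := integrable_coef_limW xpredT m s1 beta0 a1 b1.
apply/eqP; rewrite -subr_eq0 -!RintegralZl// -RintegralB//; first by rewrite /Rintegral L0.
- exact: (integrableZl mD A i1).
- exact: (integrableZl mD B i0).
Qed.

End regularisation_limit.

(** * Exact ratios, positivity and monotonicity of the Selberg integrals *)

Section jacobi_integral.
Context {R : realType} {n : nat}.
Variable beta : R.
Hypothesis beta_gt0 : 0 < beta.
Implicit Types (a b : R) (x : n.-tuple R).
Let D := @jacobi_support R n.
Let mD : measurable D := @measurable_jacobi_support R n.

Definition jacobi_int a b : R :=
  \int[lebesgue_tuple n]_(x in @jacobi_support R n) jacobi_weight beta a b x.

Lemma jacobi_weight_ge0 a b x : 0 <= jacobi_weight beta a b x.
Proof.
by rewrite mulr_ge0 ?powR_ge0// prodr_ge0// => i _; rewrite mulr_ge0// powR_ge0.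
Qed.

Lemma jacobi_weightE1 a b x : D x ->
  jacobi_weight beta a b x = limW beta a b (tvec 1 x).
Proof.
move=> xD; rewrite (limWE a b beta_gt0 _ xD); last by left.
by congr (_ * _); apply: eq_bigr => i _; rewrite mul1r.
Qed.

(** For s = -1 the coordinate is 2 + x, so the first exponent of [limW] is now the one at x = -2.
    This gives every statement about the second parameter from one about the first. *)
Lemma jacobi_weightEN1 a b x : D x ->
  jacobi_weight beta b a x = limW beta a b (tvec (-1) x).
Proof.
move=> xD; rewrite (limWE a b beta_gt0 _ xD); last by right.
congr (_ * _); apply: eq_bigr => i _; rewrite !mulNr mul1r opprK mulrC.
by [].
Qed.

Lemma integrable_jacobi_weight a b : -1 < a -> -1 < b ->
  (lebesgue_tuple n).-integrable D (fun x => (jacobi_weight beta a b x)%:E).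
Proof.
move=> a1 b1.
have := @integrable_coef_limW R n beta a b 1 pred0 0 (or_introl erefl) beta_gt0 a1 b1.
apply: eq_integrable => // x; rewrite inE => xD; rewrite jacobi_weightE1//.
by rewrite /rpoly big_pred0// coef1 eqxx mul1r.
Qed.

Let E a b s m := \int[lebesgue_tuple n]_(x in D)
  ((rpoly (tvec s x) xpredT)`_m * limW beta a b (tvec s x)).

Lemma coef_rpoly_top (y : 'I_n -> R) : (rpoly y xpredT)`_n = 1.
Proof.
have /monicP : rpoly y xpredT \is monic.
  by apply: monic_prod => i _; rewrite -[y i]opprK polyCN monicXsubC.
rewrite lead_coefE /rpoly.
rewrite (eq_bigr (fun i => 'X - (- y i)%:P)); last by move=> i _; rewrite polyCN opprK.
by rewrite size_prod_XsubC /index_enum -enumT size_enum_ord.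
Qed.

Lemma coef_rpoly_bot (y : 'I_n -> R) : (rpoly y xpredT)`_0 = \prod_i y i.
Proof.
rewrite -horner_coef0 /rpoly horner_prod; apply: eq_bigr => i _.
by rewrite hornerD hornerX hornerC add0r.
Qed.

Lemma jacobi_int_top a b : jacobi_int a b = E a b 1 n /\ jacobi_int b a = E a b (-1) n.
Proof.
split; apply: eq_Rintegral => x; rewrite inE => xD; rewrite coef_rpoly_top mul1r.
  exact: jacobi_weightE1.
exact: jacobi_weightEN1.
Qed.

Lemma limW_shift a b (s : R) x : s = 1 \/ s = -1 -> D x ->
  limW beta (a + 1) b (tvec s x) = \prod_i tvec s x i * limW beta a b (tvec s x).
Proof.
move=> s1 xD; rewrite /limW [RHS]mulrA; congr (_ * _); rewrite -big_split/=.
apply: eq_bigr => i _; have /andP[i0 i4] := tvec_itv i s1 xD.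
rewrite powRD; last by apply/implyP => _; rewrite gt_eqF.
by rewrite powRr1 ?ltW//; ring.
Qed.

Lemma jacobi_int_bot a b :
  jacobi_int (a + 1) b = E a b 1 0 /\ jacobi_int b (a + 1) = E a b (-1) 0.
Proof.
split; apply: eq_Rintegral => x; rewrite inE => xD; rewrite coef_rpoly_bot.
  by rewrite jacobi_weightE1// limW_shift//; left.
by rewrite jacobi_weightEN1// limW_shift//; right.
Qed.

Definition selberg_ratio a b : R := \prod_(j < n)
  ((a + 1 + beta / 2 * j%:R) / (a + b + 2 + beta / 2 * (n%:R + j%:R - 1))).

(** The recursion is chained from coefficient 0, the product of the coordinates, to coefficient n,
    the constant 1. The products of m + 1 and of n - m cancel after reversing the order of one of
    them. *)
Lemma E_ratio a b s : s = 1 \/ s = -1 -> -1 < a -> -1 < b ->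
  E a b s 0 = E a b s n * (4 ^+ n * selberg_ratio a b).
Proof.
move=> s1 a1 b1.
pose q m : R := a + b + 2 + beta / 2 * (n%:R + m%:R - 1).
pose p m : R := a + 1 + beta / 2 * m%:R.
have q0 m : (m < n)%N -> 0 < q m.
  move=> mn; have n1 : 1 <= n%:R :> R by rewrite ler1n; case: n mn.
  have m0 : 0 <= m%:R :> R by [].
  have : 0 <= beta / 2 * (n%:R + m%:R - 1) by rewrite mulr_ge0//; [rewrite divr_ge0// ltW|lra].
  by rewrite /q; lra.
have H k : (k <= n)%N -> E a b s 0 = E a b s k *
    \prod_(m < k) (4 * m.+1%:R * p m / ((n%:R - m%:R) * q m)).
  elim: k => [|k IH] kn; first by rewrite big_ord0 mulr1.
  rewrite IH ?(ltnW kn)// big_ord_recr/= (mulrC (\prod_(_ < k) _)) mulrA; congr (_ * _).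
  have nz : (n%:R - k%:R) * q k != 0.
    by rewrite mulf_neq0 ?gt_eqF ?q0// subr_gt0 ltr_nat.
  apply: (mulfI nz); rewrite -[LHS](aomoto_rec k s1 beta_gt0 a1 b1) -/(E a b s k.+1) -/(p k).
  by rewrite [RHS]mulrCA [X in _ = _ * X]mulrC divfK// mulrC.
rewrite (H n)//; congr (_ * _).
rewrite /selberg_ratio; under eq_bigr => m _ do rewrite -mulf_div.
rewrite big_split/=; congr (_ * _).
rewrite prodf_div big_split/= prodr_const card_ord -mulrA.
have -> : \prod_(m < n) (n%:R - m%:R) = \prod_(m < n) m.+1%:R :> R.
  rewrite (reindex_inj rev_ord_inj)/=; apply: eq_bigr => m _.
  by rewrite natrB// opprB addrC subrK.
rewrite divff ?mulr1//; apply/prodf_neq0 => m _; by rewrite pnatr_eq0.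
Qed.

Lemma jacobi_int_ratio a b : -1 < a -> -1 < b ->
  jacobi_int (a + 1) b = jacobi_int a b * (4 ^+ n * selberg_ratio a b) /\
  jacobi_int b (a + 1) = jacobi_int b a * (4 ^+ n * selberg_ratio a b).
Proof.
move=> a1 b1; have [-> ->] := jacobi_int_top a b; have [-> ->] := jacobi_int_bot a b.
by split; apply: E_ratio => //; [left|right].
Qed.

Lemma jacobi_weight_eq0 a b x : D x ->
  (jacobi_weight beta a b x == 0) = (`|vandermonde x| `^ beta == 0).
Proof.
move=> xD; rewrite mulf_eq0 orbC gt_eqF// prodr_gt0// => i _.
by have := xD i => xi; rewrite mulr_gt0// powR_gt0//; lra.
Qed.

(** Inside the support the weight vanishes exactly where the Vandermonde product does, whatever the
    exponents. If one integral is 0, its weight is 0 almost everywhere, and then so is every other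
    one. *)
Lemma jacobi_int_gt0 a b a' b' : -1 < a -> -1 < b -> -1 < a' -> -1 < b' ->
  0 < jacobi_int a b -> 0 < jacobi_int a' b'.
Proof.
move=> a1 b1 a1' b1'; have iw := integrable_jacobi_weight a1 b1.
have iw' := integrable_jacobi_weight a1' b1'.
have Z0 : 0 <= jacobi_int a' b' by apply: Rintegral_ge0 => x _; exact: jacobi_weight_ge0.
rewrite [in X in _ -> X]lt_def Z0 andbT; apply: contraTneq => Zeq.
have Ieq : (\int[lebesgue_tuple n]_(x in D) `|(jacobi_weight beta a' b' x)%:E| = 0)%E.
  under eq_integral do rewrite gee0_abs ?lee_fin ?jacobi_weight_ge0//.
  by rewrite -(fineK (integrable_fin_num mD iw')) -[fine _]/(jacobi_int a' b') Zeq.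
have /ae_eq_integral_abs := measurable_int _ iw'.
move=> /(_ (lebesgue_tuple n) mD)[/(_ Ieq) ae0 _].
rewrite -leNgt /jacobi_int /Rintegral (_ : (\int[_]_(x in _) _)%E = 0%E)//.
rewrite (ae_eq_integral (cst 0%E))//; first by rewrite integral0.
- exact: measurable_int iw.
- apply: filterS ae0 => x /= h xD; have /(congr1 fine)/=/eqP := h xD.
  by rewrite jacobi_weight_eq0// -(jacobi_weight_eq0 a b xD) => /eqP ->.
Qed.

Lemma le_limW a a' b (y : 'I_n -> R) : a <= a' -> (forall i, 0 < y i < 4) ->
  limW beta a' b y <= (4 `^ (a' - a)) ^+ n * limW beta a b y.
Proof.
move=> aa y4; rewrite /limW mulrA ler_wpM2r//.
  by apply: prodr_ge0 => i _; apply: prodr_ge0 => j _; exact: powR_ge0.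
rewrite -[n in _ ^+ n]card_ord -prodr_const -big_split/=.
apply: ler_prod => i _; have /andP[i0 i4] := y4 i.
rewrite mulr_ge0 ?powR_ge0//= mulrA ler_wpM2r ?powR_ge0//.
rewrite -[leLHS](_ : y i `^ (a' - a) * y i `^ a = _); last first.
  by rewrite -powRD ?subrK//; apply/implyP => _; rewrite gt_eqF.
by rewrite ler_wpM2r ?powR_ge0// ge0_ler_powR ?nnegrE ?subr_ge0//; exact: ltW.
Qed.

Lemma le_jacobi_int a a' b : -1 < a -> a <= a' -> -1 < b ->
  jacobi_int a' b <= (4 `^ (a' - a)) ^+ n * jacobi_int a b /\
  jacobi_int b a' <= (4 `^ (a' - a)) ^+ n * jacobi_int b a.
Proof.
move=> a1 aa b1; have a1' : -1 < a' by exact: lt_le_trans aa.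
have iZ u v c : -1 < u -> -1 < v ->
    (lebesgue_tuple n).-integrable D (fun x => (c * jacobi_weight beta u v x)%:E).
  by move=> u1 v1; exact: (integrableZl mD c (integrable_jacobi_weight u1 v1)).
split; rewrite -RintegralZl//; try exact: integrable_jacobi_weight.
  apply: le_Rintegral => //; first exact: integrable_jacobi_weight.
    exact: iZ.
  move=> x xD; rewrite !jacobi_weightE1//; apply: le_limW => // i.
  by apply: tvec_itv => //; left.
apply: le_Rintegral => //; first exact: integrable_jacobi_weight.
  exact: iZ.
move=> x xD; rewrite !jacobi_weightEN1//; apply: le_limW => // i.
by apply: tvec_itv => //; right.
Qed.

End jacobi_integral.

(** * Asymptotics of the logarithm of the Selberg integral *)

Section log_estimates.
Context {R : realType}.
Implicit Types (u x : R).

(** Both sides come from ln (1 + v) <= v: once at v = u, and once for the inverse 1 / (1 + u) = 1 -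
    u / (1 + u). *)
Lemma ln1D_order1 (d u : R) : 0 < d -> d <= 1 + u ->
  `|ln (1 + u) - u| <= u ^+ 2 / d.
Proof.
move=> d0 du; have u0 : 0 < 1 + u by exact: lt_le_trans du.
have h1 : ln (1 + u) <= u by apply: le_ln1Dx; lra.
have h2 : u / (1 + u) <= ln (1 + u).
  rewrite -[ln _]opprK lerNr -lnV ?posrE//.
  rewrite [X in ln X](_ : _ = 1 + (- (u / (1 + u)))); last by field; rewrite gt_eqF.
  apply: le_ln1Dx.
  have -> : - (u / (1 + u)) = (1 + u)^-1 - 1 by field; rewrite gt_eqF.
  by rewrite ltrBrDr addNr invr_gt0.
rewrite distrC ger0_norm ?subr_ge0//.
apply: (@le_trans _ _ (u - u / (1 + u))); first by rewrite lerD2l lerN2.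
rewrite (_ : u - _ = u ^+ 2 / (1 + u)); last by field; rewrite gt_eqF.
by rewrite ler_wpM2l ?sqr_ge0// lef_pV2 ?posrE.
Qed.

(** The mean value theorem for the remainder, whose derivative v^2 / (1 + v) is at most 2 v^2
    because 1 + v >= 1/2. *)
Lemma ln1D_order2 u : - 2^-1 <= u ->
  `|ln (1 + u) - u + u ^+ 2 / 2| <= 2 * `|u| ^+ 3.
Proof.
move=> u1; pose g (v : R) := ln (1 + v) - v + v ^+ 2 / 2.
pose g' (v : R) := v ^+ 2 / (1 + v).
have dg (v : R) : - 2^-1 <= v -> is_derive v 1 g (g' v).
  move=> v1; have v0 : 0 < 1 + v by lra.
  have d1 : is_derive v 1 (fun w : R => 1 + w) 1.
    have d := is_deriveD (is_derive_cst (1 : R) v 1) (is_derive_id v 1).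
    by apply: (is_derive_eq d); rewrite add0r.
  have d2 := @is_derive1_comp R (@ln R) (fun w => 1 + w) v _ _ (is_derive1_ln v0) d1.
  have d3 : is_derive v 1 (fun w : R => w ^+ 2 / 2) v.
    by apply: is_derive_eq; rewrite /GRing.scale/=; field.
  have d4 := is_deriveD (is_deriveB d2 (is_derive_id v 1)) d3.
  apply: (is_derive_eq d4); rewrite /g'; field; rewrite gt_eqF//; lra.
have cg (v : R) : - 2^-1 <= v -> {for v, continuous g}.
  move=> v1; apply: differentiable_continuous; apply/derivable1_diffP.
  exact: (@ex_derive _ _ _ _ _ _ _ (dg _ v1)).
have g0 : g 0 = 0 by rewrite /g addr0 ln1 expr0n/= mul0r subr0 addr0.
have g'b (v : R) : - 2^-1 <= v -> `|v| <= `|u| -> `|g' v| <= 2 * `|u| ^+ 2.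
  move=> v1 vu; have v0 : 0 < 1 + v by lra.
  rewrite /g' normrM normfV (gtr0_norm v0) normrX ler_pdivrMr//.
  have h : `|v| ^+ 2 <= `|u| ^+ 2 by rewrite lerXn2r// nnegrE.
  rewrite (le_trans h)// mulrAC ler_peMl ?exprn_ge0//; lra.
rewrite -/(g u) exprSr mulrA.
have [u0|u0] := leP 0 u.
  have [||c] := @MVT_segment R g g' 0 u u0.
  - by move=> v; rewrite in_itv/= => v0; apply: dg; lra.
  - by apply: continuous_in_subspaceT => v; rewrite inE/= in_itv/= => v0; apply: cg; lra.
  rewrite in_itv/= g0 !subr0 => c0 ->; rewrite normrM ler_wpM2r// g'b//; first lra.
  by rewrite !ger0_norm//; lra.
have [||c] := @MVT_segment R g g' u 0 (ltW u0).
- by move=> v; rewrite in_itv/= => v0; apply: dg; lra.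
- by apply: continuous_in_subspaceT => v; rewrite inE/= in_itv/= => v0; apply: cg; lra.
rewrite in_itv/= g0 !sub0r => c0 /eqP; rewrite eqr_oppLR mulrN opprK => /eqP ->.
rewrite normrM ler_wpM2r// g'b//; first lra.
by rewrite !ler0_norm//; lra.
Qed.

(** From 1 / n^2 <= 2 (1 / n - 1 / (n + 1)) the increments telescope. All asymptotics in n are
    reduced to this: a sum minus its conjectured equivalent has increments O(1 / n^2). *)
Lemma bounded_increments (v : nat -> R) (C : R) : 0 <= C ->
  (forall n, (0 < n)%N -> `|v n.+1 - v n| <= C / n%:R ^+ 2) ->
  forall n, (0 < n)%N -> `|v n| <= `|v 1| + 2 * C.
Proof.
move=> C0 dv.
have H n : `|v n.+1| <= `|v 1| + 2 * C * (1 - n.+1%:R^-1).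
  elim: n => [|n IH]; first by rewrite invr1 subrr mulr0 addr0.
  rewrite -(subrK (v n.+1) (v n.+2)) (le_trans (ler_normD _ _))//.
  rewrite (le_trans (lerD (dv _ (ltn0Sn n)) IH))// addrCA lerD2l.
  have n1 : 1 <= n.+1%:R :> R by rewrite ler1n.
  have -> : n.+2%:R = n.+1%:R + 1 :> R by rewrite natr1.
  move: (n.+1%:R) n1 => N N1; have N0 : 0 < N by lra.
  rewrite -subr_ge0 (_ : _ - _ = C * ((N - 1) / (N ^+ 2 * (N + 1)))); last first.
    by field; apply/andP; split; rewrite gt_eqF//; lra.
  rewrite mulr_ge0// divr_ge0 ?subr_ge0// mulr_ge0 ?exprn_ge0//; lra.
case=> // n _; apply: (le_trans (H n)); rewrite lerD2l -[leRHS]mulr1.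
by rewrite ler_wpM2l ?mulr_ge0// gerBl invr_ge0.
Qed.

(** The window from n to 2n - 1 moves to the one from n + 1 to 2n + 1: it loses n and gains 2n and
    2n + 1. *)
Lemma sum_shift (f : nat -> R) n :
  \sum_(j < n.+1) f (n.+1 + j)%N = \sum_(j < n) f (n + j)%N
    + (f (n + n)%N + f (n.+1 + n)%N - f n).
Proof.
rewrite big_ord_recr/=.
have -> : \sum_(j < n) f (n.+1 + j)%N = \sum_(j < n) f (n + j)%N + f (n + n)%N - f n.
  have := @big_ord_recl R 0 +%R n (fun j : 'I_n.+1 => f (n + j)%N) => /=.
  have -> : \sum_(j < n.+1) f (n + j)%N = \sum_(j < n) f (n + j)%N + f (n + n)%N.
    by rewrite big_ord_recr.
  rewrite addn0 => ->; rewrite [RHS]addrAC subrr add0r.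
  by apply: eq_bigr => j _; rewrite /bump/= addnS addSn.
ring.
Qed.

Variables (k : R).
Hypothesis k0 : 0 < k.

(** The first sum is harmonic and is followed in n. The second has n terms, each at most 1 / (q n)
    with q = min p0 k, so it is bounded by 1 / q for every p >= p0. *)
Lemma asymptotic_sum_inv (al p0 : R) : 0 < al -> 0 < p0 ->
  exists C : R, forall p n, p0 <= p -> (0 < n)%N ->
    `|\sum_(j < n) ((al + k * j%:R)^-1 - (p + k * (n%:R + j%:R - 1))^-1)
      - ln n%:R / k| <= C.
Proof.
move=> al0 p00.
pose v n : R := \sum_(j < n) (al + k * j%:R)^-1 - ln n%:R / k.
pose C1 := al / k ^+ 2 + 1 / k.
have C10 : 0 <= C1 by rewrite addr_ge0// divr_ge0 ?exprn_ge0// ltW.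
have dv n : (0 < n)%N -> `|v n.+1 - v n| <= C1 / n%:R ^+ 2.
  move=> n0; have N0 : 0 < n%:R :> R by rewrite ltr0n.
  rewrite /v big_ord_recr/=.
  rewrite (_ : _ - _ = ((al + k * n%:R)^-1 - (k * n%:R)^-1)
     - (ln (1 + n%:R^-1) - n%:R^-1) / k); last first.
    have -> : n.+1%:R = n%:R * (1 + n%:R^-1) :> R.
      by rewrite mulrDr mulr1 divff ?gt_eqF// natr1.
    have N1 : 0 < 1 + n%:R^-1 :> R by rewrite addr_gt0 ?invr_gt0.
    rewrite lnM ?posrE//.
    by field; apply/and3P; split; rewrite gt_eqF// ?addr_gt0// ?mulr_gt0//.
  rewrite [leRHS]mulrDl (le_trans (ler_normB _ _))// lerD//.
    rewrite (_ : _ - _ = - (al / (k * n%:R * (al + k * n%:R)))); last first.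
      by field; apply/and3P; split; rewrite gt_eqF// ?addr_gt0// ?mulr_gt0//.
    have kn : 0 < k * n%:R by rewrite mulr_gt0.
    rewrite normrN ger0_norm; last by rewrite divr_ge0 ?mulr_ge0// ltW// addr_gt0.
    rewrite -[leRHS]mulrA -invfM ler_wpM2l ?(ltW al0)// lef_pV2 ?posrE; last 2 first.
      by rewrite mulr_gt0// addr_gt0.
      by rewrite mulr_gt0 ?exprn_gt0.
    by rewrite -exprMn expr2 ler_wpM2l ?(ltW kn)// lerDr ltW.
  rewrite normrM normfV (gtr0_norm k0) mul1r mulrC ler_wpM2l ?invr_ge0 ?(ltW k0)//.
  have := @ln1D_order1 1 n%:R^-1 ltr01; rewrite invr1 mulr1 exprVn; apply.
  by rewrite lerDl invr_ge0.
pose q := Num.min p0 k; have q0 : 0 < q by rewrite lt_min p00.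
exists (`|v 1| + 2 * C1 + q^-1) => p n pp n0.
have n1 : 1 <= n%:R :> R by rewrite ler1n.
rewrite sumrB addrAC -/(v n) (le_trans (ler_normB _ _))// lerD//.
  exact: bounded_increments.
have yq (j : 'I_n) : q * n%:R <= p + k * (n%:R + j%:R - 1).
  have j0 : 0 <= j%:R :> R by [].
  apply: (@le_trans _ _ (q + q * (n%:R - 1))).
    by rewrite mulrBr mulr1 addrC subrK.
  have qp : q <= p by rewrite (le_trans _ pp)// /q ge_min lexx.
  have qk : q <= k by rewrite /q ge_min lexx orbT.
  rewrite lerD// ler_pM//; [exact: ltW|lra|lra].
have qn : 0 < q * n%:R by rewrite mulr_gt0//; lra.
rewrite ger0_norm; last first.
  by apply: sumr_ge0 => j _; rewrite invr_ge0 (le_trans _ (yq j))// ltW.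
apply: (@le_trans _ _ (\sum_(j < n) (q * n%:R)^-1)).
  by apply: ler_sum => j _; rewrite lef_pV2 ?posrE// (lt_le_trans _ (yq j)).
rewrite sumr_const card_ord -[_ *+ n]mulr_natl.
rewrite (_ : _ * _ = q^-1)//; field; apply/andP; split; rewrite gt_eqF//; lra.
Qed.

(** By [sum_shift] the increment in n involves four logarithms. Their terms ln (k n) cancel, those
    in ln 2 cancel against ln 4, and the coefficients of 1 / n, namely al/k + (p - k)/k - (p -
    k)/(2k) - p/(2k), add up to al/k - 1/2, the factor of ln n. This factor is free of p, which
    carries the other parameter. *)
Lemma asymptotic_sum_ln (al p0 p1 : R) : 0 < al -> 0 < p0 ->
  exists C : R, forall p n, p0 <= p <= p1 -> (0 < n)%N ->
    `|\sum_(j < n) (ln (al + k * j%:R) - ln (p + k * (n%:R + j%:R - 1)))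
      + n%:R * ln 4 - (al / k - 1 / 2) * ln n%:R| <= C.
Proof.
move=> al0 p00.
have hb p : p0 <= p -> p <= p1 -> [/\ `|al| <= al + p1 + 2 * k,
    `|p - k| <= al + p1 + 2 * k, `|(p - k) / 2| <= al + p1 + 2 * k,
    `|p / 2| <= al + p1 + 2 * k & 0 < p1].
  move=> pp0 pp1; rewrite !ler_norml; have k_gt0 := k0.
  by split; [apply/andP|apply/andP|apply/andP|apply/andP|]; lra.
pose v p n : R := \sum_(j < n) (ln (al + k * j%:R) - ln (p + k * (n%:R + j%:R - 1)))
      + n%:R * ln 4 - (al / k - 1 / 2) * ln n%:R.
(* Each logarithm is expanded at some 1 + c / m with |c| <= [B]. The number [d] bounds these
   arguments from below for all p >= p0, because p + k (m - 1) >= d k m. *)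
pose d := Num.min 1 (p0 / k).
have d0 : 0 < d by rewrite lt_min ltr01 divr_gt0.
have d1 : d <= 1 by rewrite ge_min lexx.
have dk : d * k <= p0 by rewrite -ler_pdivlMr// ge_min lexx orbT.
pose B := (al + p1 + k) / k + 1.
pose th (c : R) (n : nat) := ln (1 + c / n%:R) - c / n%:R.
have thB c n : (0 < n)%N -> `|c| <= B -> d <= 1 + c / n%:R ->
    `|th c n| <= B ^+ 2 / d / n%:R ^+ 2.
  move=> n0 cB dc; apply: (le_trans (ln1D_order1 d0 dc)).
  rewrite expr_div_n mulrAC ler_wpM2r ?invr_ge0 ?exprn_ge0//.
  rewrite ler_wpM2r ?invr_ge0 ?(ltW d0)// -(real_normK (num_real c)).
  by rewrite lerXn2r// nnegrE// (le_trans _ cB).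
pose C1 := B ^+ 2 / d * (4 + `|al / k - 1 / 2|).
have C10 : 0 <= C1 by rewrite mulr_ge0 ?addr_ge0// divr_ge0 ?sqr_ge0// ltW.
exists (`|ln al| + (`|ln p0| + `|ln p1|) + ln 4 + 2 * C1) => p n /andP[pp0 pp1] n0.
have p_gt0 : 0 < p by exact: lt_le_trans pp0.
have [b1 b2 b3 b4 p10] := hb p pp0 pp1.
have b5 : `|1 : R| <= B by rewrite normr1 /B lerDr divr_ge0// ltW// !addr_gt0.
have dv m : (0 < m)%N -> `|v p m.+1 - v p m| <= C1 / m%:R ^+ 2.
  move=> m0; have M1 : 1 <= m%:R :> R by rewrite ler1n.
  have M0 : 0 < m%:R :> R by lra.
  pose f (i : nat) : R := ln (p + k * (i%:R - 1)).
  have sf i : \sum_(j < i) ln (p + k * (i%:R + j%:R - 1)) = \sum_(j < i) f (i + j)%N.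
    by apply: eq_bigr => j _; rewrite /f natrD.
  have lnD c u : 0 < u -> 0 < u + c -> ln (u + c) = ln u + ln (1 + c / u).
    move=> u0 uc; rewrite -lnM ?posrE//; last first.
      have -> : 1 + c / u = (u + c) / u by field; rewrite gt_eqF.
      by rewrite divr_gt0.
    by congr ln; field; rewrite gt_eqF.
  have km : 0 < k * m%:R by rewrite mulr_gt0.
  have km2 : 0 < 2 * (k * m%:R) by rewrite mulr_gt0.
  have kp c : 0 <= c -> 0 <= k * c by move=> c0; rewrite mulr_ge0// ltW.
  have e1 : ln (al + k * m%:R) = ln (k * m%:R) + ln (1 + al / k / m%:R).
    rewrite addrC lnD//; last by rewrite addr_gt0.
    by congr (_ + ln (1 + _)); field; apply/andP; split; rewrite gt_eqF.
  have e2 : f m = ln (k * m%:R) + ln (1 + (p - k) / k / m%:R).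
    rewrite /f (_ : p + _ = k * m%:R + (p - k)); last by ring.
    rewrite lnD//; last by have := kp (m%:R - 1); lra.
    by congr (_ + ln (1 + _)); field; apply/andP; split; rewrite gt_eqF.
  have ln2m : ln (2 * (k * m%:R)) = ln 2 + ln (k * m%:R) by rewrite lnM// posrE.
  have e3 : f (m + m)%N = ln 2 + ln (k * m%:R) + ln (1 + (p - k) / (2 * k) / m%:R).
    rewrite /f natrD (_ : p + _ = 2 * (k * m%:R) + (p - k)); last by ring.
    rewrite lnD ?ln2m//; last by have := kp (m%:R - 1); lra.
    by congr (_ + ln (1 + _)); field; apply/andP; split; rewrite gt_eqF.
  have e4 : f (m.+1 + m)%N = ln 2 + ln (k * m%:R) + ln (1 + p / (2 * k) / m%:R).
    rewrite /f natrD -natr1 (_ : p + _ = 2 * (k * m%:R) + p); last by ring.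
    rewrite lnD ?ln2m//; last lra.
    by congr (_ + ln (1 + _)); field; apply/andP; split; rewrite gt_eqF.
  have e5 : ln m.+1%:R = ln m%:R + ln (1 + 1 / m%:R) :> R.
    by rewrite -natr1 lnD//; lra.
  have e6 : ln 4 = ln 2 + ln 2 :> R by rewrite -lnM ?posrE//; congr ln; ring.
  rewrite [X in `|X|](_ : _ = th (al / k) m + th ((p - k) / k) m
      - th ((p - k) / (2 * k)) m - th (p / (2 * k)) m - (al / k - 1 / 2) * th 1 m); last first.
    rewrite /v !sumrB !sf big_ord_recr/= sum_shift e1 e2 e3 e4 e5 -natr1 e6 /th.
    move: (ln _) (ln (1 + al / k / _)) (ln (1 + (p - k) / k / _)) => q1 q2 q3.
    move: (ln (1 + (p - k) / (2 * k) / _)) (ln (1 + p / (2 * k) / _)) (ln (1 + 1 / _)) => q4 q5 q6.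
    by field; apply/andP; split; rewrite gt_eqF.
  set Q := B ^+ 2 / d / m%:R ^+ 2.
  have BE : B = (al + p1 + 2 * k) / k by rewrite /B; field; rewrite gt_eqF.
  have hB x : `|x| <= al + p1 + 2 * k -> `|x / k| <= B.
    by move=> xB; rewrite normrM normfV (gtr0_norm k0) BE ler_pM2r ?invr_gt0.
  have h2 x : x / (2 * k) = (x / 2) / k by field; rewrite gt_eqF.
  have hd c : 0 <= c -> d <= 1 + c / m%:R.
    by move=> c0; rewrite (le_trans d1)// lerDl divr_ge0// ltW.
  have dm : d * k * m%:R <= p + k * (m%:R - 1).
    rewrite (_ : d * k * m%:R = d * k + d * k * (m%:R - 1)); last by ring.
    rewrite lerD//; first exact: le_trans pp0.
    by rewrite ler_wpM2r ?subr_ge0// ler_piMl// ltW.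
  have t1 : `|th (al / k) m| <= Q.
    by apply: thB => //; [exact: hB|apply: hd; rewrite divr_ge0// ltW].
  have t2 : `|th ((p - k) / k) m| <= Q.
    apply: thB => //; first exact: hB.
    rewrite (_ : 1 + _ = (p + k * (m%:R - 1)) / (k * m%:R)); last first.
      by field; apply/andP; split; rewrite gt_eqF.
    by rewrite ler_pdivlMr// mulrA.
  have t3 : `|th ((p - k) / (2 * k)) m| <= Q.
    apply: thB => //; first by rewrite h2; exact: hB.
    rewrite (_ : 1 + _ = (p + k * (m%:R - 1) + k * m%:R) / (2 * (k * m%:R))); last first.
      by field; apply/andP; split; rewrite gt_eqF.
    rewrite ler_pdivlMr// (_ : d * (2 * _) = d * k * m%:R + d * (k * m%:R)); last by ring.
    by rewrite lerD// ler_piMl// ltW.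
  have t4 : `|th (p / (2 * k)) m| <= Q.
    apply: thB => //; first by rewrite h2; exact: hB.
    by apply: hd; rewrite divr_ge0// ltW// mulr_gt0.
  have t5 : `|th 1 m| <= Q.
    by apply: thB => //; exact: hd.
  rewrite (_ : C1 / _ = Q + Q + Q + Q + `|al / k - 1 / 2| * Q); last first.
    by rewrite /C1 /Q; ring.
  rewrite (le_trans (ler_normD _ _))// lerD//; last by rewrite normrN normrM ler_wpM2l.
  do 2 (rewrite (le_trans (ler_normD _ _))// lerD ?normrN//).
  by rewrite (le_trans (ler_normD _ _))// lerD.
rewrite -/(v p n); apply: (le_trans (bounded_increments C10 dv n0)).
have -> : v p 1 = ln al - ln p + ln 4.
  rewrite /v big_ord1 ln1 /= mulr0n mulr0 addr0 (_ : p + k * _ = p); last by ring.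
  by ring.
rewrite lerD2r.
have lnp : `|ln p| <= `|ln p0| + `|ln p1|.
  have l0 : ln p0 <= ln p by rewrite ler_ln ?posrE.
  have l1 : ln p <= ln p1 by rewrite ler_ln ?posrE//; exact: lt_le_trans pp1.
  have [lp|lp] := leP 0 (ln p).
    by rewrite ger0_norm// (le_trans l1)// (le_trans (ler_norm _))// lerDr.
  rewrite ltr0_norm// (@le_trans _ _ `|ln p0|)//; last by rewrite lerDl.
  by rewrite (le_trans (_ : _ <= - ln p0)) ?lerN2// -normrN ler_norm.
rewrite (le_trans (ler_normD _ _))// lerD//; last first.
  by rewrite ger0_norm// ln_ge0// ler1n.
by rewrite (le_trans (ler_normB _ _))// lerD.
Qed.

End log_estimates.

(** * From unit steps to fractional shifts *)

Section gamma_increment.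
Context {R : realType}.
Implicit Types (s x y a b k : R).

(* Approximates ln Gamma(x + s) - ln Gamma(x) (Stirling). *)
Definition lgam_incr s x : R := s * ln x + (s ^+ 2 - s) / 2 * x^-1.

(** The true increment of ln Gamma has unit step exactly ln (x + s) - ln x; its approximation has it
    up to O(|s| x^-3). The error is written as a telescoping difference, to be summed along x, x +
    1, and so on. The constant 10 is twice 1 + 2 + 2, from the three error terms and x^-3 <= 2 (x^-2
    - (x + 1)^-2) for x >= 1. *)
Lemma lgam_incr_step s x : `|s| <= 4^-1 -> 1 <= x ->
  `|lgam_incr s (x + 1) - lgam_incr s x - (ln (x + s) - ln x)| <=
  10 * `|s| * (x ^- 2 - (x + 1) ^- 2).
Proof.
move=> s4 x1; have x0 : 0 < x by lra.
have xi0 : 0 < x^-1 by rewrite invr_gt0.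
have xi1 : x^-1 <= 1 by rewrite invf_le1.
have [s1 s2] : -4^-1 <= s /\ s <= 4^-1 by move: s4; rewrite ler_norml => /andP.
have sx : `|s * x^-1| <= `|s| by rewrite normrM (gtr0_norm xi0) ler_piMr.
have h1 := @ln1D_order2 R x^-1 _.
have h2 := @ln1D_order2 R (s * x^-1) _.
have l1 : ln (x + 1) - ln x = ln (1 + x^-1).
  rewrite -ln_div ?posrE//; last lra.
  by congr ln; field; rewrite gt_eqF.
have l2 : ln (x + s) - ln x = ln (1 + s * x^-1).
  rewrite -ln_div ?posrE//; last lra.
  by congr ln; field; rewrite gt_eqF.
have {}h1 := h1 _; have {}h2 := h2 _.
set e1 := ln (1 + x^-1) - x^-1 + x^-1 ^+ 2 / 2 in h1.
set e2 := ln (1 + s * x^-1) - s * x^-1 + (s * x^-1) ^+ 2 / 2 in h2.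
(* The orders 1/x and 1/x^2 cancel; the coefficient (s^2 - s) / 2 in [lgam_incr] is the one that
   achieves this. *)
rewrite (_ : _ - _ = (s ^+ 2 - s) / 2 * (x ^- 2 * (x + 1)^-1) + s * e1 - e2); last first.
  rewrite /lgam_incr l2 (_ : ln (x + 1) = ln x + ln (1 + x^-1)); last by rewrite -l1; ring.
  rewrite /e1 /e2; move: (ln _) (ln (1 + x^-1)) (ln (1 + _)) => q1 q2 q3.
  by field; apply/andP; split; rewrite gt_eqF//; lra.
have x3 : x ^- 2 * (x + 1)^-1 <= x^-1 ^+ 3.
  rewrite -exprVn [leRHS]exprSr ler_wpM2l ?exprn_ge0 ?(ltW xi0)// lef_pV2 ?posrE//; lra.
have a0 : 0 <= x ^- 2 * (x + 1)^-1 by rewrite mulr_ge0 ?invr_ge0 ?exprn_ge0//; lra.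
have t1 : `|(s ^+ 2 - s) / 2 * (x ^- 2 * (x + 1)^-1)| <= `|s| * x^-1 ^+ 3.
  rewrite normrM (ger0_norm a0) ler_pM//.
  rewrite (_ : (_ - _) / 2 = s * ((s - 1) / 2)); last by ring.
  by rewrite normrM ler_piMr// ler_norml; apply/andP; lra.
have x30 : 0 <= x^-1 ^+ 3 by rewrite exprn_ge0// ltW.
have t2 : `|s * e1| <= 2 * `|s| * x^-1 ^+ 3.
  rewrite normrM (_ : 2 * _ * _ = `|s| * (2 * x^-1 ^+ 3)); last by ring.
  rewrite ler_wpM2l//.
  have : - 2^-1 <= x^-1 by lra.
  by move=> /h1; rewrite (gtr0_norm xi0).
have t3 : `|e2| <= 2 * `|s| * x^-1 ^+ 3.
  have : - 2^-1 <= s * x^-1.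
    by move: sx; rewrite ler_norml => /andP[+ _]; lra.
  move=> /h2 h; apply: (le_trans h); rewrite normrM (gtr0_norm xi0) exprMn mulrA.
  rewrite ler_wpM2r// ler_wpM2l// exprS ler_piMr// exprn_ile1//; lra.
rewrite (le_trans (ler_normB _ _))//.
apply: (@le_trans _ _ (5 * `|s| * x^-1 ^+ 3)).
  rewrite (_ : 5 * _ * _ = `|s| * x^-1 ^+ 3 + 2 * `|s| * x^-1 ^+ 3 + 2 * `|s| * x^-1 ^+ 3); last by ring.
  by rewrite lerD// (le_trans (ler_normD _ _))// lerD.
rewrite (_ : 10 * _ * _ = 5 * `|s| * (2 * (x ^- 2 - (x + 1) ^- 2))); last by ring.
rewrite ler_wpM2l ?mulr_ge0//.
rewrite -subr_ge0 (_ : _ - _ = (3 * x ^+ 2 - 1) / (x ^+ 3 * (x + 1) ^+ 2)); last first.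
  by field; apply/andP; split; rewrite gt_eqF//; lra.
have x2 : 1 <= x ^+ 2 by rewrite exprn_ege1.
by rewrite divr_ge0//; [lra|rewrite mulr_ge0// exprn_ge0//; lra].
Qed.

(** [G] stands for ln Z(x, b) - x n ln 4 as a function of x, or for the same with the two parameters
    exchanged. Monotonicity and the exact unit step determine its fractional increments. *)
Variables (k b : R) (n : nat) (G : R -> R).
Hypotheses (k_gt0 : 0 < k) (b_gtN1 : -1 < b) (n_gt0 : (0 < n)%N).
Hypothesis G_noninc : forall x y, -1 < x -> x <= y -> G y <= G x.
Hypothesis G_step : forall x, -1 < x -> G (x + 1) - G x =
  \sum_(j < n) (ln (x + 1 + k * j%:R) - ln (x + b + 2 + k * (n%:R + j%:R - 1))).

Let X a (j : nat) : R := a + 1 + k * j%:R.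
Let Y a (j : nat) : R := a + b + 2 + k * (n%:R + j%:R - 1).

Definition lgam_sum s a : R := \sum_(j < n)
  (lgam_incr s (a + 1 + k * j%:R) - lgam_incr s (a + b + 2 + k * (n%:R + j%:R - 1))).

Let XY_ge a j : 0 <= a -> [/\ a + 1 <= X a j, 1 <= X a j & X a j <= Y a j].
Proof.
move=> a0; have n1 : 1 <= n%:R :> R by rewrite ler1n.
have j0 : 0 <= k * j%:R by rewrite mulr_ge0// ltW.
have k1 : 0 <= k * (n%:R - 1) by rewrite mulr_ge0 ?subr_ge0// ltW.
have b1 := b_gtN1.
rewrite /X /Y; split; [lra|lra|].
rewrite (_ : k * (n%:R + _ - _) = k * j%:R + k * (n%:R - 1)); [lra|ring].
Qed.

Let W s a : R := \sum_(j < n) (10 * `|s| * (X a j ^- 2 + Y a j ^- 2)).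

Let XS a j : X (a + 1) j = X a j + 1. Proof. by rewrite /X; ring. Qed.
Let YS a j : Y (a + 1) j = Y a j + 1. Proof. by rewrite /Y; ring. Qed.

(** The error of the approximation. Its unit steps are controlled by the telescoping quantity [W]
    and it vanishes at infinity, hence it is at most [W]. *)
Let Phi s a := G (a + s) - G a - lgam_sum s a.

Let Phi_step s a : `|s| <= 4^-1 -> 0 <= a ->
  `|Phi s (a + 1) - Phi s a| <= W s a - W s (a + 1).
Proof.
move=> s4 a0.
have [s1 s2] : -4^-1 <= s /\ s <= 4^-1 by move: s4; rewrite ler_norml => /andP.
pose Dl x := lgam_incr s (x + 1) - lgam_incr s x - (ln (x + s) - ln x).
have -> : Phi s (a + 1) - Phi s a = \sum_(j < n) (Dl (Y a j) - Dl (X a j)).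
  rewrite (_ : Phi s (a + 1) - Phi s a = (G (a + s + 1) - G (a + s)) - (G (a + 1) - G a)
      - (lgam_sum s (a + 1) - lgam_sum s a)); last first.
    by rewrite /Phi (_ : a + 1 + s = a + s + 1); ring.
  rewrite !G_step; [|lra|lra].
  rewrite /lgam_sum -!sumrB; apply: eq_bigr => j _; rewrite -!/(X _ _) -!/(Y _ _) XS YS.
  rewrite (_ : X (a + s) j = X a j + s); last by rewrite /X; ring.
  rewrite (_ : Y (a + s) j = Y a j + s); last by rewrite /Y; ring.
  by rewrite /Dl; ring.
rewrite /W -sumrB (le_trans (ler_norm_sum _ _ _))//; apply: ler_sum => j _.
have [_ x1 xy] := XY_ge j a0; have y1 : 1 <= Y a j by exact: le_trans xy.
rewrite XS YS (le_trans (ler_normB _ _))//.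
rewrite (_ : _ - _ = 10 * `|s| * (Y a j ^- 2 - (Y a j + 1) ^- 2)
   + 10 * `|s| * (X a j ^- 2 - (X a j + 1) ^- 2)); last by ring.
by apply: lerD; exact: lgam_incr_step.
Qed.

Let Phi_le s a m : `|s| <= 4^-1 -> 0 <= a ->
  `|Phi s a| <= `|Phi s (a + m%:R)| + W s a.
Proof.
move=> s4 a0; suff : `|Phi s a| <= `|Phi s (a + m%:R)| + (W s a - W s (a + m%:R)).
  move=> h; rewrite (le_trans h)// lerD2l gerBl; apply: sumr_ge0 => j _.
  by rewrite !mulr_ge0// addr_ge0// invr_ge0 sqr_ge0.
elim: m => [|m IH]; first by rewrite addr0 subrr addr0.
rewrite (le_trans IH)// (_ : a + m.+1%:R = a + m%:R + 1); last by rewrite -natr1; ring.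
have am : 0 <= a + m%:R by rewrite addr_ge0.
have := Phi_step s4 am; move: (Phi s (a + m%:R + 1)) (Phi s (a + m%:R)) => p q h.
have : `|q| <= `|p| + `|p - q| by have := ler_normB p (p - q); rewrite subKr.
by lra.
Qed.

(** Since |s| < 1, monotonicity traps G (a + m + s) between G (a + m - 1) and G (a + m + 1), and
    these unit steps are O(1 / m). The constant may depend on n because m tends to infinity for
    fixed n. *)
Let Phi_decay s a : `|s| <= 4^-1 -> 0 <= a ->
  exists A : R, forall m, (0 < m)%N -> `|Phi s (a + m%:R)| <= A / m%:R.
Proof.
move=> s4 a0.
have [s1 s2] : -4^-1 <= s /\ s <= 4^-1 by move: s4; rewrite ler_norml => /andP.
pose c : R := b + 1 + k * (n%:R - 1).
have n1 : 1 <= n%:R :> R by rewrite ler1n.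
have c0 : 0 <= c.
  have b1 := b_gtN1; have : 0 <= k * (n%:R - 1) by rewrite mulr_ge0 ?subr_ge0// ltW.
  by rewrite /c; lra.
exists (c *+ n + c *+ n + (`|s| * c + 2) *+ n) => m m0.
have M0 : 0 < m%:R :> R by rewrite ltr0n.
have M1 : 1 <= m%:R :> R by rewrite ler1n.
have lnXY x : m%:R <= x -> `|ln x - ln (x + c)| <= c / m%:R.
  move=> mx; have x0 : 0 < x by lra.
  rewrite distrC ger0_norm; last by rewrite subr_ge0 ler_ln ?posrE; lra.
  rewrite -ln_div ?posrE//; last lra.
  rewrite (_ : (x + c) / x = 1 + c / x); last by field; rewrite gt_eqF.
  have cx : 0 <= c / x by rewrite divr_ge0// ltW.
  rewrite (le_trans (le_ln1Dx _))//; first by lra.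
  by rewrite ler_wpM2l// lef_pV2 ?posrE.
have sumE z : z *+ n / m%:R = \sum_(j < n) (z / m%:R) :> R.
  by rewrite sumr_const card_ord mulrnAl.
have YX z j : Y z j = X z j + c by rewrite /X /Y /c; ring.
have Xm z j : m%:R <= z + 1 -> m%:R <= X z j.
  move=> mz; have : 0 <= k * j%:R by rewrite mulr_ge0// ltW.
  by rewrite /X; lra.
have GL z : -1 < z -> m%:R <= z + 1 -> `|G (z + 1) - G z| <= c *+ n / m%:R.
  move=> z1 mz; rewrite G_step// (le_trans (ler_norm_sum _ _ _))//.
  rewrite sumE; apply: ler_sum => j _.
  by rewrite -/(X _ _) -/(Y _ _) YX lnXY// Xm.
have GD : `|G (a + m%:R + s) - G (a + m%:R)| <= c *+ n / m%:R + c *+ n / m%:R.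
  have g1 := GL (a + m%:R) ltac:(lra) ltac:(lra).
  have := GL (a + m%:R - 1) ltac:(lra) ltac:(lra); rewrite subrK => g2.
  have h1 : G (a + m%:R + 1) <= G (a + m%:R + s) by apply: G_noninc; lra.
  have h2 : G (a + m%:R + s) <= G (a + m%:R - 1) by apply: G_noninc; lra.
  move: g1 g2; rewrite !ler_norml => /andP[? ?] /andP[? ?]; apply/andP; split; lra.
rewrite /Phi mulrDl [X in _ <= X + _]mulrDl (le_trans (ler_normB _ _))// lerD//.
rewrite /lgam_sum (le_trans (ler_norm_sum _ _ _))//.
rewrite sumE; apply: ler_sum => j _.
rewrite -/(X _ _) -/(Y _ _) YX; have xm := Xm (a + m%:R) j ltac:(lra).
rewrite /lgam_incr; set x := X _ _ in xm *.
have x0 : 0 < x by lra.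
rewrite (_ : _ - _ = s * (ln x - ln (x + c)) + (s ^+ 2 - s) / 2 * (x^-1 - (x + c)^-1)); last by ring.
rewrite [leRHS]mulrDl (le_trans (ler_normD _ _))// lerD//.
  by rewrite normrM -mulrA ler_wpM2l// lnXY.
rewrite normrM ler_pM//.
  rewrite (_ : (_ - _) / 2 = s * ((s - 1) / 2)); last by ring.
  have : `|(s - 1) / 2| <= 1 by rewrite ler_norml; apply/andP; lra.
  by move=> h; rewrite normrM (le_trans (ler_pM _ _ s4 h))//; lra.
have i1 : 0 < (x + c)^-1 by rewrite invr_gt0; lra.
have i2 : x^-1 <= m%:R^-1 by rewrite lef_pV2 ?posrE.
have i3 : (x + c)^-1 <= x^-1 by rewrite lef_pV2 ?posrE//; lra.
by rewrite ger0_norm; lra.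
Qed.

(** Letting m tend to infinity leaves [W]. All its bases are at least 1 + k j, so it is at most 20
    |s| times the sum of (1 + k j)^-2, which converges: the bound is uniform in n. *)
Lemma lgam_sum_error s a : `|s| <= 4^-1 -> 0 <= a ->
  `|G (a + s) - G a - lgam_sum s a| <= 20 * `|s| * (1 + 2 / k ^+ 2).
Proof.
move=> s4 a0; rewrite -/(Phi s a).
have PW : `|Phi s a| <= W s a.
  have [A HA] := Phi_decay s4 a0.
  apply/ler_addgt0Pr => e e0.
  have [m Hm] : exists m, (0 < m)%N /\ A / m%:R <= e.
    exists (Num.truncn (`|A| / e)).+1; split => //.
    rewrite ler_pdivrMr// (le_trans (ler_norm _))// -ler_pdivrMl// mulrC ltW//.
    exact: truncnS_gt.
  case: Hm => m0 Ae; rewrite (le_trans (Phi_le m s4 a0))// addrC lerD2l.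
  exact: le_trans (HA m m0) Ae.
rewrite (le_trans PW)//.
pose v (m : nat) : R := \sum_(j < m) (1 + k * j%:R) ^- 2.
have v2 : `|v n| <= 1 + 2 * k ^- 2.
  have k2 : 0 <= k ^- 2 by rewrite invr_ge0 exprn_ge0// ltW.
  have dv m : (0 < m)%N -> `|v m.+1 - v m| <= k ^- 2 / m%:R ^+ 2.
    move=> m0; have M0 : 0 < m%:R :> R by rewrite ltr0n.
    have km : 0 < k * m%:R by rewrite mulr_gt0.
    rewrite /v big_ord_recr/= addrAC subrr add0r.
    rewrite ger0_norm ?invr_ge0 ?sqr_ge0// -invfM -exprMn lef_pV2 ?posrE ?exprn_gt0//; last lra.
    by rewrite lerXn2r// ?nnegrE//; lra.
  have := bounded_increments k2 dv n_gt0.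
  by rewrite {2}/v big_ord1 mulr0 addr0 expr1n invr1 normr1.
apply: (@le_trans _ _ (20 * `|s| * v n)); last first.
  by rewrite ler_wpM2l ?mulr_ge0// (le_trans (ler_norm _))// (le_trans v2).
rewrite /W /v mulr_sumr; apply: ler_sum => j _.
have [_ x1 xy] := XY_ge j a0.
have z1 : 1 <= 1 + k * j%:R by rewrite lerDl mulr_ge0// ltW.
have zx : 1 + k * j%:R <= X a j by rewrite /X; lra.
have inv2 z : 1 + k * j%:R <= z -> z ^- 2 <= (1 + k * j%:R) ^- 2.
  by move=> h; rewrite lef_pV2 ?posrE ?exprn_gt0//; [rewrite lerXn2r ?nnegrE//|..]; lra.
rewrite (_ : 20 * _ * _ = 10 * `|s| * ((1 + k * j%:R) ^- 2 + (1 + k * j%:R) ^- 2)); last by ring.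
by rewrite ler_wpM2l ?mulr_ge0// lerD// inv2//; exact: le_trans xy.
Qed.

End gamma_increment.

(** * Expansion of a one-parameter increment *)

Section increment_asymptotics.
Context {R : realType}.

(** In [lgam_sum] the logarithms contribute s ((a + 1)/k - 1/2) ln n and the inverses (s^2 - s)/(2k)
    ln n. The range of [b] reaches below 0 and [C] is uniform over it, because the other parameter
    may already have been shifted. *)
Lemma increment_asymptotics (k a b1 : R) : 0 < k -> 0 <= a ->
  exists C : R, forall (n : nat) (b s : R) (G : R -> R),
    (0 < n)%N -> - 2^-1 <= b <= b1 -> `|s| <= 4^-1 ->
    (forall x y, -1 < x -> x <= y -> G y <= G x) ->
    (forall x, -1 < x -> G (x + 1) - G x = \sum_(j < n)
      (ln (x + 1 + k * j%:R) - ln (x + b + 2 + k * (n%:R + j%:R - 1)))) ->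
    `|G (a + s) - G a + s * (n%:R * ln 4)
      - s * ((a + 1) / k - 1 / 2 - 1 / (2 * k)) * ln n%:R
      - s ^+ 2 / (2 * k) * ln n%:R| <= C * `|s|.
Proof.
move=> k0 a0; have al0 : 0 < a + 1 by lra.
have p00 : 0 < a + 3 / 2 by lra.
have [C1 H1] := asymptotic_sum_ln k0 (a + b1 + 2) al0 p00.
have [C2 H2] := asymptotic_sum_inv k0 al0 p00.
exists (20 * (1 + 2 / k ^+ 2) + C1 + C2) => n b s G n0 /andP[b0 bb1] s4 Gd Gs.
have b0' : -1 < b by lra.
have E := lgam_sum_error k0 b0' n0 Gd Gs s4 a0.
have p2 : a + 3 / 2 <= a + b + 2 <= a + b1 + 2 by apply/andP; lra.
have {}H1 := H1 (a + b + 2) n p2 n0.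
have {}H2 := H2 (a + b + 2) n (andP p2).1 n0.
move: H1 H2; set S1 := \sum_(j < n) _; set S2 := \sum_(j < n) _ => H1 H2.
have SE : lgam_sum k b n s a = s * S1 + (s ^+ 2 - s) / 2 * S2.
  rewrite /lgam_sum /S1 /S2 !mulr_sumr -big_split/=; apply: eq_bigr => j _.
  by rewrite /lgam_incr; move: (ln _) (ln _) (_^-1) (_^-1) => *; ring.
rewrite (_ : _ - _ = (G (a + s) - G a - lgam_sum k b n s a)
  + s * (S1 + n%:R * ln 4 - ((a + 1) / k - 1 / 2) * ln n%:R)
  + (s ^+ 2 - s) / 2 * (S2 - ln n%:R / k)); last first.
  rewrite SE; move: (G _) (G a) (ln 4) (ln n%:R) => *; field; by rewrite gt_eqF.
have [s1 s2] : -4^-1 <= s /\ s <= 4^-1 by move: s4; rewrite ler_norml => /andP.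
rewrite [leRHS](_ : _ = 20 * `|s| * (1 + 2 / k ^+ 2) + C1 * `|s| + C2 * `|s|); last by ring.
rewrite (le_trans (ler_normD _ _))// lerD//.
  rewrite (le_trans (ler_normD _ _))// lerD//.
  by rewrite normrM mulrC ler_wpM2r.
rewrite normrM mulrC ler_pM//.
rewrite (_ : (_ - _) / 2 = s * ((s - 1) / 2)); last by ring.
by rewrite normrM ler_piMr// ler_norml; apply/andP; lra.
Qed.

End increment_asymptotics.

(** * Two-parameter expansion of ln Z *)

Section log_jacobi_int.
Context {R : realType}.
Variable beta : R.
Hypothesis beta_gt0 : 0 < beta.

Lemma ln_prod I (r : seq I) (P : pred I) (f : I -> R) : (forall i, 0 < f i) ->
  ln (\prod_(i <- r | P i) f i) = \sum_(i <- r | P i) ln (f i).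
Proof.
move=> f0; elim: r => [|i r IH]; first by rewrite !big_nil ln1.
rewrite !big_cons; case: (P i) => //.
by rewrite lnM ?posrE ?prodr_gt0// IH.
Qed.

Lemma ln_selberg_ratio (n : nat) (a b : R) : (0 < n)%N -> -1 < a -> -1 < b ->
  0 < @selberg_ratio R n beta a b /\
  ln (4 ^+ n * @selberg_ratio R n beta a b) = n%:R * ln 4 + \sum_(j < n)
    (ln (a + 1 + beta / 2 * j%:R) - ln (a + b + 2 + beta / 2 * (n%:R + j%:R - 1))).
Proof.
move=> n0 a1 b1; have k0 : 0 < beta / 2 by rewrite divr_gt0.
have n1 : 1 <= n%:R :> R by rewrite ler1n.
have p0 (j : nat) : 0 < a + 1 + beta / 2 * j%:R.
  by have : 0 <= beta / 2 * j%:R; [rewrite mulr_ge0// ltW|lra].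
have q0 (j : nat) : 0 < a + b + 2 + beta / 2 * (n%:R + j%:R - 1).
  have j0 : 0 <= j%:R :> R by [].
  by have : 0 <= beta / 2 * (n%:R + j%:R - 1); [rewrite mulr_ge0 ?(ltW k0)//; lra|lra].
have r0 (j : 'I_n) : 0 < (a + 1 + beta / 2 * j%:R) /
    (a + b + 2 + beta / 2 * (n%:R + j%:R - 1)) by rewrite divr_gt0.
split; first by rewrite prodr_gt0.
rewrite lnM ?posrE ?exprn_gt0 ?prodr_gt0// lnXn// mulr_natl; congr (_ + _).
rewrite ln_prod//; apply: eq_bigr => j _.
by rewrite ln_div ?posrE.
Qed.

(** One parameter is shifted at a time, first a at fixed b, then b at a + s, with k = beta / 2; as
    |s| <= 1/4, the value a + s stays in the range [-1/2, a + 1] of the second application. No term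
    in s r ln n arises, and this is what makes the limits independent. *)
Lemma jacobi_int_asymptotics (a b : R) : 0 <= a -> 0 <= b ->
  exists C : R, forall (n : nat) (s r : R), (0 < n)%N ->
    `|s| <= 4^-1 -> `|r| <= 4^-1 -> 0 < @jacobi_int R n beta a b ->
    `|ln (@jacobi_int R n beta (a + s) (b + r)) - ln (@jacobi_int R n beta a b)
      - (s * ((2 * a + 1) / beta - 1 / 2) + r * ((2 * b + 1) / beta - 1 / 2)
         + (s ^+ 2 + r ^+ 2) / beta) * ln n%:R| <= C * (`|s| + `|r|).
Proof.
move=> a0 b0; have k0 : 0 < beta / 2 by rewrite divr_gt0.
have bn0 : beta != 0 by rewrite gt_eqF.
have [C1 H1] := @increment_asymptotics R (beta / 2) a b k0 a0.
have [C2 H2] := @increment_asymptotics R (beta / 2) b (a + 1) k0 b0.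
exists (`|C1| + `|C2|) => n s r n0 s4 r4 Z0.
have [s1 s2] : -4^-1 <= s /\ s <= 4^-1 by move: s4; rewrite ler_norml => /andP.
have Zp x y : -1 < x -> -1 < y -> 0 < @jacobi_int R n beta x y.
  move=> x1 y1; have a1 : -1 < a by lra.
  have b1 : -1 < b by lra.
  exact: (jacobi_int_gt0 beta_gt0 a1 b1 x1 y1 Z0).
have l4 x : ln ((4 `^ x) ^+ n) = x * (n%:R * ln 4) :> R.
  by rewrite lnXn ?powR_gt0// ln_powR -[_ *+ n]mulr_natl mulrCA.
pose G1 x := ln (@jacobi_int R n beta x b) - x * (n%:R * ln 4).
pose G2 x := ln (@jacobi_int R n beta (a + s) x) - x * (n%:R * ln 4).
have b01 : - 2^-1 <= b <= b by apply/andP; lra.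
have as1 : - 2^-1 <= a + s <= a + 1 by apply/andP; lra.
have bm : -1 < b by lra.
have am : -1 < a + s by lra.
have p4 x : 0 < (4 `^ x) ^+ n :> R by rewrite exprn_gt0// powR_gt0.
have E1 : `|G1 (a + s) - G1 a + s * (n%:R * ln 4)
      - s * ((a + 1) / (beta / 2) - 1 / 2 - 1 / (2 * (beta / 2))) * ln n%:R
      - s ^+ 2 / (2 * (beta / 2)) * ln n%:R| <= C1 * `|s|.
  apply: (H1 n b s G1 n0 b01 s4).
    move=> x y x1 xy; have y1 : -1 < y by lra.
    have [h _] := @le_jacobi_int R n beta beta_gt0 _ _ _ x1 xy bm.
    have : ln (@jacobi_int R n beta y b) <= ln ((4 `^ (y - x)) ^+ n * @jacobi_int R n beta x b).
      by rewrite ler_ln ?posrE ?mulr_gt0 ?Zp.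
    rewrite lnM ?posrE ?Zp// l4 /G1 lerBlDr => h1; apply: (le_trans h1).
    by rewrite le_eqVlt; apply/orP; left; apply/eqP; ring.
  move=> x x1; have [r0 lr] := ln_selberg_ratio n0 x1 bm.
  have [h _] := @jacobi_int_ratio R n beta beta_gt0 _ _ x1 bm.
  rewrite /G1 h lnM ?posrE ?Zp ?mulr_gt0 ?exprn_gt0// lr; ring.
have E2 : `|G2 (b + r) - G2 b + r * (n%:R * ln 4)
      - r * ((b + 1) / (beta / 2) - 1 / 2 - 1 / (2 * (beta / 2))) * ln n%:R
      - r ^+ 2 / (2 * (beta / 2)) * ln n%:R| <= C2 * `|r|.
  apply: (H2 n (a + s) r G2 n0 as1 r4).
    move=> x y x1 xy; have y1 : -1 < y by lra.
    have [_ h] := @le_jacobi_int R n beta beta_gt0 _ _ _ x1 xy am.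
    have : ln (@jacobi_int R n beta (a + s) y) <= ln ((4 `^ (y - x)) ^+ n * @jacobi_int R n beta (a + s) x).
      by rewrite ler_ln ?posrE ?mulr_gt0 ?Zp.
    rewrite lnM ?posrE ?Zp// l4 /G2 lerBlDr => h1; apply: (le_trans h1).
    by rewrite le_eqVlt; apply/orP; left; apply/eqP; ring.
  move=> x x1; have [r0 lr] := ln_selberg_ratio n0 x1 am.
  have [_ h] := @jacobi_int_ratio R n beta beta_gt0 _ _ x1 am.
  rewrite /G2 h lnM ?posrE ?Zp ?mulr_gt0 ?exprn_gt0// lr.
  by under eq_bigr do rewrite [x + _ + 2]addrAC; ring.
move: E1 E2; rewrite /G1 /G2.
move: (ln (@jacobi_int R n beta (a + s) (b + r))) (ln (@jacobi_int R n beta (a + s) b)) => z11 z10.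
move: (ln (@jacobi_int R n beta a b)) (n%:R * ln 4) (ln n%:R) => z00 K L.
set e1 := z10 - _ - _ + _ - _ - _; set e2 := z11 - _ - _ + _ - _ - _ => E1 E2.
rewrite (_ : z11 - z00 - _ = e1 + e2); last by rewrite /e1 /e2; field.
rewrite (le_trans (ler_normD _ _))// [leRHS](_ : _ = `|C1| * `|s| + `|C1| * `|r| + (`|C2| * `|s| + `|C2| * `|r|)); last by ring.
have c1 : C1 * `|s| <= `|C1| * `|s| by rewrite ler_wpM2r// ler_norm.
have c2 : C2 * `|r| <= `|C2| * `|r| by rewrite ler_wpM2r// ler_norm.
have c3 : 0 <= `|C1| * `|r| by rewrite mulr_ge0.
have c4 : 0 <= `|C2| * `|s| by rewrite mulr_ge0.
rewrite lerD//.
  by rewrite (le_trans E1)// (le_trans c1)// lerDl.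
by rewrite (le_trans E2)// (le_trans c2)// lerDr.
Qed.

End log_jacobi_int.

(** * From moment generating functions to convergence in law *)

Section exponential_approximation.
Context {R : realType}.
Implicit Types (f g h : R -> R) (c : R).

(** The span of the real exponentials, an algebra since exponents add. On products of two such
    functions convergence of expectations is immediate from that of the generating functions. *)
Inductive expsum : (R -> R) -> Prop :=
| expsum_exp (l : R) : expsum (fun x => expR (l * x))
| expsumZ (r : R) h : expsum h -> expsum (fun x => r * h x)
| expsumD h1 h2 : expsum h1 -> expsum h2 -> expsum (fun x => h1 x + h2 x).

Lemma expsum_bound h : expsum h ->
  exists C c : R, [/\ 0 <= C, 0 <= c & forall x, `|h x| <= C * expR (c * `|x|)].
Proof.
elim=> [l|r {}h _ [C [c [C0 c0 hC]]]|h1 h2 _ [C1 [c1 [C10 c10 hC1]]] _ [C2 [c2 [C20 c20 hC2]]]].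
- exists 1, `|l|; split => // x; rewrite mul1r ger0_norm ?expR_ge0// ler_expR.
  by rewrite -normrM ler_norm.
- exists (`|r| * C), c; split; rewrite ?mulr_ge0// => x.
  by rewrite normrM -mulrA ler_wpM2l.
- exists (C1 + C2), (c1 + c2); split; rewrite ?addr_ge0// => x.
  rewrite (le_trans (ler_normD _ _))// mulrDl lerD//.
    by rewrite (le_trans (hC1 x))// ler_wpM2l// ler_expR ler_wpM2r// lerDl.
  by rewrite (le_trans (hC2 x))// ler_wpM2l// ler_expR ler_wpM2r// lerDr.
Qed.

Lemma expsumM h1 h2 : expsum h1 -> expsum h2 -> expsum (fun x => h1 x * h2 x).
Proof.
move=> e1 e2; elim: e1 => [l|r {}h1 _ IH|h h' _ IH _ IH'].
- elim: e2 => [m|r {}h2 _ IH|h h' _ IH _ IH'].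
  + rewrite (_ : (fun x => _) = (fun x => expR ((l + m) * x))); first exact: expsum_exp.
    by apply/funext => x; rewrite mulrDl expRD.
  + rewrite (_ : (fun x => _) = (fun x => r * (expR (l * x) * h2 x))); first exact: expsumZ.
    by apply/funext => x; rewrite mulrCA.
  + under eq_fun do rewrite mulrDr; exact: expsumD.
- under eq_fun do rewrite -mulrA; exact: expsumZ.
- under eq_fun do rewrite mulrDl; exact: expsumD.
Qed.

Lemma expsum_cst (r : R) : expsum (cst r).
Proof.
rewrite (_ : cst r = fun x => r * expR (0 * x)); first exact/expsumZ/expsum_exp.
by apply/funext => x; rewrite mul0r expR0 mulr1.
Qed.

Lemma expsumX h k : expsum h -> expsum (fun x => h x ^+ k).
Proof.
move=> eh; elim: k => [|k IH].
  by under eq_fun do rewrite expr0; exact: expsum_cst.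
by under eq_fun do rewrite exprS; exact: expsumM.
Qed.

(** The rate [c] is fixed before [e]: the expectations of the weight then stay bounded, and a small
    [e] gives a small error in expectation. *)
Definition exp_approx c g := forall e : R, 0 < e ->
  exists2 h, expsum h & forall x, `|g x - h x| <= e * expR (c * `|x|).

Lemma exp_approx_expsum c h : expsum h -> exp_approx c h.
Proof.
by move=> eh e e0; exists h => // x; rewrite subrr normr0 mulr_ge0 ?expR_ge0// ltW.
Qed.

Lemma exp_approx_lim c g :
  (forall e : R, 0 < e -> exists2 h, exp_approx c h &
    forall x, `|g x - h x| <= e * expR (c * `|x|)) -> exp_approx c g.
Proof.
move=> H e e0; have e20 : 0 < e / 2 by rewrite divr_gt0.
have [h ah gh] := H _ e20; have [h' eh' hh'] := ah _ e20.
exists h' => // x; rewrite -(subrKA (h x)) (le_trans (ler_normD _ _))//.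
by rewrite [e]splitr mulrDl lerD.
Qed.

Lemma exp_approx_bound c g : 0 <= c -> exp_approx c g ->
  exists C c' : R, [/\ 0 <= C, 0 <= c' & forall x, `|g x| <= C * expR (c' * `|x|)].
Proof.
move=> c0 /(_ 1 ltr01)[h eh gh]; have [C [c' [C0 c'0 hC]]] := expsum_bound eh.
exists (1 + C), (c + c'); split; rewrite ?addr_ge0// => x.
rewrite -(subrK (h x) (g x)) (le_trans (ler_normD _ _))// mulrDl lerD//.
  by rewrite (le_trans (gh x))// ler_wpM2l// ler_expR ler_wpM2r// lerDl.
by rewrite (le_trans (hC x))// ler_wpM2l// ler_expR ler_wpM2r// lerDr.
Qed.

Lemma exp_approxD c g1 g2 : exp_approx c g1 -> exp_approx c g2 ->
  exp_approx c (fun x => g1 x + g2 x).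
Proof.
move=> a1 a2 e e0; have e20 : 0 < e / 2 by rewrite divr_gt0.
have [h1 e1 gh1] := a1 _ e20; have [h2 e2 gh2] := a2 _ e20.
exists (fun x => h1 x + h2 x); first exact: expsumD.
move=> x; rewrite opprD addrACA (le_trans (ler_normD _ _))//.
by rewrite [e]splitr mulrDl lerD.
Qed.

Lemma exp_approxZ c (r : R) g : exp_approx c g -> exp_approx c (fun x => r * g x).
Proof.
move=> ag e e0; have r0 : 0 < `|r| + 1 by rewrite ltr_wpDl.
have [h eh gh] := ag _ (divr_gt0 e0 r0).
exists (fun x => r * h x); first exact: expsumZ.
move=> x; rewrite -mulrBr normrM.
apply: (@le_trans _ _ ((`|r| + 1) * (e / (`|r| + 1) * expR (c * `|x|)))).
  by rewrite ler_pM// lerDl.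
by rewrite mulrA mulrCA divff ?gt_eqF// mulr1.
Qed.

Lemma exp_approxM c1 c2 g1 g2 : 0 <= c1 -> 0 <= c2 ->
  exp_approx c1 g1 -> exp_approx c2 g2 ->
  exists2 c, 0 <= c & exp_approx c (fun x => g1 x * g2 x).
Proof.
move=> c10 c20 a1 a2.
have [C1 [d1 [C10 d10 b1]]] := exp_approx_bound c10 a1.
have [C2 [d2 [C20 d20 b2]]] := exp_approx_bound c20 a2.
exists (c1 + c2 + d1 + d2); first by rewrite !addr_ge0.
move=> e e0; pose K := C1 + C2 + 2.
have K0 : 0 < K by rewrite /K ltr_wpDl// addr_ge0.
(* Because e' <= 1, the growth of [h2] is controlled by that of [g2] alone, so the final rate does
   not depend on [e]. *)
pose e' := Num.min 1 (e / K).
have e'0 : 0 < e' by rewrite lt_min ltr01 divr_gt0.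
have e'1 : e' <= 1 by rewrite ge_min lexx.
have e'K : K * e' <= e by rewrite mulrC -ler_pdivlMr// ge_min lexx orbT.
have [h1 eh1 gh1] := a1 _ e'0; have [h2 eh2 gh2] := a2 _ e'0.
exists (fun x => h1 x * h2 x); first exact: expsumM.
move=> x.
have mE p q : 0 <= q -> p <= q -> expR (p * `|x|) <= expR (q * `|x|) :> R.
  by move=> _ pq; rewrite ler_expR ler_wpM2r.
have B1 : `|g1 x| <= C1 * expR (d1 * `|x|) := b1 x.
have B2 : `|h2 x| <= (C2 + 1) * expR ((c2 + d2) * `|x|).
  rewrite -(subrK (g2 x) (h2 x)) addrC (le_trans (ler_normD _ _))// mulrDl lerD//.
    by rewrite (le_trans (b2 x))// ler_wpM2l// ler_expR ler_wpM2r// lerDr.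
  rewrite distrC (le_trans (gh2 x))// ler_pM ?expR_ge0 ?(ltW e'0)//.
  by rewrite ler_expR ler_wpM2r// lerDl.
rewrite (_ : _ - _ = g1 x * (g2 x - h2 x) + h2 x * (g1 x - h1 x)); last by ring.
apply: (@le_trans _ _ ((C1 * e' + (C2 + 1) * e') * expR ((c1 + c2 + d1 + d2) * `|x|))).
  rewrite (le_trans (ler_normD _ _))// mulrDl !normrM lerD//.
    apply: (@le_trans _ _ (C1 * expR (d1 * `|x|) * (e' * expR (c2 * `|x|)))).
      by rewrite ler_pM.
    rewrite mulrACA -expRD -mulrDl ler_wpM2l ?mulr_ge0 ?(ltW e'0)//.
    by rewrite ler_expR ler_wpM2r//; lra.
  apply: (@le_trans _ _ ((C2 + 1) * expR ((c2 + d2) * `|x|) * (e' * expR (c1 * `|x|)))).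
    by rewrite ler_pM.
  rewrite mulrACA -expRD -mulrDl ler_wpM2l ?mulr_ge0 ?(ltW e'0) ?addr_ge0//.
  by rewrite ler_expR ler_wpM2r//; lra.
rewrite ler_wpM2r ?expR_ge0// (le_trans _ e'K)// -mulrDl ler_wpM2r ?(ltW e'0)//.
by rewrite /K; lra.
Qed.

Lemma powX_le_expR c k : 0 < c ->
  exists2 C : R, 0 <= C & forall x, 0 <= x -> x ^+ k <= C * expR (c * x).
Proof.
move=> c0; case: k => [|k].
  exists 1 => // x x0; rewrite expr0 mul1r -[leLHS]expR0 ler_expR mulr_ge0//.
  exact: ltW.
have cK : 0 < c ^+ k.+1 by rewrite exprn_gt0.
exists (k.+1`!%:R / c ^+ k.+1); first by rewrite divr_ge0// ltW.
move=> x x0; have := @expR_ge1Dxn R (c * x) k (mulr_ge0 (ltW c0) x0).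
rewrite exprMn => h; have F0 : 0 < k.+1`!%:R :> R by rewrite ltr0n fact_gt0.
have {}h : c ^+ k.+1 * x ^+ k.+1 / k.+1`!%:R <= expR (c * x) by rewrite (le_trans _ h)// lerDr.
move: h; rewrite ler_pdivrMr// => h; rewrite mulrAC ler_pdivlMr//.
by rewrite mulrC (le_trans h)// mulrC.
Qed.

Lemma exp_approx_id_scaled (l x : R) : 0 < l ->
  `|(expR (l * x) - 1) / l - x| <= l * `|x| ^+ 2 * expR (l * `|x|) /\
  `|(expR (l * x) - 1) / l| <= `|x| * expR (l * `|x|).
Proof.
move=> l0.
have hu (z : R) : expR z - 1 <= z * expR z.
  have := expR_ge1Dx (- z); rewrite expRN => h.
  have := ler_wpM2r (expR_ge0 z) h; rewrite mulVf ?gt_eqF ?expR_gt0//.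
  by rewrite mulrDl mulNr mul1r lerBlDr; lra.
have eN (z : R) : 1 <= expR `|z| by rewrite -expR0 ler_expR.
have h (z : R) : 0 <= expR z - 1 - z <= z ^+ 2 * expR `|z|.
  have z1 := expR_ge1Dx z; have z2 := hu z.
  apply/andP; split; first lra.
  have [z0|z0] := leP 0 z.
    apply: (@le_trans _ _ (z * (expR z - 1))); first by rewrite mulrBr mulr1; lra.
    by rewrite expr2 -mulrA ler_wpM2l// ger0_norm.
  apply: (@le_trans _ _ (z * (expR z - 1))); first by rewrite mulrBr mulr1; lra.
  apply: (@le_trans _ _ (z * z)); first by rewrite ler_wnM2l ?(ltW z0)//; lra.
  by rewrite -expr2 ler_peMr// sqr_ge0.
have h' (z : R) : `|expR z - 1| <= `|z| * expR `|z|.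
  have z1 := expR_ge1Dx z; have z2 := hu z.
  have [z0|z0] := leP 0 z.
    by rewrite (ger0_norm z0) ger0_norm//; lra.
  have e1 : expR z <= 1 by rewrite expR_le1 ltW.
  apply: (@le_trans _ _ `|z|); last by rewrite ler_peMr.
  by rewrite !ler0_norm//; lra.
have lx : `|l * x| = l * `|x| by rewrite normrM gtr0_norm.
split.
  rewrite (_ : _ - x = (expR (l * x) - 1 - l * x) / l); last by field; rewrite gt_eqF.
  have /andP[z0 z1] := h (l * x).
  rewrite ger0_norm ?divr_ge0// ?(ltW l0)// ler_pdivrMr// (le_trans z1)// lx.
  rewrite -(real_normK (num_real (l * x))) lx le_eqVlt; apply/orP; left; apply/eqP.
  by ring.
rewrite normrM normfV (gtr0_norm l0) ler_pdivrMr// (le_trans (h' _))// lx.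
by rewrite le_eqVlt; apply/orP; left; apply/eqP; ring.
Qed.

(** The identity is the limit of the difference quotients (exp (l x) - 1) / l as l tends to 0, and
    their k-th powers are sums of exponentials. Half of the rate c absorbs the growth exp (k l |x|),
    the other half absorbs |x|^(k + 1). *)
Lemma exp_approxX c k : 0 < c -> exp_approx c (fun x => x ^+ k).
Proof.
move=> c0 e e0.
have c20 : 0 < c / 2 by rewrite divr_gt0.
have [C C0 hC] := powX_le_expR k.+1 c20.
pose l := Num.min (c / (2 * k.+1%:R)) (e / (k%:R * C + 1)).
have kC : 0 < k%:R * C + 1 by rewrite ltr_wpDl// mulr_ge0.
have l0 : 0 < l by rewrite lt_min !divr_gt0// mulr_gt0.
have lc : k%:R * l <= c / 2.
  have : l <= c / (2 * k.+1%:R) by rewrite ge_min lexx.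
  rewrite ler_pdivlMr ?mulr_gt0// => h; rewrite ler_pdivlMr// (le_trans _ h)//.
  rewrite mulrAC mulrC ler_wpM2l ?(ltW l0)// mulrC ler_wpM2l// ler_nat.
  exact: leqnSn.
have le : k%:R * C * l <= e.
  have : l <= e / (k%:R * C + 1) by rewrite ge_min lexx orbT.
  rewrite ler_pdivlMr// => h; rewrite (le_trans _ h)// mulrC ler_wpM2l ?(ltW l0)//.
  by rewrite lerDl.
exists (fun x => ((expR (l * x) - 1) / l) ^+ k).
  apply: expsumX.
  rewrite (_ : (fun x => _) = (fun x => l^-1 * (expR (l * x) + -1))); last first.
    by apply/funext => x; rewrite mulrC.
  by apply: expsumZ; apply: expsumD; [exact: expsum_exp|exact: expsum_cst].
move=> x; have [h1 h2] := exp_approx_id_scaled x l0.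
set u := (expR (l * x) - 1) / l in h1 h2 *.
have xe : `|x| <= `|x| * expR (l * `|x|).
  by rewrite ler_peMr// -expR0 ler_expR mulr_ge0// ltW.
have key m : `|x ^+ m - u ^+ m| <= m%:R * l * `|x| ^+ m.+1 * expR (m%:R * l * `|x|).
  elim: m => [|m IH]; first by rewrite !expr0 subrr normr0 !mul0r.
  rewrite (_ : _ - _ = x * (x ^+ m - u ^+ m) + u ^+ m * (x - u)); last by rewrite !exprS; ring.
  have Em : expR (m.+1%:R * l * `|x|) = expR (m%:R * l * `|x|) * expR (l * `|x|).
    by rewrite -expRD -mulrDl -natr1; congr expR; ring.
  have e1 : 1 <= expR (l * `|x|) by rewrite -expR0 ler_expR mulr_ge0// ltW.
  have um : `|u ^+ m| <= `|x| ^+ m * expR (m%:R * l * `|x|).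
    rewrite normrX -mulrA expRM_natl -exprMn lerXn2r// nnegrE mulr_ge0 ?expR_ge0//.
  rewrite Em; move: IH um h1 e1; set A1 := expR (m%:R * _ * _); set A2 := expR (l * _).
  move=> IH um h1 e1; have A10 : 0 <= A1 by exact: expR_ge0.
  rewrite [leRHS](_ : _ = m%:R * l * `|x| ^+ m.+2 * (A1 * A2) + l * `|x| ^+ m.+2 * (A1 * A2)); last first.
    by rewrite -[m.+1%:R]natr1; ring.
  rewrite (le_trans (ler_normD _ _))// !normrM lerD//.
    apply: (@le_trans _ _ (`|x| * (m%:R * l * `|x| ^+ m.+1 * A1))).
      by rewrite ler_wpM2l.
    rewrite (_ : `|x| * _ = m%:R * l * `|x| ^+ m.+2 * A1); last first.
      by rewrite [`|x| ^+ m.+2]exprS; ring.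
    apply: ler_wpM2l; last by rewrite ler_peMr.
    by rewrite mulr_ge0 ?exprn_ge0// mulr_ge0// ltW.
  rewrite distrC.
  apply: (@le_trans _ _ (`|x| ^+ m * A1 * (l * `|x| ^+ 2 * A2))); first by rewrite ler_pM.
  rewrite le_eqVlt; apply/orP; left; apply/eqP.
  by rewrite [`|x| ^+ m.+2]exprSr [`|x| ^+ m.+1]exprSr; ring.
rewrite (le_trans (key k))//.
apply: (@le_trans _ _ (k%:R * l * (C * expR (c / 2 * `|x|)) * expR (c / 2 * `|x|))).
  rewrite ler_pM ?expR_ge0// ?mulr_ge0 ?exprn_ge0 ?(ltW l0)//.
    by rewrite ler_wpM2l ?mulr_ge0 ?(ltW l0)// hC.
  by rewrite ler_expR ler_wpM2r.
rewrite [leLHS](_ : _ = k%:R * C * l * (expR (c / 2 * `|x|) * expR (c / 2 * `|x|))); last by ring.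
by rewrite -expRD -mulrDl -splitr ler_wpM2r// expR_ge0.
Qed.

(** Since |x|^i / i! is 2^-i times (2|x|)^i / i!, the tail from K on is at most 2^-K times the
    exponential series at 2|x|. *)
Lemma sin_taylor_bound (x : R) K :
  `|sin x - \sum_(i < K) sin_coeff x i| <= 2^-1 ^+ K * expR (2 * `|x|).
Proof.
have cE := is_cvg_series_exp_coeff (2 * `|x|).
have pE m : \sum_(i < m) exp_coeff (2 * `|x|) i <= expR (2 * `|x|).
  rewrite /expR; have := @nondecreasing_cvgn_le R (series (exp_coeff (2 * `|x|))) _ cE m.
  rewrite /series /= big_mkord; apply.
  apply: nondecreasing_series => i _ _; apply: exp_coeff_ge0; exact: mulr_ge0.
have B N : (K <= N)%N -> `|series (sin_coeff x) N - \sum_(i < K) sin_coeff x i|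
    <= 2^-1 ^+ K * expR (2 * `|x|).
  move=> KN; rewrite /series /= -(big_mkord xpredT (sin_coeff x)).
  rewrite (big_cat_nat (n := K))//= addrAC subrr add0r.
  rewrite (le_trans (ler_norm_sum _ _ _))//.
  apply: (@le_trans _ _ (2^-1 ^+ K * \sum_(K <= i < N) exp_coeff (2 * `|x|) i)).
    rewrite mulr_sumr; apply: ler_sum_nat => i /andP[Ki _].
    rewrite /sin_coeff /exp_coeff /= normrM normfV normrM normrX.
    rewrite (ger0_norm (ler0n _ i`!)) exprMn !mulrA ler_wpM2r ?invr_ge0//.
    rewrite ler_wpM2r ?exprn_ge0// [leRHS](_ : _ = 2 ^+ (i - K)); last first.
      by rewrite -{1}(subnKC Ki) exprD mulrA -exprMn mulVf// expr1n mul1r.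
    rewrite (@le_trans _ _ 1)//; last by rewrite exprn_ege1// ler1n.
    rewrite normrM normrX normrN1 expr1n mulr1; by case: odd; rewrite ?normr1 ?normr0.
  rewrite ler_wpM2l ?exprn_ge0// (le_trans _ (pE N))//.
  rewrite -(big_mkord xpredT (exp_coeff (2 * `|x|))) [leRHS](big_cat_nat (n := K))//= lerDr.
  by apply: sumr_ge0 => i _; apply: exp_coeff_ge0; exact: mulr_ge0.
have cS : `|series (sin_coeff x) N - \sum_(i < K) sin_coeff x i| @[N --> \oo] -->
    `|sin x - \sum_(i < K) sin_coeff x i|.
  apply: cvg_norm; apply: cvgB; last exact: cvg_cst.
  rewrite unlock; exact: is_cvg_series_sin_coeff.
rewrite -(cvg_lim _ cS)//; apply: limr_le; first exact: (cvgP _ cS).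
by exists K => // N; exact: B.
Qed.

Lemma exp_approx_sin (th : R) : 0 < th ->
  exp_approx (2 * th) (fun x => sin (th * x)).
Proof.
move=> th0; apply: exp_approx_lim => e e0.
have [K Ke] : exists K, 2^-1 ^+ K <= e :> R.
  have /cvgrPdist_lt/(_ _ e0)[K _ /(_ K (leqnn K))] : (2^-1 : R) ^+ n @[n --> \oo] --> 0.
    by apply: cvg_expr; rewrite ger0_norm ?invf_lt1// ltr1n.
  by rewrite sub0r normrN => h; exists K; rewrite (le_trans (ler_norm _))// ltW.
exists (fun x => \sum_(i < K) sin_coeff (th * x) i).
  elim: K {Ke} => [|K IH].
    rewrite (_ : (fun x => _) = cst 0); last by apply/funext => x; rewrite big_ord0.
    exact/exp_approx_expsum/expsum_cst.
  under eq_fun do rewrite big_ord_recr/=.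
  apply: exp_approxD => //.
  rewrite (_ : (fun x => _) = (fun x => ((odd K)%:R * (-1) ^+ K.-1./2 * th ^+ K / K`!%:R) * x ^+ K)); last first.
    by apply/funext => x; rewrite /sin_coeff /= exprMn; ring.
  by apply/exp_approxZ/exp_approxX; rewrite mulr_gt0.
move=> x; rewrite (le_trans (sin_taylor_bound _ K))//.
by rewrite normrM (gtr0_norm th0) mulrA ler_wpM2r// expR_ge0.
Qed.

End exponential_approximation.

(** * Convergence of expectations and weighted approximation *)

Section moment_convergence.
Context {R : realType} (d : nat -> measure_display)
  (T : forall n, measurableType (d n)) (P : forall n, probability (T n) R)
  (U V : forall n, T n -> R) (d' : measure_display) (O : measurableType d')
  (Q : probability O R) (X Y : O -> R).
Arguments U : clear implicits.
Arguments V : clear implicits.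
Hypotheses (mU : forall n, measurable_fun setT (U n))
  (mV : forall n, measurable_fun setT (V n))
  (mX : measurable_fun setT X) (mY : measurable_fun setT Y).

(** Integrability is part of the notion because real-valued integrals are compared linearly. For the
    [P n] it is required only eventually, which is what convergence of extended integrals to a
    finite limit provides. *)
Definition cvg_expect (g : R -> R -> R) := [/\
  measurable_fun setT (fun p : R * R => g p.1 p.2),
  Q.-integrable setT (fun w => (g (X w) (Y w))%:E),
  \forall n \near \oo, (P n).-integrable setT (fun w => (g (U n w) (V n w))%:E) &
  \int[P n]_w g (U n w) (V n w) @[n --> \oo] --> \int[Q]_w g (X w) (Y w)].

Lemma cvg_expectZ (r : R) g : cvg_expect g -> cvg_expect (fun x y => r * g x y).
Proof.
move=> [mg iQ iP cv]; split.
- exact: measurable_funM.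
- exact: (integrableZl measurableT r iQ).
- by apply: filterS iP => n iP; exact: (integrableZl measurableT r iP).
- rewrite RintegralZl//.
  apply: (@cvg_trans _ (r * \int[P n]_w g (U n w) (V n w) @[n --> \oo])); last first.
    by apply: cvgM => //; exact: cvg_cst.
  apply: near_eq_cvg; apply: filterS iP => n iP.
  by rewrite RintegralZl.
Qed.

Lemma cvg_expectD g h : cvg_expect g -> cvg_expect h ->
  cvg_expect (fun x y => g x y + h x y).
Proof.
move=> [mg iQ iP cv] [mh iQ' iP' cv']; split.
- exact: measurable_funD.
- exact: (integrableD measurableT iQ iQ').
- by apply: filterS2 iP iP' => n iP iP'; exact: (integrableD measurableT iP iP').
- rewrite RintegralD//.
  apply: (@cvg_trans _ (\int[P n]_w g (U n w) (V n w) + \int[P n]_w h (U n w) (V n w) @[n --> \oo])); last first.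
    exact: cvgD.
  apply: near_eq_cvg; apply: filterS2 iP iP' => n iP iP'.
  by rewrite RintegralD.
Qed.

(** A three-epsilon argument: the convergent expectations of the weight [W] are eventually below
    [K], so replacing [g] by [h] costs at most e / 3 on both sides. *)
Lemma cvg_expect_approx (g W : R -> R -> R) : measurable_fun setT (fun p : R * R => g p.1 p.2) ->
  cvg_expect W ->
  (forall e : R, 0 < e -> exists2 h, cvg_expect h &
    forall x y : R, `|g x y - h x y| <= e * W x y) -> cvg_expect g.
Proof.
move=> mg [mW iQW iPW cW] H.
have int d0 (T0 : measurableType d0) (p : probability T0 R) (u v : T0 -> R) (h : R -> R -> R) :
    measurable_fun setT u -> measurable_fun setT v ->
    (forall x y : R, `|g x y - h x y| <= 1 * W x y) ->
    p.-integrable setT (fun w => (h (u w) (v w))%:E) ->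
    p.-integrable setT (fun w => (W (u w) (v w))%:E) ->
    p.-integrable setT (fun w => (g (u w) (v w))%:E).
  move=> mu mv gh ih iW.
  apply: (@le_integrable _ _ _ p setT measurableT _
    (fun w => `|(h (u w) (v w))%:E| + (W (u w) (v w))%:E)%E).
  - apply/measurable_EFinP.
    exact: (measurableT_comp mg (measurable_fun_pair mu mv)).
  - move=> w _; rewrite /= lee_fin.
    rewrite -[g _ _](subrK (h (u w) (v w))) addrC (le_trans (ler_normD _ _))//.
    rewrite (le_trans _ (ler_norm _))// lerD//.
    by rewrite (le_trans (gh _ _))// mul1r.
  - by apply: integrableD => //; exact: integrable_abse.
have diff d0 (T0 : measurableType d0) (p : probability T0 R) (u v : T0 -> R) (h : R -> R -> R) (e : R) :
    (forall x y : R, `|g x y - h x y| <= e * W x y) ->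
    p.-integrable setT (fun w => (g (u w) (v w))%:E) ->
    p.-integrable setT (fun w => (h (u w) (v w))%:E) ->
    p.-integrable setT (fun w => (W (u w) (v w))%:E) ->
    `|\int[p]_w g (u w) (v w) - \int[p]_w h (u w) (v w)| <= e * \int[p]_w W (u w) (v w).
  move=> gh ig ih iW; rewrite -RintegralB//.
  have ib : p.-integrable setT (fun w => (g (u w) (v w) - h (u w) (v w))%:E).
    exact: (integrableB measurableT ig ih).
  apply: (le_trans (le_normr_Rintegral measurableT ib)).
  rewrite -RintegralZl//; apply: le_Rintegral => //.
  - exact: (integrable_norm ib).
  - exact: (integrableZl measurableT e iW).
have [h1 [_ iQh1 iPh1 _] gh1] := H 1 ltr01.
have iQ : Q.-integrable setT (fun w => (g (X w) (Y w))%:E) by exact: int iQh1 iQW.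
have iP : \forall n \near \oo, (P n).-integrable setT (fun w => (g (U n w) (V n w))%:E).
  by apply: filterS2 iPh1 iPW => n; exact: int.
split => //; apply/cvgrPdist_le => e e0.
pose K := `|\int[Q]_w W (X w) (Y w)| + 1.
have K0 : 0 < K by rewrite ltr_wpDl.
have e3 : 0 < e / (3 * K) by rewrite divr_gt0// mulr_gt0.
have e30 : 0 < e / 3 by rewrite divr_gt0.
have [h [_ iQh iPh ch] gh] := H _ e3.
move/cvgrPdist_le : ch => /(_ _ e30) ch.
move/cvgrPdist_lt : cW => /(_ _ ltr01) cW.
near=> n.
have a1 := diff _ _ Q X Y h _ gh iQ iQh iQW.
have a2 : `|\int[P n]_w g (U n w) (V n w) - \int[P n]_w h (U n w) (V n w)|
    <= e / (3 * K) * \int[P n]_w W (U n w) (V n w).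
  by apply: diff => //; near: n.
have a3 : `|\int[Q]_w h (X w) (Y w) - \int[P n]_w h (U n w) (V n w)| <= e / 3 by near: n.
have a4 : `|\int[Q]_w W (X w) (Y w) - \int[P n]_w W (U n w) (V n w)| < 1 by near: n.
have eK z : z <= K -> e / (3 * K) * z <= e / 3.
  move=> zK; rewrite invfM mulrA -mulrA ler_piMr ?divr_ge0 ?(ltW e0)//.
  by rewrite mulrC ler_pdivrMr// mul1r.
have {}a1 := le_trans a1 (eK _ (le_trans (ler_norm _) (ler_wpDr ler01 (lexx _)))).
have {}a2 : `|\int[P n]_w g (U n w) (V n w) - \int[P n]_w h (U n w) (V n w)| <= e / 3.
  apply: (le_trans a2); apply: eK; rewrite /K.
  have := ler_norm (\int[Q]_w W (X w) (Y w)).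
  by move: a4; rewrite ltr_norml => /andP[? ?]; lra.
rewrite distrC in a2.
rewrite (_ : _ - _ = (\int[Q]_w g (X w) (Y w) - \int[Q]_w h (X w) (Y w))
  + (\int[Q]_w h (X w) (Y w) - \int[P n]_w h (U n w) (V n w))
  + (\int[P n]_w h (U n w) (V n w) - \int[P n]_w g (U n w) (V n w))); last by ring.
rewrite (_ : e = e / 3 + e / 3 + e / 3); last by field.
by rewrite (le_trans (ler_normD _ _))// lerD// (le_trans (ler_normD _ _))// lerD.
Unshelve. all: by end_near. Qed.

Hypothesis mgf_fin : forall l m,
  Q.-integrable setT (fun w => (expR (l * X w + m * Y w))%:E).
Hypothesis mgf_cvg : forall l m,
  (\int[P n]_w (expR (l * U n w + m * V n w))%:E @[n --> \oo] -->
   \int[Q]_w (expR (l * X w + m * Y w))%:E)%E.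

Lemma cvg_expect_exp l m : cvg_expect (fun x y => expR (l * x + m * y)).
Proof.
have mp (l' m' : R) : measurable_fun setT (fun p : R * R => expR (l' * p.1 + m' * p.2)).
  apply: measurableT_comp => //.
  by apply: measurable_funD; apply: measurable_funM.
have fQ := integrable_fin_num measurableT (mgf_fin l m).
have := @mgf_cvg l m; rewrite -(fineK fQ) => /fine_cvgP[fP cP].
split => //.
apply: filterS fP => n fP; apply/integrableP; split.
  apply/measurable_EFinP.
  apply: measurableT_comp => //.
  by apply: measurable_funD; apply: measurable_funM.
under eq_integral do rewrite gee0_abs ?lee_fin ?expR_ge0//.
by rewrite ltey_eq fP.
Qed.

Lemma cvg_expect_expsum h1 h2 : expsum h1 -> expsum h2 ->
  cvg_expect (fun x y => h1 x * h2 y).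
Proof.
move=> e1 e2; elim: e1 => [l|r {}h1 _ IH|h h' _ IH _ IH'].
- elim: e2 => [m|r {}h2 _ IH|h h' _ IH _ IH'].
  + rewrite (_ : (fun x y => _) = (fun x y => expR (l * x + m * y))).
      exact: cvg_expect_exp.
    by apply/funext => x; apply/funext => y; rewrite expRD.
  + rewrite (_ : (fun x y => _) = (fun x y => r * (expR (l * x) * h2 y))).
      exact: cvg_expectZ.
    by apply/funext => x; apply/funext => y; rewrite mulrCA.
  + rewrite (_ : (fun x y => _) = (fun x y => expR (l * x) * h y + expR (l * x) * h' y)).
      exact: cvg_expectD.
    by apply/funext => x; apply/funext => y; rewrite mulrDr.
- rewrite (_ : (fun x y => _) = (fun x y => r * (h1 x * h2 y))); first exact: cvg_expectZ.
  by apply/funext => x; apply/funext => y; rewrite mulrA.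
- rewrite (_ : (fun x y => _) = (fun x y => h x * h2 y + h' x * h2 y)).
    exact: cvg_expectD.
  by apply/funext => x; apply/funext => y; rewrite mulrDl.
Qed.

(** This is 4 cosh (c x) cosh (c y). It dominates exp (c |x|) exp (c |y|) and, being itself made of
    exponentials, has convergent expectations. *)
Definition exp_weight c (x y : R) :=
  (expR (c * x) + expR (- c * x)) * (expR (c * y) + expR (- c * y)).

Lemma cvg_expect_weight c : cvg_expect (exp_weight c).
Proof.
by apply: (@cvg_expect_expsum (fun x => expR (c * x) + expR (- c * x))
  (fun x => expR (c * x) + expR (- c * x))); apply: expsumD; exact: expsum_exp.
Qed.

Lemma expR_norm_le c (x : R) : expR (c * `|x|) <= expR (c * x) + expR (- c * x).
Proof.
have [x0|x0] := leP 0 x.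
  by rewrite ger0_norm// lerDl expR_ge0.
by rewrite ltr0_norm// mulrN -mulNr lerDr expR_ge0.
Qed.

End moment_convergence.

(** * Bernstein averages and inversion of the sine *)

Section bernstein.
Context {R : realType}.
Implicit Types (phi psi : nat -> R) (u : R).

(* The expectation of phi at a binomial variable of parameters N and u. *)
Fixpoint bern N phi u : R :=
  if N is N'.+1 then (1 - u) * bern N' phi u + u * bern N' (fun k => phi k.+1) u
  else phi 0%N.

Lemma bern_le N phi psi u : 0 <= u <= 1 -> (forall k, phi k <= psi k) ->
  bern N phi u <= bern N psi u.
Proof.
move=> /andP[u0 u1]; elim: N phi psi => //= N IH phi psi le_phi.
by rewrite lerD// ler_wpM2l ?IH ?subr_ge0.
Qed.

Lemma bern_affine N phi (c K : R) u :
  bern N (fun k => c + K * phi k) u = c + K * bern N phi u.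
Proof. by elim: N phi => //= N IH phi; rewrite !IH; ring. Qed.

(** Variance plus squared bias of a binomial variable; [a] is general because the recursion moves it
    to a - 1. *)
Lemma bern_sqr N (a : R) u :
  bern N (fun k => (k%:R - a) ^+ 2) u = N%:R * (u * (1 - u)) + (N%:R * u - a) ^+ 2.
Proof.
elim: N a => [|N IH] a /=; first by ring.
rewrite IH (_ : (fun k => _) = (fun k => (k%:R - (a - 1)) ^+ 2)); last first.
  by apply/funext => k; rewrite -natr1; ring.
by rewrite IH -[N.+1%:R]natr1; ring.
Qed.

(** A quadratic modulus replaces the usual appeal to Chebyshev's inequality: the mean squared
    deviation is u (1 - u) / N <= 1 / (4 N). *)
Lemma bern_dist N phi (z c K u : R) : (0 < N)%N -> 0 <= u <= 1 -> 0 <= K ->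
  (forall k, `|phi k - z| <= c + K * (k%:R / N%:R - u) ^+ 2) ->
  `|bern N phi u - z| <= c + K / (4 * N%:R).
Proof.
move=> N0 u01 K0 H; have Np : 0 < N%:R :> R by rewrite ltr0n.
have [u0 u1] := andP u01.
have E : bern N (fun k => c + K * (k%:R / N%:R - u) ^+ 2) u = c + K * (u * (1 - u) / N%:R).
  rewrite bern_affine; congr (_ + _ * _).
  rewrite (_ : (fun k => _) = (fun k => 0 + N%:R ^- 2 * (k%:R - N%:R * u) ^+ 2)); last first.
    by apply/funext => k; field; rewrite gt_eqF.
  by rewrite bern_affine bern_sqr subrr; field; rewrite gt_eqF.
have E4 : c + K * (u * (1 - u) / N%:R) <= c + K / (4 * N%:R).
  rewrite lerD2l ler_wpM2l// invfM ler_wpM2r ?invr_ge0//.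
  by have := sqr_ge0 (u - 2^-1); rewrite (_ : _ ^+ 2 = 4^-1 - u * (1 - u)); [rewrite subr_ge0|field].
have zE : z = bern N (fun k => z + 0 * phi k) u by rewrite bern_affine mul0r addr0.
rewrite ler_distl; apply/andP; split.
  apply: (@le_trans _ _ (bern N (fun k => z + -1 * (c + K * (k%:R / N%:R - u) ^+ 2)) u)).
    by rewrite bern_affine E mulN1r lerD2l lerN2.
  apply: bern_le => // k; have := H k; rewrite ler_distl => /andP[+ _].
  by rewrite mulN1r.
apply: (@le_trans _ _ (bern N (fun k => z + 1 * (c + K * (k%:R / N%:R - u) ^+ 2)) u)).
  apply: bern_le => // k; have := H k; rewrite ler_distl => /andP[_].
  by rewrite mul1r.
by rewrite bern_affine E mul1r lerD2l.
Qed.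

Lemma bern_bound N phi u (M : R) : 0 <= u <= 1 -> (forall k, `|phi k| <= M) ->
  `|bern N phi u| <= M.
Proof.
move=> u01 H.
have cst (c : R) : bern N (fun k => c + 0 * 0) u = c.
  by rewrite (bern_affine N (fun=> 0)) mul0r addr0.
rewrite ler_norml; apply/andP; split.
  rewrite -[leLHS]cst; apply: bern_le => // k; rewrite mul0r addr0.
  by have := H k; rewrite ler_norml => /andP[].
rewrite -[leRHS]cst; apply: bern_le => // k; rewrite mul0r addr0.
by have := H k; rewrite ler_norml => /andP[].
Qed.

(** [xs] is a left inverse of x |-> (1 + sin (x / L)) / 2 on [-L, L], Lipschitz because the slope of
    sin on [-1, 1] is at least cos 1 > 0. Clamping to [- sin 1, sin 1] makes it total with values in
    [-L, L], since the estimates on [bern] quantify over all indices, even those beyond N. *)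
Lemma sampling (L : R) : 0 < L -> exists2 xs : R -> R, forall z, `|xs z| <= L &
  exists C : R, forall x z : R, `|x| <= L -> `|xs z - x| <= C * `|z - (1 + sin (L^-1 * x)) / 2|.
Proof.
move=> L0.
have p2 := @pihalf_ge1 R; have p3 := @pihalf_lt2 R.
have p0 : 0 < pi :> R by exact: pi_gt0.
have c1 : 0 < cos 1 :> R by exact: cos1_gt0.
pose q : R := sin 1.
have q0 : 0 < q by apply: sin_gt0_pi; rewrite ltr01/=; lra.
have q1 : q <= 1 by exact: sin_le1.
pose clamp (z : R) := Num.max (- q) (Num.min q z).
have clamp_itv z : -q <= clamp z <= q.
  by rewrite /clamp le_max lexx/= ge_max ge_min lexx/= andbT; lra.
have itv (w : R) : `|w| <= 1 -> w \in `[- (pi / 2), pi / 2].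
  by rewrite ler_norml in_itv/= => /andP[? ?]; apply/andP; split; lra.
have asin1 z : -q <= z <= q -> `|asin z| <= 1 /\ sin (asin z) = z.
  move=> /andP[z1 z2].
  have z11 : -1 <= z <= 1 by apply/andP; lra.
  have sz : sin (asin z) = z by apply: asinK; rewrite in_itv.
  have ai : asin z \in `[- (pi / 2), pi / 2].
    by rewrite in_itv/= asin_geNpi2// asin_lepi2.
  have i1 : (1 : R) \in `[- (pi / 2), pi / 2] by apply: itv; rewrite normr1.
  have i2 : (-1 : R) \in `[- (pi / 2), pi / 2] by apply: itv; rewrite normrN1.
  split => //; rewrite ler_norml; apply/andP; split; rewrite leNgt; apply/negP.
    by rewrite -(ltr_sin ai i2) sz sinN -/q; lra.
  by rewrite -(ltr_sin i1 ai) sz -/q; lra.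
have sin_lip (s t : R) : `|s| <= 1 -> `|t| <= 1 -> cos 1 * `|s - t| <= `|sin s - sin t|.
  wlog st : s t / t <= s.
    move=> H s1 t1; have [ts|/ltW ts] := leP t s; first exact: H.
    by rewrite (distrC s) (distrC (sin s)); exact: H.
  move=> s1 t1.
  have [|c] := @MVT_segment R sin cos t s st.
    by apply: continuous_subspaceT => x; exact: continuous_sin.
  rewrite in_itv/= => /andP[c0 cs] ->; rewrite normrM ler_wpM2r//.
  rewrite (le_trans _ (ler_norm _))// -(cos_norm c).
  have cn : `|c| <= 1.
    move: s1 t1; rewrite !ler_norml => /andP[? ?] /andP[? ?]; apply/andP; split; lra.
  have ci : `|c| \in `[0, pi] by rewrite in_itv/= normr_ge0/=; lra.
  have oi : (1 : R) \in `[0, pi] by rewrite in_itv/= ler01/=; lra.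
  by rewrite leNgt (ltr_cos oi ci) -leNgt.
exists (fun z => L * asin (clamp (2 * z - 1))).
  move=> z; rewrite normrM gtr0_norm// ler_piMr ?(ltW L0)//.
  exact: (asin1 _ (clamp_itv _)).1.
exists (L * (cos 1)^-1 * 2) => x z xL.
have x1 : `|L^-1 * x| <= 1 by rewrite normrM gtr0_norm ?invr_gt0// mulrC ler_pdivrMr// mul1r.
set w := clamp _; have [w1 ws] := asin1 _ (clamp_itv (2 * z - 1)).
rewrite -/w in w1 ws.
have h := sin_lip _ _ w1 x1; rewrite ws in h.
have sx : - q <= sin (L^-1 * x) <= q.
  have xi := itv _ x1; move: (x1); rewrite ler_norml => /andP[x2 x3].
  have i1 : (1 : R) \in `[- (pi / 2), pi / 2] by apply: itv; rewrite normr1.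
  have i2 : (-1 : R) \in `[- (pi / 2), pi / 2] by apply: itv; rewrite normrN1.
  apply/andP; split; rewrite leNgt; apply/negP.
    by rewrite -sinN (ltr_sin xi i2); lra.
  by rewrite (ltr_sin i1 xi); lra.
have cl : `|w - sin (L^-1 * x)| <= `|2 * z - 1 - sin (L^-1 * x)|.
  move: sx => /andP[sx1 sx2]; rewrite /w /clamp.
  move: (2 * z - 1) (sin _) sx1 sx2 => v y y1 y2.
  case: (leP q v) => h1; [case: (leP (- q) q) => h2|case: (leP (- q) v) => h2].
  - have -> : `|q - y| = q - y by apply: ger0_norm; lra.
    have -> : `|v - y| = v - y by apply: ger0_norm; lra.
    by lra.
  - by exfalso; lra.
  - by [].
  - have -> : `|- q - y| = - (- q - y) by apply: ler0_norm; lra.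
    have -> : `|v - y| = - (v - y) by apply: ler0_norm; lra.
    by lra.
have -> : L * asin w - x = L * (asin w - L^-1 * x).
  by rewrite mulrBr mulrA divff ?gt_eqF// mul1r.
rewrite normrM (gtr0_norm L0) -!mulrA ler_wpM2l ?(ltW L0)// ler_pdivlMl//.
rewrite (le_trans h)// (le_trans cl)//.
rewrite (_ : 2 * z - 1 - _ = 2 * (z - (1 + sin (L^-1 * x)) / 2)); last by field.
by rewrite normrM ger0_norm.
Qed.

End bernstein.

(** * Weighted density of tensors in the bounded continuous functions *)

Section exponential_tensors.
Context {R : realType}.

Definition exp_approximable (f : R -> R) :=
  measurable_fun setT f /\ exists2 c, 0 <= c & exp_approx c f.

Lemma exp_approximable_cst (r : R) : exp_approximable (cst r).
Proof.
by split; [exact: measurable_cst|exists 0 => //; exact/exp_approx_expsum/expsum_cst].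
Qed.

Lemma exp_approximableM f g : exp_approximable f -> exp_approximable g -> exp_approximable (fun x => f x * g x).
Proof.
move=> [mf [c c0 af]] [mg [c' c'0 ag]]; split; first exact: measurable_funM.
by have [c'' ? ?] := exp_approxM c0 c'0 af ag; exists c''.
Qed.

Lemma exp_approx_le c c' (f : R -> R) : c <= c' -> exp_approx c f -> exp_approx c' f.
Proof.
move=> cc' af e e0; have [h eh fh] := af e e0; exists h => // x.
by rewrite (le_trans (fh x))// ler_wpM2l ?(ltW e0)// ler_expR ler_wpM2r.
Qed.

Lemma exp_approximableD f g : exp_approximable f -> exp_approximable g -> exp_approximable (fun x => f x + g x).
Proof.
move=> [mf [c c0 af]] [mg [c' c'0 ag]]; split; first exact: measurable_funD.
exists (c + c'); first exact: addr_ge0.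
by apply: exp_approxD; [apply: exp_approx_le af; rewrite lerDl|apply: exp_approx_le ag; rewrite lerDr].
Qed.

Lemma exp_approximable_sin (L : R) : 0 < L -> exp_approximable (fun x => (1 + sin (L^-1 * x)) / 2).
Proof.
move=> L0; have Li : 0 < L^-1 by rewrite invr_gt0.
have gs : exp_approximable (fun x => sin (L^-1 * x)).
  split; last by exists (2 * L^-1); [rewrite mulr_ge0// ltW|exact: exp_approx_sin].
  apply: (measurableT_comp (f := @sin R)); last exact: measurable_funM.
  apply: continuous_measurable_fun; exact: continuous_sin.
have := exp_approximableM (exp_approximableD (exp_approximable_cst 1) gs) (exp_approximable_cst 2^-1).
by [].
Qed.

Inductive exp_tensor : (R -> R -> R) -> Prop :=
| exp_tensor_prod f g : exp_approximable f -> exp_approximable g -> exp_tensor (fun x y => f x * g y)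
| exp_tensorD p q : exp_tensor p -> exp_tensor q -> exp_tensor (fun x y => p x y + q x y).

Lemma exp_tensor_mull f p : exp_approximable f -> exp_tensor p ->
  exp_tensor (fun x y => f x * p x y).
Proof.
move=> gf; elim=> [f' g' gf' gg'|{}p q _ IH _ IH'].
  rewrite (_ : (fun x y => _) = (fun x y => (f x * f' x) * g' y)).
    exact: (exp_tensor_prod (exp_approximableM gf gf')).
  by apply/funext => x; apply/funext => y; rewrite mulrA.
rewrite (_ : (fun x y => _) = (fun x y => f x * p x y + f x * q x y)).
  exact: exp_tensorD.
by apply/funext => x; apply/funext => y; rewrite mulrDr.
Qed.

Lemma exp_tensor_mulr g p : exp_approximable g -> exp_tensor p ->
  exp_tensor (fun x y => g y * p x y).
Proof.
move=> gg; elim=> [f' g' gf' gg'|{}p q _ IH _ IH'].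
  rewrite (_ : (fun x y => _) = (fun x y => f' x * (g y * g' y))).
    exact: (exp_tensor_prod gf' (exp_approximableM gg gg')).
  by apply/funext => x; apply/funext => y; rewrite mulrCA.
rewrite (_ : (fun x y => _) = (fun x y => g y * p x y + g y * q x y)).
  exact: exp_tensorD.
by apply/funext => x; apply/funext => y; rewrite mulrDr.
Qed.

Lemma exp_approximable_onem f : exp_approximable f -> exp_approximable (fun x => 1 - f x).
Proof.
move=> gf; have := exp_approximableD (exp_approximable_cst 1) (exp_approximableM (exp_approximable_cst (-1)) gf).
by under eq_fun do rewrite mulN1r.
Qed.

Lemma exp_tensor_bernl N (phi : nat -> R -> R -> R) f : exp_approximable f ->
  (forall k, exp_tensor (phi k)) ->
  exp_tensor (fun x y => bern N (fun k => phi k x y) (f x)).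
Proof.
move=> gf; elim: N phi => [|N IH] phi tphi /=; first exact: tphi.
apply: exp_tensorD; first exact: (exp_tensor_mull (exp_approximable_onem gf) (IH _ tphi)).
exact: (exp_tensor_mull gf (IH _ (fun k => tphi k.+1))).
Qed.

Lemma exp_tensor_bernr N (phi : nat -> R -> R -> R) g : exp_approximable g ->
  (forall k, exp_tensor (phi k)) ->
  exp_tensor (fun x y => bern N (fun k => phi k x y) (g y)).
Proof.
move=> gg; elim: N phi => [|N IH] phi tphi /=; first exact: tphi.
apply: exp_tensorD; first exact: (exp_tensor_mulr (exp_approximable_onem gg) (IH _ tphi)).
exact: (exp_tensor_mulr gg (IH _ (fun k => tphi k.+1))).
Qed.

Lemma exp_tensor_cst (r : R) : exp_tensor (fun _ _ => r).
Proof.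
have := exp_tensor_prod (exp_approximable_cst r) (exp_approximable_cst 1).
by under eq_fun do under eq_fun do rewrite /cst mulr1.
Qed.

Lemma exp_tensor_measurable p : exp_tensor p ->
  measurable_fun setT (fun z : R * R => p z.1 z.2).
Proof.
elim=> [f g [mf _] [mg _]|{}p q _ mp _ mq]; last exact: measurable_funD.
apply: measurable_funM; first exact: (measurableT_comp mf measurable_fst).
exact: (measurableT_comp mg measurable_snd).
Qed.

(** Points closer than D are handled by uniform continuity on the compact square, the others by 2M
    <= (2M / D^2) times the squared distance. The quadratic form is the one that Bernstein averages
    control. *)
Lemma continuous_square_modulus (f : R * R -> R) (L M e : R) : continuous f ->
  (forall z, `|f z| <= M) -> 0 < e ->
  exists2 K : R, 0 <= K & forall x y x' y' : R,
    `|x| <= L -> `|y| <= L -> `|x'| <= L -> `|y'| <= L ->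
    `|f (x', y') - f (x, y)| <= e + K * ((x' - x) ^+ 2 + (y' - y) ^+ 2).
Proof.
move=> cf fM e0; have M0 : 0 <= M by rewrite (le_trans _ (fM (0, 0))).
pose A := `[- L, L]%classic `*` `[- L, L]%classic : set (R * R).
have cA : compact A by apply: compact_setX; exact: segment_compact.
have [D D0 HD] : exists2 D : R, 0 < D & forall x y x' y' : R,
    A (x, y) -> `|x' - x| < D -> `|y' - y| < D -> `|f (x', y') - f (x, y)| <= e.
  have e20 : 0 < e / 2 by rewrite divr_gt0.
  have near0 : \forall D \near 0^'+, A `<=` (fun z => forall x' y' : R,
      `|x' - z.1| < D -> `|y' - z.2| < D -> `|f (x', y') - f z| <= e).
    apply: (compact_near_coveringP A).1 => // z0 _.
    have /cvgrPdist_lt/(_ _ e20)/nbhs_ballP[r /= r0 fr] := cf z0.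
    have r20 : 0 < r / 2 by rewrite divr_gt0.
    exists (ball z0 (r / 2), [set D | D < r / 2]) => /=.
      split; first exact: nbhsx_ballx.
      exact: nbhs_right_lt.
    move=> [z D] /= [[z1 z2] Dr] x' y' x'D y'D.
    move: z1 z2; rewrite -!ball_normE /= => z1 z2.
    have fz' : `|f z0 - f (x', y')| < e / 2.
      apply: fr; split; rewrite -ball_normE /=.
        rewrite -(subrKA z.1) (le_lt_trans (ler_normD _ _))// [ltRHS]splitr ltrD//.
        by rewrite distrC (lt_trans x'D).
      rewrite -(subrKA z.2) (le_lt_trans (ler_normD _ _))// [ltRHS]splitr ltrD//.
      by rewrite distrC (lt_trans y'D).
    have fz : `|f z0 - f z| < e / 2.
      apply: fr; split; rewrite -ball_normE /=.
        by rewrite (lt_le_trans z1)// ler_pdivrMr// ler_peMr ?(ltW r0)// ler1n.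
      by rewrite (lt_le_trans z2)// ler_pdivrMr// ler_peMr ?(ltW r0)// ler1n.
    rewrite -(subrKA (f z0)) (le_trans (ler_normD _ _))// [leRHS]splitr lerD ?ltW//.
    by rewrite distrC.
  have [D [D0 HD]] := filter_ex (filterI (nbhs_right_gt (0 : R)) near0).
  exists D => // x y x' y' Axy; exact: (HD (x, y)).
have K0 : 0 <= 2 * M / D ^+ 2.
  by rewrite divr_ge0 ?exprn_ge0// ?(ltW D0)// mulr_ge0.
exists (2 * M / D ^+ 2) => //.
move=> x y x' y' xL yL xL' yL'.
have Axy : A (x, y).
  by split; rewrite /= in_itv/=; rewrite -ler_norml.
have [/andP[dx dy]|] := boolP ((`|x' - x| < D) && (`|y' - y| < D)).
  by rewrite (le_trans (HD _ _ _ _ Axy dx dy))// lerDl mulr_ge0// addr_ge0// sqr_ge0.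
rewrite negb_and -!leNgt => far.
have D2 : D ^+ 2 <= (x' - x) ^+ 2 + (y' - y) ^+ 2.
  case/orP: far => far.
    rewrite (@le_trans _ _ ((x' - x) ^+ 2)) ?lerDl ?sqr_ge0//.
    by rewrite -(real_normK (num_real (x' - x))) lerXn2r// nnegrE ltW.
  rewrite (@le_trans _ _ ((y' - y) ^+ 2)) ?lerDr ?sqr_ge0//.
  by rewrite -(real_normK (num_real (y' - y))) lerXn2r// nnegrE ltW.
rewrite (le_trans (ler_normB _ _))// (@le_trans _ _ (2 * M))//.
  by rewrite (le_trans (lerD (fM _) (fM _)))// -mulr2n mulr_natl.
rewrite ler_wpDl ?(ltW e0)// mulrAC ler_pdivlMr ?exprn_gt0//.
by apply: ler_wpM2l => //; rewrite mulr_ge0.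
Qed.

Lemma exp_tensor_dense (f : R * R -> R) (M e : R) : continuous f ->
  (forall z, `|f z| <= M) -> 0 < e ->
  exists2 p, exp_tensor p & forall x y, `|f (x, y) - p x y| <= e * exp_weight 1 x y.
Proof.
move=> cf fM e0; have M0 : 0 <= M by rewrite (le_trans _ (fM (0, 0))).
(* Where |x| or |y| exceeds L, the weight is at least L and e L >= 2M, so the trivial bound
   suffices. Inside the square the sine of x / L determines x. *)
pose L := 2 * M / e + 1.
have L0 : 0 < L by rewrite ltr_wpDl// divr_ge0 ?mulr_ge0// ltW.
have [xs xsL [C HC]] := sampling L0.
have e20 : 0 < e / 2 by rewrite divr_gt0.
have [K K0 HK] := continuous_square_modulus L cf fM e20.
pose u x : R := (1 + sin (L^-1 * x)) / 2.
have u01 x : 0 <= u x <= 1.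
  have := sin_geN1 (L^-1 * x); have := sin_le1 (L^-1 * x).
  by rewrite /u => ? ?; apply/andP; split; lra.
have gu : exp_approximable u by exact: exp_approximable_sin.
pose K' := K * C ^+ 2.
have K'0 : 0 <= K' by rewrite mulr_ge0// sqr_ge0.
(* Each of the two nested averages costs K' / (4N) <= e / 4, next to the e / 2 from the modulus of
   continuity. *)
have [N N0 NK] : exists2 N : nat, (0 < N)%N & K' / N%:R <= e.
  exists (Num.truncn (K' / e)).+1 => //.
  rewrite ler_pdivrMr ?ltr0n// -ler_pdivrMl// mulrC ltW//; exact: truncnS_gt.
pose F k l : R := f (xs (k%:R / N%:R), xs (l%:R / N%:R)).
exists (fun x y => bern N (fun k => bern N (F k) (u y)) (u x)).
  apply: exp_tensor_bernl => // k; apply: (@exp_tensor_bernr N (fun l _ _ => F k l)) => // l.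
  exact: exp_tensor_cst.
have h (z : R) : 1 <= expR (1 * z) + expR (-1 * z).
  by rewrite (le_trans _ (expR_norm_le 1 z))// -expR0 ler_expR mulr_ge0.
have w1 (x y : R) : 1 <= exp_weight 1 x y.
  by rewrite -[leLHS]mulr1 /exp_weight; apply: ler_pM => //; exact: h.
have wL (x y : R) : L <= expR (1 * x) + expR (-1 * x) \/ L <= expR (1 * y) + expR (-1 * y) ->
    L <= exp_weight 1 x y.
  have hx := h x; have hy := h y; rewrite /exp_weight => -[] Lh.
    by rewrite (le_trans Lh)// ler_peMr// (le_trans ler01).
  by rewrite (le_trans Lh)// ler_peMl// (le_trans ler01).
have far (x y : R) : L <= exp_weight 1 x y ->
   `|f (x, y) - bern N (fun k => bern N (F k) (u y)) (u x)| <= e * exp_weight 1 x y.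
  move=> Lw; rewrite (le_trans (ler_normB _ _))//.
  apply: (@le_trans _ _ (2 * M)).
    rewrite [leRHS](_ : _ = M + M); last by ring.
    by rewrite lerD// bern_bound// => k; rewrite bern_bound// => l; exact: fM.
  by rewrite [leRHS]mulrC -ler_pdivrMr// (le_trans _ Lw)// /L lerDl.
move=> x y; have [xL|xL] := leP `|x| L; last first.
  apply/far/wL; left; rewrite (le_trans _ (expR_norm_le 1 x))// mul1r.
  by rewrite (le_trans (ltW xL))// (le_trans _ (expR_ge1Dx _))// lerDr.
have [yL|yL] := leP `|y| L; last first.
  apply/far/wL; right; rewrite (le_trans _ (expR_norm_le 1 y))// mul1r.
  by rewrite (le_trans (ltW yL))// (le_trans _ (expR_ge1Dx _))// lerDr.
rewrite distrC; apply: (@le_trans _ _ (e / 2 + K' / (4 * N%:R) + K' / (4 * N%:R))); last first.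
  apply: (@le_trans _ _ e); last by rewrite ler_peMr// ltW.
  have -> : K' / (4 * N%:R) = K' / N%:R / 4 by rewrite invfM mulrA mulrAC.
  by move: NK; lra.
have sq x0 z : `|x0| <= L -> (xs z - x0) ^+ 2 <= C ^+ 2 * (z - u x0) ^+ 2.
  move=> x0L; rewrite -exprMn -[leLHS]real_normK ?num_real// -[leRHS]real_normK ?num_real//.
  rewrite lerXn2r// ?nnegrE// normrM (le_trans (HC _ _ x0L))// ler_wpM2r//.
  exact: ler_norm.
apply: bern_dist => // k.
rewrite [leRHS]addrAC.
apply: bern_dist => // l.
rewrite (le_trans (HK _ _ _ _ xL yL (xsL _) (xsL _)))// -addrA lerD2l -mulrDr /K' -mulrA.
by rewrite ler_wpM2l// mulrDr lerD// sq.
Qed.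

End exponential_tensors.

(** * From generating functions to bounded continuous test functions *)

Section mgf_convergence.
Context {R : realType} (d : nat -> measure_display)
  (T : forall n, measurableType (d n)) (P : forall n, probability (T n) R)
  (U V : forall n, T n -> R) (d' : measure_display) (O : measurableType d')
  (Q : probability O R) (X Y : O -> R).
Arguments U : clear implicits.
Arguments V : clear implicits.
Hypotheses (mU : forall n, measurable_fun setT (U n))
  (mV : forall n, measurable_fun setT (V n))
  (mX : measurable_fun setT X) (mY : measurable_fun setT Y).
Hypothesis mgf_fin : forall l m,
  Q.-integrable setT (fun w => (expR (l * X w + m * Y w))%:E).
Hypothesis mgf_cvg : forall l m,
  (\int[P n]_w (expR (l * U n w + m * V n w))%:E @[n --> \oo] -->
   \int[Q]_w (expR (l * X w + m * Y w))%:E)%E.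

Lemma cvg_expect_prod f g : exp_approximable f -> exp_approximable g ->
  cvg_expect P U V Q X Y (fun x y => f x * g y).
Proof.
move=> [mf [c1 c10 a1]] [mg [c2 c20 a2]].
have [C1 [d1 [C10 d10 b1]]] := exp_approx_bound c10 a1.
have [C2 [d2 [C20 d20 b2]]] := exp_approx_bound c20 a2.
pose c := c1 + c2 + d1 + d2.
have cW := cvg_expect_weight mU mV mgf_fin mgf_cvg c.
apply: (cvg_expect_approx mU mV mX mY _ cW) => [|e e0].
  apply: measurable_funM; first exact: (measurableT_comp mf measurable_fst).
  exact: (measurableT_comp mg measurable_snd).
pose K := C1 + C2 + 2.
have K0 : 0 < K by rewrite /K ltr_wpDl// addr_ge0.
pose e' := Num.min 1 (e / K).
have e'0 : 0 < e' by rewrite lt_min ltr01 divr_gt0.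
have e'1 : e' <= 1 by rewrite ge_min lexx.
have e'K : K * e' <= e by rewrite mulrC -ler_pdivlMr// ge_min lexx orbT.
have [h1 eh1 gh1] := a1 _ e'0; have [h2 eh2 gh2] := a2 _ e'0.
exists (fun x y => h1 x * h2 y); first exact: cvg_expect_expsum.
move=> x y.
have up p (z : R) : p <= c -> expR (p * `|z|) <= expR (c * z) + expR (- c * z).
  move=> pc; rewrite (le_trans _ (expR_norm_le c z))// ler_expR ler_wpM2r//.
set Ex := expR (c * x) + expR (- c * x) in up *.
set Ey := expR (c * y) + expR (- c * y) in up *.
have Ex0 : 0 <= Ex by rewrite addr_ge0// expR_ge0.
have Ey0 : 0 <= Ey by rewrite addr_ge0// expR_ge0.
have F1 : `|f x| <= C1 * Ex.
  by rewrite (le_trans (b1 x))// ler_wpM2l// up// /c; lra.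
have D1 : `|f x - h1 x| <= e' * Ex.
  by rewrite (le_trans (gh1 x))// ler_wpM2l ?(ltW e'0)// up// /c; lra.
have D2 : `|g y - h2 y| <= e' * Ey.
  by rewrite (le_trans (gh2 y))// ler_wpM2l ?(ltW e'0)// up// /c; lra.
have F2 : `|h2 y| <= (C2 + 1) * Ey.
  rewrite -(subrK (g y) (h2 y)) addrC (le_trans (ler_normD _ _))// mulrDl lerD//.
    by rewrite (le_trans (b2 y))// ler_wpM2l// up// /c; lra.
  by rewrite distrC (le_trans D2)// ler_wpM2r.
rewrite /exp_weight -/Ex -/Ey.
rewrite (_ : _ - _ = f x * (g y - h2 y) + (f x - h1 x) * h2 y); last by ring.
apply: (@le_trans _ _ (K * e' * (Ex * Ey))); last by rewrite ler_wpM2r// mulr_ge0.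
apply: (@le_trans _ _ (C1 * Ex * (e' * Ey) + e' * Ex * ((C2 + 1) * Ey))).
  by rewrite (le_trans (ler_normD _ _))// !normrM lerD// ler_pM.
rewrite -subr_ge0 (_ : _ - _ = e' * (Ex * Ey)); last by rewrite /K; ring.
by rewrite !mulr_ge0// ltW.
Qed.

Lemma cvg_expect_tensor p : exp_tensor p -> cvg_expect P U V Q X Y p.
Proof.
by elim=> [f g|{}p q _ IH _ IH']; [exact: cvg_expect_prod|exact: cvg_expectD].
Qed.

Lemma cvg_expect_bounded (f : R * R -> R) (M : R) : continuous f ->
  (forall z, `|f z| <= M) -> cvg_expect P U V Q X Y (fun x y => f (x, y)).
Proof.
move=> cf fM.
have cW := cvg_expect_weight mU mV mgf_fin mgf_cvg 1.
apply: (cvg_expect_approx mU mV mX mY _ cW) => [|e e0]; last first.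
  have [p tp fp] := exp_tensor_dense cf fM e0.
  by exists p; [exact: cvg_expect_tensor|].
(* Choosing a tensor for each error 1 / (n + 1) presents [f] as a pointwise limit of functions
   measurable for the product sigma-algebra, hence measurable. *)
have pe n : {p | exp_tensor p & forall x y, `|f (x, y) - p x y| <= n.+1%:R^-1 * exp_weight 1 x y}.
  by apply: cid2; apply: (exp_tensor_dense cf fM).
apply: (@measurable_fun_cvg _ _ _ setT (fun n (z : R * R) => s2val (pe n) z.1 z.2)).
- by move=> n; apply: exp_tensor_measurable; exact: (s2valP (pe n)).
- move=> [x y] _ /=; apply/cvgrPdist_le => e e0.
  have w0 : 0 <= exp_weight 1 x y by rewrite mulr_ge0// addr_ge0// expR_ge0.
  have c0 : n.+1%:R^-1 * exp_weight 1 x y @[n --> \oo] --> (0 : R).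
    rewrite -[X in _ --> X](mul0r (exp_weight 1 x y)).
    by apply: cvgM; [exact: cvg_harmonic|exact: cvg_cst].
  move/cvgrPdist_le : c0 => /(_ _ e0); apply: filterS => n.
  rewrite sub0r normrN => h; rewrite (le_trans (s2valP' (pe n) x y))//.
  by rewrite (le_trans (ler_norm _)).
Qed.

End mgf_convergence.

(** * The normal and Jacobi laws *)

Section density.
Context d (T : measurableType d) (R : realType)
  (mu : {measure set T -> \bar R}).
Local Open Scope ereal_scope.
Import HBNNSimple.

(** Agreement on measurable sets passes to simple functions by linearity and to nonnegative
    functions by monotone convergence. *)
Lemma ge0_integral_density (nu : {measure set T -> \bar R}) (w : T -> R) (D : set T) (g : T -> \bar R) :
  measurable D -> measurable_fun D w -> (forall x, D x -> (0 <= w x)%R) ->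
  (forall A, measurable A -> nu A = \int[mu]_(x in A `&` D) (w x)%:E) ->
  measurable_fun setT g -> (forall x, 0 <= g x) ->
  \int[nu]_x g x = \int[mu]_(x in D) (g x * (w x)%:E).
Proof.
move=> mD mw w0 nuE mg g0.
have mgD := measurable_funTS mg : measurable_fun D g.
have mwE : measurable_fun D (EFin \o w) by exact/measurable_EFinP.
pose h := nnsfun_approx measurableT mg.
have hg x : (h n x)%:E @[n --> \oo] --> g x.
  by apply: (cvg_nnsfun_approx measurableT mg).
have nd x : {homo (fun n => (h n x)%:E) : m n / (m <= n)%N >-> m <= n}.
  by move=> m n mn; rewrite lee_fin; exact/lefP/nd_nnsfun_approx.
have mh n : measurable_fun D (EFin \o h n) by apply/measurable_EFinP/measurable_funTS.
transitivity (lim (\int[nu]_x (h n x)%:E @[n --> \oo])).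
  rewrite -monotone_convergence//; last 2 first.
  - by move=> n; apply/measurable_EFinP.
  - by move=> n x _; rewrite lee_fin.
  by apply: eq_integral => x _; apply/esym/cvg_lim.
transitivity (lim (\int[mu]_(x in D) ((h n x)%:E * (w x)%:E) @[n --> \oo])); last first.
  rewrite -monotone_convergence//; first last.
  - by move=> x Dx m n mn; rewrite lee_wpmul2r ?lee_fin ?w0//; exact/lefP/nd_nnsfun_approx.
  - by move=> n x Dx; rewrite mule_ge0// lee_fin ?w0.
  - by move=> n; apply: emeasurable_funM => //; exact: mh.
  by apply: eq_integral => x _; apply: cvg_lim => //; apply: cvgeZr.
congr (limn _); apply/funext => n.
transitivity (\int[nu]_x (\sum_(y \in range (h n)) (y * \1_(h n @^-1` [set y]) x)%:E)).
  by apply: eq_integral => t tE; rewrite /= fimfunE -fsumEFin.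
rewrite ge0_integral_fsum//; last 2 first.
- by move=> r; apply/measurable_EFinP; exact: measurable_funM.
- by move=> m y Ey; exact: nnfun_muleindic_ge0.
transitivity (\int[mu]_(x in D) (\sum_(y \in range (h n))
    (y * \1_(h n @^-1` [set y]) x)%:E * (w x)%:E)); last first.
  apply: eq_integral => x; rewrite inE => Dx.
  rewrite -ge0_mule_fsuml => [|y]; last exact: nnfun_muleindic_ge0.
  by rewrite fsumEFin // -(fimfunE _ x).
rewrite ge0_integral_fsum//; last 2 first.
- move=> y; apply: emeasurable_funM => //; apply/measurable_EFinP.
  by apply: measurable_funM => //.
- move=> m y Ey; apply: mule_ge0; last by rewrite lee_fin w0.
  exact: nnfun_muleindic_ge0.
apply: eq_fsbigr => r; rewrite inE => -[t _ rE].
have r0 : (0 <= r)%R by rewrite -rE.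
have mA : measurable (h n @^-1` [set r]) by exact: measurable_sfunP.
under eq_integral do rewrite EFinM.
rewrite ge0_integralZl ?lee_fin//; last exact/measurable_EFinP.
rewrite integral_indic// setIT nuE//.
under [RHS]eq_integral do rewrite EFinM -muleA.
rewrite [RHS]ge0_integralZl ?lee_fin//; last 2 first.
- by apply: emeasurable_funM => //; exact/measurable_EFinP.
- by move=> x Dx; rewrite mule_ge0 ?lee_fin ?w0.
congr (_ * _); rewrite setIC integral_mkcondr.
by apply: eq_integral => x _; rewrite [RHS]muleC epatch_indic.
Qed.

Lemma ge0_integral_law d' (S : measurableType d') (P : {measure set S -> \bar R})
    (X : S -> T) (w : T -> R) (D : set T) (g : T -> \bar R) :
  measurable_fun setT X ->
  measurable D -> measurable_fun D w -> (forall x, D x -> (0 <= w x)%R) ->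
  (forall A, measurable A -> P (X @^-1` A) = \int[mu]_(x in A `&` D) (w x)%:E) ->
  measurable_fun setT g -> (forall x, 0 <= g x) ->
  \int[P]_s g (X s) = \int[mu]_(x in D) (g x * (w x)%:E).
Proof.
move=> mX mD mw w0 PE mg g0.
pose Y : {mfun S >-> T} := mfun_Sub (mem_set mX).
transitivity (\int[pushforward P Y]_y g y); last exact: ge0_integral_density.
by rewrite (ge0_integral_pushforward mX).
Qed.

End density.

(** * Generating function of the independent normal pair *)

Section normal_mgf.
Context {R : realType} d (O : measurableType d) (Q : probability O R).
Local Open Scope ereal_scope.

(** Completing the square: exp (l x) times the centred density is exp (l^2 / 2) times the density
    with mean l, whose integral is 1. *)
Lemma normal_mgf (N : {RV Q >-> R}) (l : R) : has_law N (normal_prob (0 : R) 1) ->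
  \int[Q]_w (expR (l * N w))%:E = (expR (l ^+ 2 / 2))%:E.
Proof.
move=> hN.
have me : measurable_fun setT (fun x : R => (expR (l * x))%:E).
  by apply/measurable_EFinP; apply: measurableT_comp => //; exact: measurable_funM.
have e0 (x : R) : 0 <= (expR (l * x))%:E by rewrite lee_fin expR_ge0.
have mN : measurable_fun setT (N : O -> measurableTypeR R) by exact: (@measurable_funPT _ _ _ _ N).
have -> := @ge0_integral_law _ (measurableTypeR R) R lebesgue_measure _ _ Q N (normal_pdf 0 1) setT _
  mN measurableT _ _ _ me e0; first last.
- by move=> A mA; rewrite setIT; exact: hN.
- by move=> x _; exact: normal_pdf_ge0.
- exact: measurable_normal_pdf.
transitivity (\int[lebesgue_measure]_x ((expR (l ^+ 2 / 2))%:E * (normal_pdf l 1 x)%:E)).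
  apply: eq_integral => x _; rewrite -!EFinM; congr EFin.
  rewrite !normal_pdfE ?oner_eq0// mulrCA [RHS]mulrCA; congr (_ * _)%R.
  rewrite /normal_fun -!expRD; congr expR.
  by rewrite expr1n; field.
rewrite ge0_integralZl ?lee_fin ?expR_ge0//; first last.
- by move=> x _; rewrite lee_fin normal_pdf_ge0.
- by apply/measurable_EFinP; exact: measurable_normal_pdf.
by rewrite integral_normal_pdf mule1.
Qed.

(** Independence says that the joint law and the product of the marginals agree on rectangles, hence
    everywhere; Tonelli then splits the integral. *)
Lemma independent_mgf (X Y : {RV Q >-> R}) (l m : R) : independent_RV2 X Y ->
  \int[Q]_w (expR (l * X w + m * Y w))%:E =
  \int[Q]_w (expR (l * X w))%:E * \int[Q]_w (expR (m * Y w))%:E.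
Proof.
move=> iXY.
have mXY : measurable_fun setT (fun w => (X w, Y w)) by exact: measurable_fun_pair.
pose XY : {mfun O >-> (R * R)%type} := mfun_Sub (mem_set mXY).
have me (c : R) : measurable_fun setT (fun x : R => (expR (c * x))%:E).
  by apply/measurable_EFinP; apply: measurableT_comp => //; exact: measurable_funM.
have e0 (c x : R) : 0 <= (expR (c * x))%:E by rewrite lee_fin expR_ge0.
have nuE A : measurable A -> (distribution Q X \x distribution Q Y) A = pushforward Q XY A.
  by apply: product_measure_unique => A' B mA mB; exact: iXY.
pose f (z : R * R) := (expR (l * z.1))%:E * (expR (m * z.2))%:E.
have mf : measurable_fun setT f.
  apply: emeasurable_funM; first exact: (measurableT_comp (me l) measurable_fst).
  exact: (measurableT_comp (me m) measurable_snd).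
have f0 z : 0 <= f z by rewrite mule_ge0.
transitivity (\int[pushforward Q XY]_z f z).
  rewrite (ge0_integral_pushforward mXY)//.
  by apply: eq_integral => w _; rewrite /f /= expRD EFinM.
transitivity (\int[distribution Q X \x distribution Q Y]_z f z).
  by apply: eq_measure_integral => A mA _; exact/esym/nuE.
rewrite fubini_tonelli1//.
transitivity (\int[distribution Q X]_x ((expR (l * x))%:E * \int[distribution Q Y]_y (expR (m * y))%:E)).
  by apply: eq_integral => x _; rewrite /fubini_F /f /= ge0_integralZl.
rewrite ge0_integralZr//; last exact: integral_ge0.
by rewrite (ge0_integral_distribution X (me l) (e0 l)) (ge0_integral_distribution Y (me m) (e0 m)).
Qed.

End normal_mgf.

Lemma measurable_det_plus {R : realType} n : measurable_fun setT (@det_plus R n).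
Proof.
apply: measurable_prod => i _; apply: measurable_funB => //; exact: measurable_tnth.
Qed.

Lemma measurable_det_minus {R : realType} n : measurable_fun setT (@det_minus R n).
Proof.
apply: measurable_prod => i _; apply: measurable_funD => //; exact: measurable_tnth.
Qed.

(** * Exponential moments of the log-determinants as ratios of Selberg integrals *)

Section jacobi_law_moments.
Context {R : realType} (beta a b : R) (n : nat).
Hypotheses (beta_gt0 : 0 < beta) (a_ge0 : 0 <= a) (b_ge0 : 0 <= b).
Context d (T : measurableType d) (P : probability T R) (X : {RV P >-> (n.-tuple R)}).
Hypothesis X_jacobi : has_law X (@jacobi_law R beta a b n).

Lemma jacobi_weight_shift s r (x : n.-tuple R) : jacobi_support x ->
  expR (s * ln (det_plus x) + r * ln (det_minus x)) * jacobi_weight beta a b x =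
  jacobi_weight beta (a + s) (b + r) x.
Proof.
move=> xD; have xp j : 0 < 2 - tnth x j by have /andP[_] := xD j; rewrite subr_gt0.
have xm j : 0 < 2 + tnth x j by have /andP[+ _] := xD j; rewrite -ltrBlDl sub0r.
rewrite /det_plus /det_minus !ln_prod// !mulr_sumr -big_split/= expR_sum.
rewrite /jacobi_weight mulrCA -big_split; congr (_ * _); apply: eq_bigr => j _ /=.
have pw (t u v : R) : 0 < t -> t `^ (u + v) = t `^ u * expR (v * ln t).
  by move=> t0; rewrite /powR gt_eqF// mulrDl expRD.
by rewrite !pw// expRD; ring.
Qed.

Lemma jacobi_law_density (A : set (n.-tuple R)) : measurable A ->
  (P (X @^-1` A) = \int[lebesgue_tuple n]_(x in A `&` @jacobi_support R n)
     (jacobi_cst beta a b n * jacobi_weight beta a b x)%:E)%E.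
Proof.
have a1 : -1 < a by rewrite (lt_le_trans _ a_ge0)// ltrN10.
have b1 : -1 < b by rewrite (lt_le_trans _ b_ge0)// ltrN10.
have /integrableP[mw _] := @integrable_jacobi_weight R n beta beta_gt0 a b a1 b1.
move=> mA; rewrite [LHS]X_jacobi// /jacobi_law.
have mAD : measurable (A `&` @jacobi_support R n).
  by apply: measurableI => //; exact: measurable_jacobi_support.
under [RHS]eq_integral do rewrite EFinM.
rewrite ge0_integralZl//.
- by apply: measurable_funS mw => //; exact: measurable_jacobi_support.
- by move=> x _; rewrite lee_fin jacobi_weight_ge0.
- rewrite lee_fin invr_ge0 fine_ge0// integral_ge0// => x _.
  by rewrite lee_fin jacobi_weight_ge0.
Qed.

Lemma jacobi_cstE : jacobi_cst beta a b n = (@jacobi_int R n beta a b)^-1.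
Proof. by []. Qed.

(** If Z were 0, the constant would be 0^-1 = 0 and the law would have mass 0, whereas it is the law
    of a random variable. Positivity thus costs no computation. *)
Lemma jacobi_int_law_gt0 : 0 < @jacobi_int R n beta a b.
Proof.
have Z0 : 0 <= @jacobi_int R n beta a b.
  by apply: Rintegral_ge0 => x _; exact: jacobi_weight_ge0.
rewrite lt0r Z0 andbT; apply/eqP => Z; have := probability_setT P.
rewrite -(preimage_setT X) jacobi_law_density// jacobi_cstE Z invr0.
under eq_integral do rewrite mul0r.
by rewrite integral0 => /eqP; rewrite eq_sym onee_eq0.
Qed.

Lemma jacobi_law_moment s r : -1 < a + s -> -1 < b + r ->
  (\int[P]_w (expR (s * ln (det_plus (X w)) + r * ln (det_minus (X w))))%:E =
   (@jacobi_int R n beta (a + s) (b + r) / @jacobi_int R n beta a b)%:E)%E.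
Proof.
move=> as1 br1; have mD := @measurable_jacobi_support R n.
have a1 : -1 < a by rewrite (lt_le_trans _ a_ge0)// ltrN10.
have b1 : -1 < b by rewrite (lt_le_trans _ b_ge0)// ltrN10.
have iw := @integrable_jacobi_weight R n beta beta_gt0 a b a1 b1.
have iw' := @integrable_jacobi_weight R n beta beta_gt0 _ _ as1 br1.
have Z0 := jacobi_int_law_gt0.
have mw : measurable_fun (@jacobi_support R n) (@jacobi_weight R beta a b n).
  by apply/measurable_EFinP; exact: measurable_int iw.
pose g (x : n.-tuple R) := (expR (s * ln (det_plus x) + r * ln (det_minus x)))%:E.
have mg : measurable_fun setT g.
  apply/measurable_EFinP; apply: measurableT_comp => //; apply: measurable_funD.
    apply: measurable_funM => //.
    by apply: (measurableT_comp (@measurable_ln R)); exact: measurable_det_plus.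
  apply: measurable_funM => //.
  by apply: (measurableT_comp (@measurable_ln R)); exact: measurable_det_minus.
have g0 x : (0 <= g x)%E by rewrite lee_fin expR_ge0.
have mX : measurable_fun setT (X : T -> n.-tuple R) by [].
have mcw : measurable_fun (@jacobi_support R n)
    (fun x => jacobi_cst beta a b n * jacobi_weight beta a b x).
  by apply: measurable_funM.
have cw0 x : @jacobi_support R n x -> 0 <= jacobi_cst beta a b n * jacobi_weight beta a b x.
  by move=> _; rewrite mulr_ge0 ?jacobi_weight_ge0// jacobi_cstE invr_ge0 ltW.
rewrite (ge0_integral_law mX mD mcw cw0 jacobi_law_density mg g0).
transitivity (\int[lebesgue_tuple n]_(x in @jacobi_support R n)
    ((jacobi_cst beta a b n)%:E * (jacobi_weight beta (a + s) (b + r) x)%:E))%E.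
  apply: eq_integral => x; rewrite inE => xD.
  by rewrite /g -!EFinM -jacobi_weight_shift// mulrCA.
rewrite integralZl// jacobi_cstE mulrC EFinM; congr (_ * _)%E.
by rewrite fineK// integrable_fin_num.
Qed.

End jacobi_law_moments.

Lemma measurable_normalized_log {R : realType} (beta c : R) n :
  measurable_fun setT (normalized_log beta c n).
Proof.
apply: measurable_funM => //; apply: measurable_funD => //; exact: measurable_ln.
Qed.

(** * Limit of the normalised generating functions *)

Section jacobi_mgf.
Context {R : realType} (beta a b : R).
Hypotheses (beta_gt0 : 0 < beta) (a_ge0 : 0 <= a) (b_ge0 : 0 <= b).
Context (d : nat -> measure_display) (T : forall n, measurableType (d n))
  (P : forall n, probability (T n) R) (X : forall n, {RV (P n) >-> (n.-tuple R)}).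
Hypothesis X_jacobi : forall n, (1 <= n)%N -> has_law (X n) (@jacobi_law R beta a b n).

Let sigma n := Num.sqrt (2 / beta * ln (n%:R : R)).

Lemma near_lt_sigma (q : R) : 0 <= q -> \forall n \near \oo, q < sigma n.
Proof.
move=> q0; apply: filterS (nbhs_infty_gtr (expR (q ^+ 2 * (beta / 2)))) => n qn.
have k0 : 0 < beta / 2 by rewrite divr_gt0.
have n0 : 0 < n%:R :> R by rewrite (lt_trans (expR_gt0 _) qn).
have ql : q ^+ 2 * (beta / 2) < ln n%:R.
  by rewrite -ltr_expR (lnK n0).
rewrite -(ger0_norm q0) -sqrtr_sqr ltr_sqrt; last first.
  by rewrite -[2 / beta]invf_div mulr_gt0 ?invr_gt0// (le_lt_trans _ ql)// mulr_ge0 ?sqr_ge0// ltW.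
by rewrite -[2 / beta]invf_div mulrC ltr_pdivlMr.
Qed.

(** Put s = l / sigma, r = m / sigma and ln n = sigma^2 beta / 2 in the expansion of ln Z. The
    linear terms cancel against the centring, the quadratic ones become (l^2 + m^2) / 2, and the
    error is O(1 / sigma). *)
Lemma jacobi_mgf_cvg (l m : R) :
  (\int[P n]_w (expR (l * normalized_log beta a n (det_plus (X n w)) +
                      m * normalized_log beta b n (det_minus (X n w))))%:E
    @[n --> \oo] --> (expR ((l ^+ 2 + m ^+ 2) / 2))%:E)%E.
Proof.
have [C HC] := jacobi_int_asymptotics beta_gt0 a_ge0 b_ge0.
pose Z n a' b' := @jacobi_int R n beta a' b'.
pose K n := ln (Z n (a + l / sigma n) (b + m / sigma n)) - ln (Z n a b)
  + (l / sigma n * (1 / 2 - (2 * a + 1) / beta) + m / sigma n * (1 / 2 - (2 * b + 1) / beta)) * ln n%:R.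
have small q n : 0 < sigma n -> 4 * `|q| < sigma n -> `|q / sigma n| <= 4^-1.
  by move=> s0 qs; rewrite normrM normfV (gtr0_norm s0) ler_pdivrMr// ler_pdivlMl// ltW.
have shift_id (z z' s : R) : 0 < s ->
    z - z' + (l / s * (1 / 2 - (2 * a + 1) / beta) + m / s * (1 / 2 - (2 * b + 1) / beta))
      * (s ^+ 2 * (beta / 2)) - (l ^+ 2 + m ^+ 2) / 2 =
    z - z' - (l / s * ((2 * a + 1) / beta - 1 / 2) + m / s * ((2 * b + 1) / beta - 1 / 2)
      + ((l / s) ^+ 2 + (m / s) ^+ 2) / beta) * (s ^+ 2 * (beta / 2)).
  by move=> s0; field; rewrite !gt_eqF.
have KC n : (0 < n)%N -> 0 < sigma n -> 4 * `|l| < sigma n -> 4 * `|m| < sigma n ->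
   `|K n - (l ^+ 2 + m ^+ 2) / 2| <= C * ((`|l| + `|m|) / sigma n).
  move=> n0 s0 ls ms.
  have := HC n _ _ n0 (small _ _ s0 ls) (small _ _ s0 ms)
    (jacobi_int_law_gt0 beta_gt0 a_ge0 b_ge0 (X_jacobi n0)).
  rewrite !normrM !normfV (gtr0_norm s0) -mulrDl; apply: le_trans.
  have s2 : ln n%:R = sigma n ^+ 2 * (beta / 2).
    rewrite sqr_sqrtr; last by move: s0; rewrite sqrtr_gt0 => /ltW.
    by rewrite -[2 / beta]invf_div mulrC mulrA mulfV ?mul1r// gt_eqF// divr_gt0.
  rewrite le_eqVlt; apply/orP; left; apply/eqP; congr `|_|.
  rewrite /K s2; exact: shift_id.
have Kl : K n @[n --> \oo] --> (l ^+ 2 + m ^+ 2) / 2.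
  apply/cvgrPdist_le => e e0.
  have ge0 : 0 <= 4 * `|l| + 4 * `|m| + `|C| * (`|l| + `|m|) / e.
    by rewrite !addr_ge0// ?mulr_ge0// ?addr_ge0// invr_ge0 ltW.
  apply: filterS2 (near_lt_sigma ge0) (nbhs_infty_ge 1) => n ns n0.
  have h1 : 0 <= 4 * `|l| by rewrite mulr_ge0.
  have h2 : 0 <= 4 * `|m| by rewrite mulr_ge0.
  have h3 : 0 <= `|C| * (`|l| + `|m|) / e by rewrite !mulr_ge0 ?addr_ge0// invr_ge0 ltW.
  have s0 : 0 < sigma n by apply: le_lt_trans ns.
  rewrite distrC (le_trans (KC n n0 s0 _ _))//.
  - by apply: le_lt_trans ns; rewrite -addrA lerDl addr_ge0.
  - by apply: le_lt_trans ns; rewrite addrAC lerDr addr_ge0.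
  rewrite mulrA ler_pdivrMr// (@le_trans _ _ (`|C| * (`|l| + `|m|)))//.
    by rewrite ler_wpM2r ?addr_ge0// ler_norm.
  rewrite -ler_pdivrMl// mulrC ltW//; apply: le_lt_trans ns.
  by rewrite lerDr addr_ge0.
(* The integral equals exp (K n) only for large n, once n >= 1 and both shifts are at most 1/4 in
   absolute value. *)
apply: (@cvg_trans _ ((expR (K n))%:E @[n --> \oo])); last first.
  by apply/cvg_EFinP; apply: cvg_comp Kl _; exact: continuous_expR.
apply: near_eq_cvg.
have ge0 : 0 <= 4 * `|l| + 4 * `|m| by rewrite addr_ge0// mulr_ge0.
apply: filterS2 (near_lt_sigma ge0) (nbhs_infty_ge 1) => n ns n0.
have h1 : 0 <= 4 * `|l| by rewrite mulr_ge0.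
have h2 : 0 <= 4 * `|m| by rewrite mulr_ge0.
have s0 : 0 < sigma n by apply: le_lt_trans ns.
have ls : `|l / sigma n| <= 4^-1 by apply: small => //; apply: le_lt_trans ns; rewrite lerDl.
have ms : `|m / sigma n| <= 4^-1 by apply: small => //; apply: le_lt_trans ns; rewrite lerDr.
have shift c q : 0 <= c -> `|q| <= 4^-1 -> -1 < c + q :> R.
  by rewrite ler_norml => c0 /andP[q4 _]; lra.
have as1 := shift _ _ a_ge0 ls; have bs1 := shift _ _ b_ge0 ms.
have hX := X_jacobi n0.
have Z0 := jacobi_int_law_gt0 beta_gt0 a_ge0 b_ge0 hX.
have a1 : -1 < a by rewrite (lt_le_trans _ a_ge0)// ltrN10.
have b1 : -1 < b by rewrite (lt_le_trans _ b_ge0)// ltrN10.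
have Z0' := jacobi_int_gt0 beta_gt0 a1 b1 as1 bs1 Z0.
pose q := (l / sigma n * (1 / 2 - (2 * a + 1) / beta) + m / sigma n * (1 / 2 - (2 * b + 1) / beta)) * ln n%:R.
transitivity (\int[P n]_w ((expR q)%:E * (expR (l / sigma n * ln (det_plus (X n w))
   + m / sigma n * ln (det_minus (X n w))))%:E))%E; last first.
  apply: eq_integral => w _; rewrite -EFinM -expRD; congr (expR _)%:E.
  by rewrite /normalized_log -/(sigma n) /q; ring.
rewrite ge0_integralZl//; last first.
  apply/measurable_EFinP; apply: measurableT_comp => //; apply: measurable_funD; apply: measurable_funM => //.
    apply: (measurableT_comp (@measurable_ln R)).
    by apply: (measurableT_comp (@measurable_det_plus R n)).
  apply: (measurableT_comp (@measurable_ln R)).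
  by apply: (measurableT_comp (@measurable_det_minus R n)).
rewrite (jacobi_law_moment beta_gt0 a_ge0 b_ge0 hX as1 bs1) -EFinM; congr EFin.
rewrite /K expRD expRB [LHS]mulrC; congr (_ * (_ / _)).
  exact: (lnK Z0').
exact: (lnK Z0).
Qed.

End jacobi_mgf.

Theorem theorem5p3 (R : realType) (beta a b : R)
    (beta_gt0 : 0 < beta) (a_ge0 : 0 <= a) (b_ge0 : 0 <= b)
    (d : nat -> measure_display) (T : forall n, measurableType (d n))
    (P : forall n, probability (T n) R)
    (X : forall n, {RV (P n) >-> (n.-tuple R)})
    (X_jacobi : forall n, (1 <= n)%N ->
       has_law (X n) (@jacobi_law R beta a b n))
    (d' : measure_display) (O : measurableType d') (Q : probability O R)
    (N1 N2 : {RV Q >-> R})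
    (N1_normal : has_law N1 (normal_prob (0 : R) 1))
    (N2_normal : has_law N2 (normal_prob (0 : R) 1))
    (N1_N2_independent : independent_RV2 N1 N2) :
  cvg_in_law P
    (fun n w => (normalized_log beta a n (det_plus (X n w)),
                 normalized_log beta b n (det_minus (X n w))))
    Q (fun w => (N1 w, N2 w)).
Proof.
move=> f cf [M0 [_ fM0]].
have fM z : `|f z| <= M0 + 1 by apply: (fM0 (M0 + 1)); rewrite ?ltrDl.
have mN1 : measurable_fun setT N1 by [].
have mN2 : measurable_fun setT N2 by [].
have mU n : measurable_fun setT (fun w => normalized_log beta a n (det_plus (X n w))).
  apply: (measurableT_comp (measurable_normalized_log beta a n)).
  by apply: (measurableT_comp (@measurable_det_plus R n)).
have mV n : measurable_fun setT (fun w => normalized_log beta b n (det_minus (X n w))).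
  apply: (measurableT_comp (measurable_normalized_log beta b n)).
  by apply: (measurableT_comp (@measurable_det_minus R n)).
have mgfE l m : (\int[Q]_w (expR (l * N1 w + m * N2 w))%:E =
    (expR ((l ^+ 2 + m ^+ 2) / 2))%:E)%E.
  rewrite independent_mgf// (normal_mgf l N1_normal) (normal_mgf m N2_normal).
  by rewrite -EFinM -expRD mulrDl.
have mgf_fin l m : Q.-integrable setT (fun w => (expR (l * N1 w + m * N2 w))%:E).
  apply/integrableP; split.
    apply/measurable_EFinP; apply: measurableT_comp => //.
    by apply: measurable_funD; apply: measurable_funM.
  under eq_integral do rewrite /= ger0_norm ?expR_ge0//.
  by rewrite mgfE ltry.
have mgf_cvg l m : (\int[P n]_w (expR (l * normalized_log beta a n (det_plus (X n w)) +
      m * normalized_log beta b n (det_minus (X n w))))%:E @[n --> \oo] -->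
    \int[Q]_w (expR (l * N1 w + m * N2 w))%:E)%E.
  by rewrite mgfE; exact: jacobi_mgf_cvg.
have [_ iQ iP cv] := cvg_expect_bounded mU mV mN1 mN2 mgf_fin mgf_cvg cf fM.
rewrite unlock.
have -> : (\int[Q]_w ((f \o (fun w => (N1 w, N2 w))) w)%:E =
    (\int[Q]_w f (N1 w, N2 w))%:E)%E.
  by rewrite /Rintegral fineK// integrable_fin_num.
move/cvg_EFinP : cv; apply: cvg_trans; apply: near_eq_cvg.
apply: filterS iP => n iPn.
by rewrite /Rintegral fineK ?integrable_fin_num// unlock.
Qed.
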